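(* Let $g\in H(\mathbb{D})$ be such that $\log(g)\in\mathcal{B}$, let $\nu$ be a weight that is analytic and quasi-normal, and let $\mu$ be an arbitrary weight. Then $S_g: H^{\infty}_\nu\rightarrow H^{\infty}_\mu$ is compact if and only if $$\lim_{t_2\rightarrow1^-}\limsup_{t_1\rightarrow1^-}\sup_{0\leq\theta<2\pi}\mu(t_1)\int_{t_2}^{t_1}\frac{|g(re^{i\theta})|}{(1-r^2)\nu(r)}\,dr=0\,.$$
   Context: $\mathbb{D}$ is the open unit disk and $H(\mathbb{D})$ the space of analytic functions on $\mathbb{D}$. A weight is a non-negative continuous function $\nu$ on $\mathbb{D}$ with $\nu(z)=\nu(|z|)$ for all $z$, which is decreasing in $|z|$; we write $\nu(r)$ for its value at $|z|=r$. For a weight $\nu$: $H^{\infty}_\nu=\{f\in H(\mathbb{D}): \sup_{z}\nu(z)|f(z)|<\infty\}$, $H^{0}_\nu=\{f\in H(\mathbb{D}): \lim_{|z|\to1^-}\nu(z)|f(z)|=0\}$, $\mathcal{B}^{0}_\nu=\{f\in H(\mathbb{D}): \lim_{|z|\to1^-}\nu(z)|f'(z)|=0\}$. The Bloch space is $\mathcal{B}=\{f\in H(\mathbb{D}): |f(0)|+\sup_{z}(1-|z|^2)|f'(z)|<\infty\}$; ''$\log(g)\in\mathcal{B}$'' means $g$ has no zeros in $\mathbb{D}$ and an analytic branch of $\log g$ belongs to $\mathcal{B}$. A weight $\nu$ is analytic if $\nu(z)=1/F(|z|)$ for some $F\in H(\mathbb{D})$ with $|F(z)|\leq F(|z|)$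 for all $z$. A weight $\nu$ is quasi-normal if $H^0_{\nu}=\mathcal{B}^0_{\nu_1}$ where $\nu_1(z)=\nu(z)(1-|z|^2)$. For $g\in H(\mathbb{D})$, $(S_gf)(z)=\int_0^z f'(\omega)g(\omega)\,d\omega$. *)

(* Defs.v *)
From Stdlib Require Import Reals.
From Coquelicot Require Import Coquelicot.
Open Scope R_scope.

Definition inD (z : C) : Prop := Cmod z < 1.

Definition holo (f : C -> C) : Prop :=
  forall z, inD z -> ex_derive (K := C_AbsRing) (V := C_NormedModule) f z.

Definition cderiv (f : C -> C) : C -> C := C_derive f.

Definition cexp (z : C) : C :=
  (exp (Re z) * cos (Im z), exp (Re z) * sin (Im z)).

Definition polar (r theta : R) : C := (r * cos theta, r * sin theta).

(* A weight, given by its radial profile nu : [0,1) -> R, nu(z) = nu(|z|):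
   non-negative, continuous on D (as z |-> nu(|z|)), decreasing in |z|. *)
Definition weight (nu : R -> R) : Prop :=
  (forall r, 0 <= r < 1 -> 0 <= nu r) /\
  (forall z : C, inD z -> continuous (fun w : C => nu (Cmod w)) z) /\
  (forall r s, 0 <= r -> r <= s -> s < 1 -> nu s <= nu r).

Definition Hinf (nu : R -> R) (f : C -> C) : Prop :=
  holo f /\ exists M, forall z, inD z -> nu (Cmod z) * Cmod (f z) <= M.

Definition H0 (nu : R -> R) (f : C -> C) : Prop :=
  holo f /\ forall eps, 0 < eps -> exists r0, r0 < 1 /\
    forall z, r0 < Cmod z < 1 -> nu (Cmod z) * Cmod (f z) < eps.

Definition B0 (nu : R -> R) (f : C -> C) : Prop :=
  holo f /\ forall eps, 0 < eps -> exists r0, r0 < 1 /\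
    forall z, r0 < Cmod z < 1 -> nu (Cmod z) * Cmod (cderiv f z) < eps.

Definition Bloch (h : C -> C) : Prop :=
  holo h /\ exists M, forall z, inD z ->
    (1 - Cmod z ^ 2) * Cmod (cderiv h z) <= M.

Definition log_in_Bloch (g : C -> C) : Prop :=
  (forall z, inD z -> g z <> 0%C) /\
  exists h : C -> C, holo h /\ (forall z, inD z -> cexp (h z) = g z) /\ Bloch h.

Definition analytic_weight (nu : R -> R) : Prop :=
  weight nu /\ exists F : C -> C, holo F /\
    (forall r, 0 <= r < 1 -> (RtoC (nu r) * F (RtoC r))%C = 1%C) /\
    (forall z, inD z -> Cmod (F z) <= Re (F (RtoC (Cmod z)))).

Definition quasi_normal (nu : R -> R) : Prop :=
  weight nu /\
  forall f : C -> C, H0 nu f <-> B0 (fun r => nu r * (1 - r ^ 2)) f.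

(* (S_g f)(z) = int_0^z f'(w) g(w) dw, along the segment [0,z] *)
Definition Sg (g f : C -> C) (z : C) : C :=
  RInt (V := C_R_CompleteNormedModule)
    (fun t : R => (cderiv f (RtoC t * z) * g (RtoC t * z) * z)%C) 0 1.

Definition Sg_compact (g : C -> C) (nu mu : R -> R) : Prop :=
  (forall f, Hinf nu f -> Hinf mu (Sg g f)) /\
  forall fs : nat -> C -> C,
    (forall n, Hinf nu (fs n)) ->
    (exists M, forall n z, inD z -> nu (Cmod z) * Cmod (fs n z) <= M) ->
    exists phi : nat -> nat, (forall n, (phi n < phi (S n))%nat) /\
    exists h : C -> C, Hinf mu h /\
      forall eps, 0 < eps -> exists N, forall n, (N <= n)%nat ->
        forall z, inD z ->
          mu (Cmod z) * Cmod (Sg g (fs (phi n)) z - h z)%C <= eps.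

(* lim_{t2->1-} limsup_{t1->1-} sup_theta mu(t1) int_{t2}^{t1}
     |g(r e^{i theta})| / ((1-r^2) nu(r)) dr = 0,
   written out with epsilons (the quantity is non-negative). *)
Definition limit_condition (g : C -> C) (nu mu : R -> R) : Prop :=
  forall eps, 0 < eps -> exists a, 0 <= a < 1 /\
    forall t2, a < t2 < 1 -> exists b, t2 <= b < 1 /\
      forall t1, b < t1 < 1 -> forall theta, 0 <= theta < 2 * PI ->
        mu t1 * RInt (fun r => Cmod (g (polar r theta)) / ((1 - r ^ 2) * nu r))
                     t2 t1 <= eps.

(* Main.v *)
Require Import Defs.
From Stdlib Require Import Reals ZArith List Lra Lia Psatz Classical ClassicalEpsilon.
From Coquelicot Require Import Coquelicot.
Open Scope R_scope.

(* Quasi-normality enters through two growth estimates, both obtained by a gliding hump on the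
   dilates of the majorant F = 1/nu.  First, (1-r^2) F'(r) <= K F(r); hence nu is doubling and
   Cauchy's estimate gives |f'| <= C |f|_nu / ((1-|z|^2) nu).  Second, the integral over [0,r] of
   F(s)/(1-s^2) is at most K F(r); hence |f'| <= C / ((1-|z|^2) nu) forces f into H^oo_nu.
   Sufficiency: take a locally uniform limit (Montel) and split the integral defining S_g along
   a ray at t2.
   Necessity: on a given ray, say [0,1), test with f' = z^n F(z)/(1-z^2) T(z), where T is the sum
   over k of c_k ((1-z^2)(1-p_k^2)/(1-p_k z)^2)^m with hyperbolically equidistant nodes p_k and
   phases c_k = exp(-i arg g(p_k)).  Since log g is a Bloch function, arg g is Lipschitz for the
   hyperbolic distance, so for a fine grid and a large m, Re (T g) >= c |g| on the ray, while
   |T| <= C on the disc whatever the number of nodes; the factor z^n makes f' tend to 0 locally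
   uniformly. *)

(** * Complex differentiability *)

(** Quasi-normality equates two sets of functions and carries no constants, so the growth estimates
    are extracted by contradiction. [F] itself cannot be fed into it: nu F = 1 on [0,1), so [F] is
    not in [H0 nu], whereas a dilate F(rho z) is bounded and lies there once nu is known to tend to
    0. Sums of such dilates cannot cancel at a point of [0,1), because [F], its derivative and the
    primitive of F/(1-z^2) have non-negative real part there. Necessity must produce the modulus |g|
    from an analytic integrand, although the conjugate phase of g is not analytic. The peak at p
    extends 1 - d(p,r)^2 analytically from [0,1), d being the pseudohyperbolic distance. In the
    variable x = ((1+r)/(1-r)) / ((1+p)/(1-p)) it reads 4x/(1+x)^2, so equidistant nodes are a
    geometric progression in x and their peaks sum like a geometric series. The exponent is m+1: one
    power pays for this summation, the other m make the distant peaks, whose phases are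
    uncontrolled, negligible against the nearest one. Only the number of nodes depends on the end
    point of the integral; no constant depends on the ray or on n. *)

Definition cdiff (f : C -> C) (z l : C) : Prop :=
  forall eps, 0 < eps -> exists del, 0 < del /\ forall w, Cmod (w - z) < del ->
    Cmod (f w - f z - l * (w - z)) <= eps * Cmod (w - z).

(** Real parameter, complex value: this is what remains of [cdiff] along a line, and it is the form
    consumed by the real and imaginary parts and by integrals over [0,1]. *)
Definition rdiff (c : R -> C) (t : R) (v : C) : Prop :=
  forall eps, 0 < eps -> exists del, 0 < del /\ forall s, Rabs (s - t) < del ->
    Cmod (c s - c t - RtoC (s - t) * v) <= eps * Rabs (s - t).

Lemma is_derive_cdiff (f : C -> C) (z l : C) :
  is_derive (K := C_AbsRing) (V := C_NormedModule) f z l <-> cdiff f z l.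
Proof.
  split.
  - intros [_ H] eps Heps.
    destruct (H z (fun P HP => HP) (mkposreal eps Heps)) as [d Hd].
    exists d; split; [apply cond_pos|]. intros w Hw.
    specialize (Hd w Hw).
    replace (f w - f z - l * (w - z))%C
      with (minus (minus (f w) (f z)) (scal (minus w z) l)); [exact Hd|].
    unfold minus, plus, opp, scal; simpl; unfold mult; simpl. ring.
  - intros H. split.
    + apply is_linear_scal_l.
    + intros x Hx.
      assert (E : x = z).
      { symmetry; apply (is_filter_lim_locally_unique (V := AbsRing_NormedModule C_AbsRing)); exact Hx. }
      subst x. intros eps. destruct (H eps (cond_pos eps)) as [d [Hd Hw]].
      exists (mkposreal d Hd). intros w Bw. specialize (Hw w Bw).
      replace (f w - f z - l * (w - z))%C
        with (minus (minus (f w) (f z)) (scal (minus w z) l)) in Hw; [exact Hw|].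
      unfold minus, plus, opp, scal; simpl; unfold mult; simpl. ring.
Qed.

Lemma is_derive_rdiff (c : R -> C) (t : R) (v : C) :
  rdiff c t v -> is_derive (K := R_AbsRing) (V := C_R_NormedModule) c t v.
Proof.
  intros H. split; [apply is_linear_scal_l|]. intros x Hx.
  assert (E : x = t).
  { symmetry; apply (is_filter_lim_locally_unique (V := R_NormedModule)); exact Hx. }
  subst x. intros eps. destruct (H eps (cond_pos eps)) as [d [Hd Hw]].
  exists (mkposreal d Hd). intros w Bw. specialize (Hw w Bw). rewrite Cmod_norm in Hw.
  replace (c w - c t - RtoC (w - t) * v)%C
    with (minus (minus (c w) (c t)) (scal (minus w t) v)) in Hw; [exact Hw|].
  unfold minus, plus, opp; simpl. rewrite scal_R_Cmult. reflexivity.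
Qed.

Lemma is_derive_rdiff_linear (L : C -> R) (c : R -> C) (t : R) (v : C) :
  (forall x y s, L (x - y - RtoC s * v)%C = L x - L y - s * L v) ->
  (forall x, Rabs (L x) <= Cmod x) ->
  rdiff c t v -> is_derive (fun s => L (c s)) t (L v).
Proof.
  intros HL HB H. split; [apply is_linear_scal_l|]. intros x Hx.
  assert (E : x = t).
  { symmetry; apply (is_filter_lim_locally_unique (V := R_NormedModule)); exact Hx. }
  subst x. intros eps. destruct (H eps (cond_pos eps)) as [d [Hd Hw]].
  exists (mkposreal d Hd). intros w Bw. specialize (Hw w Bw).
  eapply Rle_trans; [|exact Hw]. eapply Rle_trans; [|apply HB]. rewrite HL. apply Rle_refl.
Qed.

Lemma im_le_Cmod (z : C) : Rabs (Im z) <= Cmod z.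
Proof. eapply Rle_trans; [apply Rmax_r|apply Rmax_Cmod]. Qed.

Lemma rdiff_Re (c : R -> C) (t : R) (v : C) : rdiff c t v -> is_derive (fun s => Re (c s)) t (Re v).
Proof.
  apply is_derive_rdiff_linear; [|apply re_le_Cmod].
  intros x y s. destruct x, y, v; unfold Re; simpl; ring.
Qed.

Lemma rdiff_Im (c : R -> C) (t : R) (v : C) : rdiff c t v -> is_derive (fun s => Im (c s)) t (Im v).
Proof.
  apply is_derive_rdiff_linear; [|apply im_le_Cmod].
  intros x y s. destruct x, y, v; unfold Im; simpl; ring.
Qed.

Lemma Cmod_minus_sym (a b : C) : Cmod (a - b) = Cmod (b - a).
Proof. replace (a - b)%C with (- (b - a))%C by ring. apply Cmod_opp. Qed.

Lemma Cmod_dist_triangle (a b c : C) : Cmod (a - c) <= Cmod (a - b) + Cmod (b - c).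
Proof. replace (a - c)%C with ((a - b) + (b - c))%C by ring. apply Cmod_triangle. Qed.

Lemma Cmod_triangle_minus (a b : C) : Cmod (a - b) <= Cmod a + Cmod b.
Proof. unfold Cminus. rewrite <- (Cmod_opp b). apply Cmod_triangle. Qed.

Lemma Cmod_triangle_inv (a b : C) : Cmod a - Cmod b <= Cmod (a - b).
Proof.
  pose proof (Cmod_triangle (a - b) b) as H.
  replace (a - b + b)%C with a in H by ring. lra.
Qed.

Lemma Cmod_le_abs (z : C) : Cmod z <= Rabs (fst z) + Rabs (snd z).
Proof.
  destruct z as [x y]. simpl.
  replace ((x, y) : C) with (RtoC x + Ci * RtoC y)%C
    by (apply injective_projections; simpl; ring).
  eapply Rle_trans; [apply Cmod_triangle|].
  rewrite Cmod_mult, Cmod_Ci, !Cmod_R. lra.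
Qed.

(** Balls of [C] as a uniform space are squares; passing to the modulus costs a factor sqrt 2, which
    is rounded up to 2 and absorbed by halving radii. *)
Lemma sqrt_2_le : sqrt 2 <= 2.
Proof. rewrite <- (sqrt_square 2) at 2 by lra. apply sqrt_le_1_alt. lra. Qed.

Lemma continuous_C_intro (U : UniformSpace) (c : U -> C) (t : U) :
  (forall eps, 0 < eps -> locally t (fun s => Cmod (c s - c t) < eps)) ->
  continuous c t.
Proof.
  intros H. apply filterlim_locally. intros eps.
  eapply filter_imp; [|exact (H eps (cond_pos eps))].
  intros s Hs. apply C_NormedModule_mixin_compat1. exact Hs.
Qed.

Lemma continuous_C_elim (U : UniformSpace) (c : U -> C) (t : U) :
  continuous c t ->
  forall eps, 0 < eps -> locally t (fun s => Cmod (c s - c t) < eps).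
Proof.
  intros H eps Heps. pose proof (proj1 (filterlim_locally c (c t)) H) as H1.
  assert (Hp : 0 < eps / 2) by lra.
  specialize (H1 (mkposreal _ Hp)). eapply filter_imp; [|exact H1].
  intros s Hs. apply C_NormedModule_mixin_compat2 in Hs.
  eapply Rlt_le_trans; [exact Hs|]. simpl.
  pose proof sqrt_2_le. nra.
Qed.

Lemma locally_C_ball (z : C) (P : C -> Prop) (del : R) :
  0 < del -> (forall w, Cmod (w - z) < del -> P w) -> locally z P.
Proof.
  intros Hd H. assert (Hp : 0 < del / 2) by lra.
  exists (mkposreal _ Hp). intros w Hw. apply H.
  apply C_NormedModule_mixin_compat2 in Hw.
  eapply Rlt_le_trans; [exact Hw|]. simpl.
  pose proof sqrt_2_le. nra.
Qed.

Lemma continuous_Cmult (U : UniformSpace) (f g : U -> C) (x : U) :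
  continuous f x -> continuous g x -> continuous (fun t => (f t * g t)%C) x.
Proof.
  intros Hf Hg. apply continuous_C_intro. intros eps He.
  pose proof (Cmod_ge_0 (f x)) as P1. pose proof (Cmod_ge_0 (g x)) as P2.
  set (K := Cmod (f x) + Cmod (g x) + 1).
  set (e := Rmin 1 (eps / K)).
  assert (He1 : 0 < e).
  { apply Rmin_glb_lt; [lra|]. apply Rdiv_lt_0_compat; unfold K; lra. }
  assert (He2 : e <= 1) by apply Rmin_l.
  assert (He3 : e * K <= eps).
  { apply Rle_trans with (eps / K * K).
    - apply Rmult_le_compat_r; [unfold K; lra|apply Rmin_r].
    - right; field; unfold K; lra. }
  eapply filter_imp; [|exact (filter_and _ _ (continuous_C_elim U f x Hf e He1)
                                             (continuous_C_elim U g x Hg e He1))].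
  intros t [H1 H2].
  replace (f t * g t - f x * g x)%C
    with ((f t - f x) * (g t - g x) + (f t - f x) * g x + f x * (g t - g x))%C by ring.
  eapply Rle_lt_trans; [apply Cmod_triangle|].
  eapply Rle_lt_trans; [apply Rplus_le_compat_r, Cmod_triangle|]. rewrite !Cmod_mult.
  pose proof (Cmod_ge_0 (f t - f x)). pose proof (Cmod_ge_0 (g t - g x)).
  unfold K in He3. nra.
Qed.

Lemma continuous_Cminus (U : UniformSpace) (f g : U -> C) (x : U) :
  continuous f x -> continuous g x -> continuous (fun t => (f t - g t)%C) x.
Proof. exact (continuous_minus (V := C_R_NormedModule) f g x). Qed.

Lemma cdiff_lip (f : C -> C) (z l : C) : cdiff f z l ->
  exists del, 0 < del /\ forall w, Cmod (w - z) < del ->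
    Cmod (f w - f z) <= (Cmod l + 1) * Cmod (w - z).
Proof.
  intros H. destruct (H 1 Rlt_0_1) as [d [Hd Hw]]. exists d; split; [exact Hd|].
  intros w Bw. specialize (Hw w Bw).
  replace (f w - f z)%C with ((f w - f z - l * (w - z)) + l * (w - z))%C by ring.
  eapply Rle_trans; [apply Cmod_triangle|]. rewrite Cmod_mult. lra.
Qed.

Lemma cdiff_near (f : C -> C) (z l : C) : cdiff f z l ->
  forall eps, 0 < eps -> exists del, 0 < del /\ forall w, Cmod (w - z) < del ->
    Cmod (f w - f z) < eps.
Proof.
  intros H eps He. destruct (cdiff_lip f z l H) as [d [Hd Hw]].
  pose proof (Cmod_ge_0 l).
  exists (Rmin d (eps / (Cmod l + 1))). split.
  - apply Rmin_glb_lt; [lra|]. apply Rdiv_lt_0_compat; lra.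
  - intros w Bw. eapply Rle_lt_trans; [apply Hw|].
    + eapply Rlt_le_trans; [exact Bw|apply Rmin_l].
    + assert (Cmod (w - z) < eps / (Cmod l + 1)).
      { eapply Rlt_le_trans; [exact Bw|apply Rmin_r]. }
      apply Rlt_le_trans with ((Cmod l + 1) * (eps / (Cmod l + 1))).
      * apply Rmult_lt_compat_l; lra.
      * right; field; lra.
Qed.

Lemma cdiff_continuous (f : C -> C) (z l : C) : cdiff f z l -> continuous f z.
Proof.
  intros H. apply continuous_C_intro. intros eps He.
  destruct (cdiff_near f z l H eps He) as [d [Hd Hw]].
  apply (locally_C_ball z _ d Hd Hw).
Qed.

Lemma rdiff_continuous (c : R -> C) (t : R) (v : C) : rdiff c t v -> continuous c t.
Proof.
  intros H. apply (ex_derive_continuous (K := R_AbsRing) (V := C_R_NormedModule)).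
  exists v. apply is_derive_rdiff, H.
Qed.

Lemma cdiff_ext (f g : C -> C) (z l : C) :
  (forall w, f w = g w) -> cdiff f z l -> cdiff g z l.
Proof.
  intros E H eps He. destruct (H eps He) as [d [Hd Hw]]. exists d; split; [exact Hd|].
  intros w Bw. rewrite <- !E. apply Hw, Bw.
Qed.

Lemma cdiff_const (a z : C) : cdiff (fun _ => a) z 0%C.
Proof.
  intros eps He. exists 1; split; [lra|]. intros w _.
  replace (a - a - 0 * (w - z))%C with (RtoC 0) by ring. rewrite Cmod_0.
  pose proof (Cmod_ge_0 (w - z)). nra.
Qed.

Lemma cdiff_id (z : C) : cdiff (fun w => w) z 1%C.
Proof.
  intros eps He. exists 1; split; [lra|]. intros w _.
  replace (w - z - 1 * (w - z))%C with (RtoC 0) by ring. rewrite Cmod_0.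
  pose proof (Cmod_ge_0 (w - z)). nra.
Qed.

Lemma cdiff_plus (f g : C -> C) (z l m : C) :
  cdiff f z l -> cdiff g z m -> cdiff (fun w => (f w + g w)%C) z (l + m)%C.
Proof.
  intros Hf Hg eps He. assert (He2 : 0 < eps / 2) by lra.
  destruct (Hf _ He2) as [d1 [Hd1 H1]]. destruct (Hg _ He2) as [d2 [Hd2 H2]].
  exists (Rmin d1 d2). split; [apply Rmin_glb_lt; assumption|].
  intros w Bw.
  destruct (Rmin_Rgt_l _ _ _ Bw) as [B1 B2].
  specialize (H1 w B1). specialize (H2 w B2).
  replace (f w + g w - (f z + g z) - (l + m) * (w - z))%C
    with ((f w - f z - l * (w - z)) + (g w - g z - m * (w - z)))%C by ring.
  eapply Rle_trans; [apply Cmod_triangle|]. lra.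
Qed.

Lemma cdiff_scal (a : C) (f : C -> C) (z l : C) :
  cdiff f z l -> cdiff (fun w => (a * f w)%C) z (a * l)%C.
Proof.
  intros H eps He. pose proof (Cmod_ge_0 a) as Pa.
  assert (He' : 0 < eps / (Cmod a + 1)) by (apply Rdiv_lt_0_compat; lra).
  destruct (H _ He') as [d [Hd Hw]]. exists d; split; [exact Hd|]. intros w Bw.
  specialize (Hw w Bw).
  replace (a * f w - a * f z - a * l * (w - z))%C with (a * (f w - f z - l * (w - z)))%C by ring.
  rewrite Cmod_mult. apply Rle_trans with ((Cmod a + 1) * (eps / (Cmod a + 1) * Cmod (w - z))).
  - apply Rmult_le_compat; try apply Cmod_ge_0; [lra|exact Hw].
  - right. field. lra.
Qed.

Lemma cdiff_minus (f g : C -> C) (z l m : C) :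
  cdiff f z l -> cdiff g z m -> cdiff (fun w => (f w - g w)%C) z (l - m)%C.
Proof.
  intros Hf Hg. replace (l - m)%C with (l + (- (1)) * m)%C by ring.
  apply cdiff_ext with (fun w => (f w + (- (1)) * g w)%C); [intros; ring|].
  apply cdiff_plus; [exact Hf|]. apply cdiff_scal; exact Hg.
Qed.

Lemma cdiff_comp (f g : C -> C) (z l m : C) :
  cdiff g z m -> cdiff f (g z) l -> cdiff (fun w => f (g w)) z (l * m)%C.
Proof.
  intros Hg Hf eps He.
  pose proof (Cmod_ge_0 l) as P1. pose proof (Cmod_ge_0 m) as P2.
  set (e1 := eps / (2 * (Cmod m + 1))).
  set (e2 := eps / (2 * (Cmod l + 1))).
  assert (He1 : 0 < e1) by (apply Rdiv_lt_0_compat; lra).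
  assert (He2 : 0 < e2) by (apply Rdiv_lt_0_compat; lra).
  destruct (Hf _ He1) as [d1 [Hd1 H1]]. destruct (Hg _ He2) as [d2 [Hd2 H2]].
  destruct (cdiff_near g z m Hg d1 Hd1) as [d3 [Hd3 H3]].
  destruct (cdiff_lip g z m Hg) as [d4 [Hd4 H4]].
  exists (Rmin (Rmin d2 d4) d3). split; [repeat apply Rmin_glb_lt; assumption|].
  intros w Bw. destruct (Rmin_Rgt_l _ _ _ Bw) as [B24 B3].
  destruct (Rmin_Rgt_l _ _ _ B24) as [B2 B4].
  specialize (H2 w B2). specialize (H3 w B3). specialize (H4 w B4).
  specialize (H1 (g w) H3).
  replace (f (g w) - f (g z) - l * m * (w - z))%C
    with ((f (g w) - f (g z) - l * (g w - g z)) + l * (g w - g z - m * (w - z)))%C by ring.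
  eapply Rle_trans; [apply Cmod_triangle|]. rewrite Cmod_mult.
  set (h := Cmod (w - z)) in *. assert (Hh : 0 <= h) by apply Cmod_ge_0.
  assert (e1 * Cmod (g w - g z) <= eps / 2 * h).
  { apply Rle_trans with (e1 * ((Cmod m + 1) * h)).
    - apply Rmult_le_compat_l; lra.
    - right; unfold e1; field; lra. }
  assert (Cmod l * Cmod (g w - g z - m * (w - z)) <= eps / 2 * h).
  { apply Rle_trans with ((Cmod l + 1) * (e2 * h)).
    - apply Rmult_le_compat; try lra. apply Cmod_ge_0.
    - right; unfold e2; field; lra. }
  lra.
Qed.

Lemma cdiff_sqr (z : C) : cdiff (fun w => (w * w)%C) z (2 * z)%C.
Proof.
  intros eps He. exists eps; split; [exact He|]. intros w Bw.
  replace (w * w - z * z - 2 * z * (w - z))%C with ((w - z) * (w - z))%C by ring.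
  rewrite Cmod_mult. apply Rmult_le_compat_r; [apply Cmod_ge_0|lra].
Qed.

(** Polarisation 4fg = (f+g)^2 - (f-g)^2 reduces the product rule to the chain rule and the
    derivative of the square. *)
Lemma cdiff_mult (f g : C -> C) (z l m : C) :
  cdiff f z l -> cdiff g z m ->
  cdiff (fun w => (f w * g w)%C) z (l * g z + f z * m)%C.
Proof.
  intros Hf Hg.
  apply cdiff_ext with (fun w => (/ 4 * ((f w + g w) * (f w + g w) - (f w - g w) * (f w - g w)))%C).
  { intros w. field. }
  replace (l * g z + f z * m)%C
    with (/ 4 * (2 * (f z + g z) * (l + m) - 2 * (f z - g z) * (l - m)))%C by field.
  apply cdiff_scal, cdiff_minus.
  - apply (cdiff_comp (fun w => (w * w)%C) (fun w => (f w + g w)%C));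
      [apply cdiff_plus; assumption|apply cdiff_sqr].
  - apply (cdiff_comp (fun w => (w * w)%C) (fun w => (f w - g w)%C));
      [apply cdiff_minus; assumption|apply cdiff_sqr].
Qed.

Lemma cdiff_Cinv (z : C) : z <> 0%C -> cdiff Cinv z (- / (z * z))%C.
Proof.
  intros Hz eps He. pose proof (proj1 (Cmod_gt_0 z) Hz) as Pz.
  set (r := Cmod z) in *.
  (* The remainder is (w-z)^2/(w z^2). The first bound keeps |w| >= r/2, so the second one gives
     |w-z| <= eps r^2 |w|. *)
  exists (Rmin (r / 2) (eps * (r * r * r) / 2)). split.
  - apply Rmin_glb_lt; [lra|]. apply Rdiv_lt_0_compat; [|lra].
    repeat apply Rmult_lt_0_compat; lra.
  - intros w Bw.
    destruct (Rmin_Rgt_l _ _ _ Bw) as [B1 B2].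
    assert (Hw : r / 2 <= Cmod w).
    { pose proof (Cmod_triangle_inv z w). rewrite Cmod_minus_sym in H. fold r in H. lra. }
    assert (Hw0 : w <> 0%C) by (apply Cmod_gt_0; lra).
    replace (/ w - / z - - / (z * z) * (w - z))%C
      with ((w - z) * ((w - z) * / (w * (z * z))))%C by (field; split; assumption).
    rewrite !Cmod_mult, Cmod_inv, !Cmod_mult
      by (repeat apply Cmult_neq_0; assumption).
    fold r. set (h := Cmod (w - z)) in *. assert (Hh : 0 <= h) by apply Cmod_ge_0.
    rewrite (Rmult_comm eps). apply Rmult_le_compat_l; [exact Hh|].
    apply Rmult_le_reg_r with (Cmod w * (r * r)).
    + repeat apply Rmult_lt_0_compat; lra.
    + rewrite Rmult_assoc, Rinv_l, Rmult_1_r.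
      * apply Rle_trans with (eps * (r / 2 * (r * r))); [|].
        -- lra.
        -- apply Rmult_le_compat_l; [lra|]. apply Rmult_le_compat_r; nra.
      * apply Rgt_not_eq. repeat apply Rmult_lt_0_compat; lra.
Qed.

Lemma cdiff_inv (f : C -> C) (z l : C) : f z <> 0%C ->
  cdiff f z l -> cdiff (fun w => / f w)%C z (- / (f z * f z) * l)%C.
Proof. intros H Hf. apply (cdiff_comp Cinv f); [exact Hf|]. apply cdiff_Cinv; exact H. Qed.

Lemma rdiff_ext (c d : R -> C) (t : R) (v : C) :
  (forall s, c s = d s) -> rdiff c t v -> rdiff d t v.
Proof.
  intros E H eps He. destruct (H eps He) as [x [Hx Hs]]. exists x; split; [exact Hx|].
  intros s Bs. rewrite <- !E. apply Hs, Bs.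
Qed.

Lemma cdiff_lin (c z : C) : cdiff (fun w => (c * w)%C) z c.
Proof.
  pose proof (cdiff_scal c (fun w => w) z 1 (cdiff_id z)) as H.
  rewrite Cmult_1_r in H. exact H.
Qed.

Lemma continuous_Cinv (U : UniformSpace) (f : U -> C) (x : U) :
  f x <> 0%C -> continuous f x -> continuous (fun t => (/ f t)%C) x.
Proof.
  intros H Hf. apply (continuous_comp f Cinv); [exact Hf|].
  eapply cdiff_continuous, cdiff_Cinv, H.
Qed.

Lemma rdiff_line (f : C -> C) (a b : C) (t : R) (l : C) :
  cdiff f (a + RtoC t * b)%C l -> rdiff (fun s => f (a + RtoC s * b)%C) t (l * b)%C.
Proof.
  intros Hf eps He. pose proof (Cmod_ge_0 b) as Pb.
  assert (He' : 0 < eps / (Cmod b + 1)) by (apply Rdiv_lt_0_compat; lra).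
  destruct (Hf _ He') as [d [Hd Hw]]. exists (d / (Cmod b + 1)).
  split; [apply Rdiv_lt_0_compat; lra|]. intros s Bs.
  assert (E : (a + RtoC s * b - (a + RtoC t * b))%C = (RtoC (s - t) * b)%C)
    by (rewrite RtoC_minus; ring).
  specialize (Hw (a + RtoC s * b)%C). rewrite E, Cmod_mult, Cmod_R in Hw.
  pose proof (Rabs_pos (s - t)) as Ps.
  rewrite (Cmult_comm l), Cmult_assoc, (Cmult_comm _ l).
  eapply Rle_trans; [apply Hw|].
  - apply Rle_lt_trans with (Rabs (s - t) * (Cmod b + 1)); [nra|].
    apply Rmult_lt_compat_r with (r := Cmod b + 1) in Bs; [|lra].
    replace (d / (Cmod b + 1) * (Cmod b + 1)) with d in Bs by (field; lra). exact Bs.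
  - apply Rle_trans with (eps / (Cmod b + 1) * (Rabs (s - t) * (Cmod b + 1))).
    + apply Rmult_le_compat_l; [lra|nra].
    + right. field. lra.
Qed.

Lemma continuous_line (a b : C) (t : R) : continuous (fun s => (a + RtoC s * b)%C) t.
Proof. eapply rdiff_continuous, (rdiff_line (fun w => w)), cdiff_id. Qed.

Lemma derive_continuous (f : R -> R) (t l : R) : is_derive f t l -> continuous f t.
Proof.
  intros H. apply (ex_derive_continuous (K := R_AbsRing) (V := R_NormedModule)). exists l. exact H.
Qed.

Lemma mean_value (f df : R -> R) (a b : R) : a <= b ->
  (forall t, a <= t <= b -> is_derive f t (df t)) ->
  exists c, a <= c <= b /\ f b - f a = df c * (b - a).
Proof.
  intros Hab H. destruct (MVT_gen f a b df) as [c [Hc E]]; rewrite Rmin_left, Rmax_right in * by lra.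
  - intros t Ht. apply H. lra.
  - intros t Ht. eapply continuity_pt_filterlim, derive_continuous, H, Ht.
  - exists c. split; assumption.
Qed.

(** * Integrals along segments and Goursat's lemma *)

Notation CI := (RInt (V := C_R_CompleteNormedModule)).
Notation is_CI := (is_RInt (V := C_R_NormedModule)).
Notation ex_CI := (ex_RInt (V := C_R_NormedModule)).

Lemma is_CI_iff (h : R -> C) (a b : R) (l : C) :
  is_CI h a b l <->
  is_RInt (fun t => Re (h t)) a b (Re l) /\ is_RInt (fun t => Im (h t)) a b (Im l).
Proof.
  split.
  - intros H. split.
    + exact (is_RInt_fct_extend_fst (U := R_NormedModule) (V := R_NormedModule) h a b l H).
    + exact (is_RInt_fct_extend_snd (U := R_NormedModule) (V := R_NormedModule) h a b l H).
  - intros [H1 H2]. destruct l as [l1 l2].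
    exact (is_RInt_fct_extend_pair (U := R_NormedModule) (V := R_NormedModule) h a b l1 l2 H1 H2).
Qed.

Lemma is_CI_scal (c : C) (h : R -> C) (a b : R) (l : C) :
  is_CI h a b l -> is_CI (fun t => (c * h t)%C) a b (c * l)%C.
Proof.
  intros H. apply is_CI_iff in H. destruct H as [H1 H2]. apply is_CI_iff. split.
  - rewrite re_mult. apply is_RInt_ext with (fun t => Re c * Re (h t) - Im c * Im (h t)).
    + intros; rewrite re_mult; reflexivity.
    + apply (is_RInt_minus (V := R_NormedModule));
        apply (is_RInt_scal (V := R_NormedModule)); assumption.
  - rewrite im_mult. apply is_RInt_ext with (fun t => Re c * Im (h t) + Im c * Re (h t)).
    + intros; rewrite im_mult; reflexivity.
    + apply (is_RInt_plus (V := R_NormedModule));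
        apply (is_RInt_scal (V := R_NormedModule)); assumption.
Qed.

Lemma is_CI_minus (g h : R -> C) (a b : R) (l m : C) :
  is_CI g a b l -> is_CI h a b m -> is_CI (fun t => (g t - h t)%C) a b (l - m)%C.
Proof. intros H1 H2. exact (is_RInt_minus _ _ _ _ _ _ H1 H2). Qed.

Lemma is_CI_ext (g h : R -> C) (a b : R) (l : C) :
  (forall t, Rmin a b <= t <= Rmax a b -> g t = h t) -> is_CI g a b l -> is_CI h a b l.
Proof. intros E. apply is_RInt_ext. intros t Ht. apply E. lra. Qed.

Lemma CI_unique (h : R -> C) (a b : R) (l : C) : is_CI h a b l -> CI h a b = l.
Proof. apply (is_RInt_unique (V := C_R_CompleteNormedModule)). Qed.

Lemma CI_correct (h : R -> C) (a b : R) : ex_CI h a b -> is_CI h a b (CI h a b).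
Proof. apply (RInt_correct (V := C_R_CompleteNormedModule)). Qed.

Lemma ex_CI_continuous (h : R -> C) (a b : R) : a <= b ->
  (forall t, a <= t <= b -> continuous h t) -> ex_CI h a b.
Proof.
  intros Hab H. apply (ex_RInt_continuous (V := C_R_CompleteNormedModule)).
  rewrite Rmin_left, Rmax_right by exact Hab. exact H.
Qed.

Lemma is_CI_norm (h : R -> C) (g : R -> R) (a b : R) (l : C) (m : R) : a <= b ->
  (forall t, a <= t <= b -> Cmod (h t) <= g t) ->
  is_CI h a b l -> is_RInt g a b m -> Cmod l <= m.
Proof.
  intros Hab H H1 H2. rewrite Cmod_norm.
  apply (norm_RInt_le h g a b l m Hab); try assumption.
  intros t Ht. specialize (H t Ht). rewrite Cmod_norm in H. exact H.
Qed.

Lemma is_CI_norm_const (h : R -> C) (K a b : R) (l : C) : a <= b ->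
  (forall t, a <= t <= b -> Cmod (h t) <= K) -> is_CI h a b l -> Cmod l <= K * (b - a).
Proof.
  intros Hab H H1. apply (is_CI_norm h (fun _ => K) a b l _ Hab H H1).
  replace (K * (b - a)) with (scal (b - a) K).
  - apply (is_RInt_const (V := R_NormedModule)).
  - unfold scal; simpl; unfold mult; simpl; ring.
Qed.

Definition seg (f : C -> C) (a b : C) : C :=
  CI (fun t => (f (a + RtoC t * (b - a)) * (b - a))%C) 0 1.

Definition on_seg (P : C -> Prop) (a b : C) : Prop :=
  forall t, 0 <= t <= 1 -> P (a + RtoC t * (b - a))%C.

Lemma continuous_seg (f : C -> C) (a b : C) (t : R) :
  continuous f (a + RtoC t * (b - a))%C ->
  continuous (fun t : R => (f (a + RtoC t * (b - a)) * (b - a))%C) t.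
Proof.
  intros H. apply continuous_Cmult; [|apply continuous_const].
  apply (continuous_comp (fun t : R => (a + RtoC t * (b - a))%C) f); [|exact H].
  apply continuous_line.
Qed.

Lemma is_CI_seg (f : C -> C) (a b : C) :
  on_seg (fun w => continuous f w) a b ->
  is_CI (fun t => (f (a + RtoC t * (b - a)) * (b - a))%C) 0 1 (seg f a b).
Proof.
  intros H. apply CI_correct, ex_CI_continuous; [lra|].
  intros t Ht. apply continuous_seg, H, Ht.
Qed.

Lemma RtoC_m1 : RtoC (-1) = (- (1))%C.
Proof. rewrite <- RtoC_opp. f_equal; ring. Qed.

Lemma is_CI_seg_swap (f : C -> C) (a b l : C) :
  is_CI (fun t => (f (a + RtoC t * (b - a)) * (b - a))%C) 0 1 l ->
  is_CI (fun t => (f (b + RtoC t * (a - b)) * (a - b))%C) 0 1 (- l)%C.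
Proof.
  intros H. apply (is_RInt_swap (V := C_R_NormedModule)) in H.
  replace 1 with (-1 * 0 + 1) in H at 1 by ring.
  replace 0 with (-1 * 1 + 1) in H at 2 by ring.
  apply (is_RInt_comp_lin (V := C_R_NormedModule)) in H.
  eapply is_CI_ext; [|exact H]. intros t _; cbv beta; rewrite scal_R_Cmult.
  replace (a + RtoC (-1 * t + 1) * (b - a))%C with (b + RtoC t * (a - b))%C.
  - rewrite RtoC_m1. ring.
  - rewrite RtoC_plus, RtoC_mult, RtoC_m1. ring.
Qed.

Lemma seg_swap (f : C -> C) (a b : C) :
  on_seg (fun w => continuous f w) a b -> seg f b a = (- seg f a b)%C.
Proof.
  intros H. unfold seg at 1. apply CI_unique, is_CI_seg_swap, is_CI_seg, H.
Qed.

Lemma seg_split (f : C -> C) (a b m : C) :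
  on_seg (fun w => continuous f w) a b -> m = ((a + b) / 2)%C ->
  seg f a b = (seg f a m + seg f m b)%C.
Proof.
  intros H Em.
  assert (Half : RtoC (1 / 2) = (1 / 2)%C) by (apply RtoC_div; lra).
  assert (Ha : on_seg (fun w => continuous f w) a m).
  { intros t Ht.
    replace (a + RtoC t * (m - a))%C with (a + RtoC (t * (1 / 2)) * (b - a))%C.
    - apply H; lra.
    - rewrite RtoC_mult, Half, Em. field. }
  assert (Hb : on_seg (fun w => continuous f w) m b).
  { intros t Ht.
    replace (m + RtoC t * (b - m))%C with (a + RtoC (1 / 2 + t * (1 / 2)) * (b - a))%C.
    - apply H; lra.
    - rewrite RtoC_plus, RtoC_mult, Half, Em. field. }
  pose proof (is_CI_seg f a m Ha) as Ia. pose proof (is_CI_seg f m b Hb) as Ib.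
  unfold seg at 1. apply CI_unique.
  apply (is_RInt_Chasles (V := C_R_NormedModule) _ 0 (1/2) 1).
  - replace 0 with (2 * 0 + 0) in Ia by ring.
    replace 1 with (2 * (1 / 2) + 0) in Ia by field.
    replace (2 * 0 + 0) with (2 * 0 + 0) in Ia by ring.
    apply (is_RInt_comp_lin (V := C_R_NormedModule)) in Ia.
    eapply is_CI_ext; [|exact Ia]. intros t _; cbv beta; rewrite scal_R_Cmult.
    replace (a + RtoC (2 * t + 0) * (m - a))%C with (a + RtoC t * (b - a))%C.
    + rewrite Em. field.
    + rewrite RtoC_plus, RtoC_mult, Em. field.
  - replace 0 with (2 * (1 / 2) + (-1)) in Ib by field.
    replace 1 with (2 * 1 + (-1)) in Ib at 2 by ring.
    apply (is_RInt_comp_lin (V := C_R_NormedModule)) in Ib.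
    eapply is_CI_ext; [|exact Ib]. intros t _; cbv beta; rewrite scal_R_Cmult.
    replace (m + RtoC (2 * t + -1) * (b - m))%C with (a + RtoC t * (b - a))%C.
    + rewrite Em. field.
    + rewrite RtoC_plus, RtoC_mult, RtoC_m1, Em. field.
Qed.

Lemma is_CI_ftc (P p : C -> C) (a b : C) :
  on_seg (fun w => cdiff P w (p w)) a b -> on_seg (fun w => continuous p w) a b ->
  is_CI (fun t => (p (a + RtoC t * (b - a)) * (b - a))%C) 0 1 (P b - P a)%C.
Proof.
  intros H Hc.
  replace (P b - P a)%C
    with (minus (P (a + RtoC 1 * (b - a))%C) (P (a + RtoC 0 * (b - a))%C) : C_R_NormedModule).
  - apply (is_RInt_derive (V := C_R_CompleteNormedModule)
             (fun t => P (a + RtoC t * (b - a))%C)).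
    + rewrite Rmin_left, Rmax_right by lra. intros t Ht. apply is_derive_rdiff.
      apply (rdiff_line P), H, Ht.
    + rewrite Rmin_left, Rmax_right by lra. intros t Ht. apply continuous_seg, Hc, Ht.
  - change (P (a + 1 * (b - a)) - P (a + 0 * (b - a)) = P b - P a)%C.
    f_equal; [|do 2 f_equal]; f_equal; ring.
Qed.

(** Replaces [f] by a nearby [p] with an explicit primitive [P]; around a closed triangle the
    increments of [P] cancel and only the error remains. *)
Lemma seg_approx (f P p : C -> C) (a b : C) (K : R) :
  on_seg (fun w => continuous f w) a b ->
  on_seg (fun w => cdiff P w (p w)) a b -> on_seg (fun w => continuous p w) a b ->
  on_seg (fun w => Cmod (f w - p w) <= K) a b ->
  Cmod (seg f a b - (P b - P a)) <= K * Cmod (b - a).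
Proof.
  intros Hf HP Hp HK.
  replace (K * Cmod (b - a)) with (K * Cmod (b - a) * (1 - 0)) by ring.
  eapply is_CI_norm_const with (a := 0) (b := 1); [lra| |].
  2: { apply is_CI_minus; [apply is_CI_seg; exact Hf|apply (is_CI_ftc P p); assumption]. }
  intros t Ht. simpl.
  replace (f (a + RtoC t * (b - a)) * (b - a) - p (a + RtoC t * (b - a)) * (b - a))%C
    with ((f (a + RtoC t * (b - a)) - p (a + RtoC t * (b - a))) * (b - a))%C by ring.
  rewrite Cmod_mult. apply Rmult_le_compat_r; [apply Cmod_ge_0|]. apply HK, Ht.
Qed.

(** * Limits of complex sequences *)

Lemma C_cauchy_lim (u : nat -> C) :
  (forall eps, 0 < eps -> exists N, forall n m, (N <= n)%nat -> (N <= m)%nat ->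
     Cmod (u n - u m) < eps) ->
  exists l, forall eps, 0 < eps -> exists N, forall n, (N <= n)%nat -> Cmod (u n - l) < eps.
Proof.
  intros H.
  assert (HR : Cauchy_crit (fun n => Re (u n))).
  { intros eps He. destruct (H eps He) as [N HN]. exists N. intros n m Hn Hm.
    eapply Rle_lt_trans; [|apply (HN n m Hn Hm)].
    eapply Rle_trans; [|apply re_le_Cmod]. unfold R_dist. right. reflexivity. }
  assert (HI : Cauchy_crit (fun n => Im (u n))).
  { intros eps He. destruct (H eps He) as [N HN]. exists N. intros n m Hn Hm.
    eapply Rle_lt_trans; [|apply (HN n m Hn Hm)].
    eapply Rle_trans; [|apply im_le_Cmod]. unfold R_dist. right. reflexivity. }
  destruct (Rcomplete.R_complete _ HR) as [x Hx]. destruct (Rcomplete.R_complete _ HI) as [y Hy].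
  exists (x, y). intros eps He. assert (He2 : 0 < eps / 2) by lra.
  destruct (Hx _ He2) as [N1 H1]. destruct (Hy _ He2) as [N2 H2].
  exists (max N1 N2). intros n Hn.
  assert (A1 : (n >= N1)%nat) by lia. assert (A2 : (n >= N2)%nat) by lia.
  specialize (H1 n A1). specialize (H2 n A2). unfold R_dist in *.
  eapply Rle_lt_trans; [apply Cmod_le_abs|].
  change (fst (u n - (x, y))%C) with (Re (u n) - x).
  change (snd (u n - (x, y))%C) with (Im (u n) - y). lra.
Qed.

Lemma C_lim_le (u : nat -> C) (l z : C) (K : R) (N0 : nat) :
  (forall eps, 0 < eps -> exists N, forall n, (N <= n)%nat -> Cmod (u n - l) < eps) ->
  (forall n, (N0 <= n)%nat -> Cmod (u n - z) <= K) -> Cmod (l - z) <= K.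
Proof.
  intros H HK. apply le_epsilon. intros eps He.
  destruct (H eps He) as [N HN]. set (n := max N N0).
  assert (A : (N <= n)%nat) by lia. assert (B : (N0 <= n)%nat) by lia.
  specialize (HN n A). specialize (HK n B).
  pose proof (Cmod_dist_triangle l (u n) z) as Htr. rewrite (Cmod_minus_sym l (u n)) in Htr. lra.
Qed.

Lemma pow_small (r eps : R) : 0 <= r < 1 -> 0 < eps ->
  exists N, forall n, (N <= n)%nat -> r ^ n < eps.
Proof.
  intros Hr He. destruct (pow_lt_1_zero r) with (y := eps) as [N HN];
    [rewrite Rabs_pos_eq; lra|exact He|].
  exists N. intros n Hn. specialize (HN n Hn).
  rewrite Rabs_pos_eq in HN by (apply pow_le; lra). exact HN.
Qed.

Lemma geom_small (d eps : R) : 0 <= d -> 0 < eps -> exists n, d / 2 ^ n < eps.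
Proof.
  intros Hd He. assert (He' : 0 < eps / (d + 1)) by (apply Rdiv_lt_0_compat; lra).
  destruct (pow_small (1 / 2) _ ltac:(lra) He') as [N HN]. specialize (HN N (le_n N)). exists N.
  replace (d / 2 ^ N) with (d * (1 / 2) ^ N) by (unfold Rdiv; rewrite Rmult_1_l, pow_inv; reflexivity).
  apply Rle_lt_trans with (d * (eps / (d + 1))); [apply Rmult_le_compat_l; lra|].
  apply Rmult_lt_reg_r with (d + 1); [lra|].
  replace (d * (eps / (d + 1)) * (d + 1)) with (d * eps) by (field; lra). nra.
Qed.

Lemma C_geom_lim (u : nat -> C) (d : R) :
  (forall n, Cmod (u (S n) - u n) <= d / 2 ^ S n) ->
  exists l, forall n, Cmod (l - u n) <= d / 2 ^ n.
Proof.
  intros H.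
  assert (Hp : forall n, 0 < 2 ^ n) by (intros; apply pow_lt; lra).
  assert (Hd : 0 <= d).
  { pose proof (H 0%nat) as H0. pose proof (Cmod_ge_0 (u 1%nat - u 0%nat)).
    simpl in H0. lra. }
  assert (G : forall n k, Cmod (u (n + k)%nat - u n) <= d / 2 ^ n - d / 2 ^ (n + k)).
  { intros n k. induction k.
    - replace (n + 0)%nat with n by lia. replace (u n - u n)%C with (RtoC 0) by ring.
      rewrite Cmod_0. lra.
    - replace (n + S k)%nat with (S (n + k)) by lia.
      eapply Rle_trans; [apply (Cmod_dist_triangle _ (u (n + k)%nat))|].
      pose proof (H (n + k)%nat). pose proof (Hp (n + k)%nat).
      assert (d / 2 ^ (n + k) = 2 * (d / 2 ^ S (n + k))) by (simpl; field; lra). lra. }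
  assert (G' : forall n m, (n <= m)%nat -> Cmod (u m - u n) <= d / 2 ^ n).
  { intros n m Hm. replace m with (n + (m - n))%nat by lia.
    eapply Rle_trans; [apply G|]. pose proof (Hp (n + (m - n))%nat) as Hq.
    assert (0 <= d / 2 ^ (n + (m - n))) by (apply Rdiv_le_0_compat; lra). lra. }
  destruct (C_cauchy_lim u) as [l Hl].
  { intros eps He. destruct (geom_small d (eps / 2) Hd ltac:(lra)) as [N HN].
    exists N. intros n m Hn Hm.
    eapply Rle_lt_trans; [apply (Cmod_dist_triangle _ (u N))|].
    rewrite (Cmod_minus_sym (u N)).
    pose proof (G' N n Hn). pose proof (G' N m Hm). lra. }
  exists l. intros n. apply (C_lim_le u l (u n) _ n Hl). intros m Hm. apply G', Hm.
Qed.

(** * Bisection of triangles *)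

Definition convex (Om : C -> Prop) : Prop := forall a b, Om a -> Om b -> on_seg Om a b.

Definition closedC (Om : C -> Prop) : Prop :=
  forall z, (forall eps, 0 < eps -> exists w, Om w /\ Cmod (w - z) < eps) -> Om z.

Definition tri (f : C -> C) (a b c : C) : C := (seg f a b + seg f b c + seg f c a)%C.

Lemma convex_mid (Om : C -> Prop) (a b : C) : convex Om -> Om a -> Om b -> Om ((a + b) / 2)%C.
Proof.
  intros H Ha Hb. replace ((a + b) / 2)%C with (a + RtoC (1 / 2) * (b - a))%C.
  - apply H; [assumption|assumption|lra].
  - rewrite RtoC_div by lra. field.
Qed.

Lemma tri_split (Om : C -> Prop) (f : C -> C) (a b c : C) :
  convex Om -> (forall w, Om w -> continuous f w) -> Om a -> Om b -> Om c ->
  let m1 := ((a + b) / 2)%C in let m2 := ((b + c) / 2)%C in let m3 := ((c + a) / 2)%C in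
  tri f a b c = (tri f a m1 m3 + tri f m1 b m2 + (tri f m3 m2 c + tri f m1 m2 m3))%C.
Proof.
  intros HO Hf Ha Hb Hc m1 m2 m3.
  assert (O1 : Om m1) by (apply convex_mid; assumption).
  assert (O2 : Om m2) by (apply convex_mid; assumption).
  assert (O3 : Om m3) by (apply convex_mid; assumption).
  assert (S : forall x y, Om x -> Om y -> on_seg (fun w => continuous f w) x y).
  { intros x y Hx Hy t Ht. apply Hf, HO; assumption. }
  unfold tri.
  rewrite (seg_split f a b m1), (seg_split f b c m2), (seg_split f c a m3)
    by (first [reflexivity | apply S; assumption]).
  rewrite (seg_swap f m1 m2), (seg_swap f m2 m3), (seg_swap f m3 m1)
    by (apply S; assumption).
  ring.
Qed.

(** Bounding the three sides, rather than an area or a diameter of a hull, leaves degenerate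
    triangles without a separate case. *)
Definition tri_in (Om : C -> Prop) (d : R) (T : C * C * C) : Prop :=
  let '(a, b, c) := T in
  Om a /\ Om b /\ Om c /\ Cmod (b - a) <= d /\ Cmod (c - b) <= d /\ Cmod (a - c) <= d.

Lemma Cmod_half (z : C) (d : R) : Cmod z <= d -> Cmod (z / 2) <= d / 2.
Proof.
  intros H. rewrite Cmod_div by (intros E; apply RtoC_inj in E; lra).
  rewrite Cmod_R, Rabs_pos_eq by lra. lra.
Qed.

Lemma tri_step (Om : C -> Prop) (f : C -> C) (d : R) (T : C * C * C) :
  convex Om -> (forall w, Om w -> continuous f w) -> tri_in Om d T ->
  exists T', tri_in Om (d / 2) T' /\ Cmod (fst (fst T') - fst (fst T)) <= d / 2 /\
    let '(a, b, c) := T in let '(a', b', c') := T' in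
    Cmod (tri f a b c) <= 4 * Cmod (tri f a' b' c').
Proof.
  intros HO Hf. destruct T as [[a b] c]. intros (Ha & Hb & Hc & L1 & L2 & L3).
  pose proof (tri_split Om f a b c HO Hf Ha Hb Hc) as E. cbv zeta in E.
  set (m1 := ((a + b) / 2)%C) in *. set (m2 := ((b + c) / 2)%C) in *.
  set (m3 := ((c + a) / 2)%C) in *.
  assert (O1 : Om m1) by (apply convex_mid; assumption).
  assert (O2 : Om m2) by (apply convex_mid; assumption).
  assert (O3 : Om m3) by (apply convex_mid; assumption).
  assert (L1' : Cmod (a - b) <= d) by (rewrite Cmod_minus_sym; exact L1).
  assert (L2' : Cmod (b - c) <= d) by (rewrite Cmod_minus_sym; exact L2).
  assert (L3' : Cmod (c - a) <= d) by (rewrite Cmod_minus_sym; exact L3).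
  assert (Hd : 0 <= d / 2) by (pose proof (Cmod_ge_0 (a - b)); lra).
  assert (HH : forall u v z w, Cmod w <= d -> z = (w / 2)%C -> (u - v)%C = z ->
                               Cmod (u - v) <= d / 2).
  { intros u v z w Hw Hz Hu. rewrite Hu, Hz. apply Cmod_half, Hw. }
  assert (Z : Cmod (tri f a b c) <= Cmod (tri f a m1 m3) + Cmod (tri f m1 b m2)
               + (Cmod (tri f m3 m2 c) + Cmod (tri f m1 m2 m3))).
  { rewrite E. eapply Rle_trans; [apply Cmod_triangle|].
    apply Rplus_le_compat; apply Cmod_triangle. }
  assert (Q : Cmod (tri f a b c) <= 4 * Cmod (tri f a m1 m3) \/
              Cmod (tri f a b c) <= 4 * Cmod (tri f m1 b m2) \/
              Cmod (tri f a b c) <= 4 * Cmod (tri f m3 m2 c) \/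
              Cmod (tri f a b c) <= 4 * Cmod (tri f m1 m2 m3)) by lra.
  destruct Q as [Q|[Q|[Q|Q]]];
    [exists (a, m1, m3)|exists (m1, b, m2)|exists (m3, m2, c)|exists (m1, m2, m3)];
    (split; [unfold tri_in; repeat split; try assumption|split; [|exact Q]]);
    simpl; unfold m1, m2, m3;
    first [ replace (a - a)%C with (RtoC 0) by ring; rewrite Cmod_0; exact Hd
          | eapply HH with (w := (a - b)%C); [assumption|reflexivity|field]
          | eapply HH with (w := (b - a)%C); [assumption|reflexivity|field]
          | eapply HH with (w := (b - c)%C); [assumption|reflexivity|field]
          | eapply HH with (w := (c - b)%C); [assumption|reflexivity|field]
          | eapply HH with (w := (a - c)%C); [assumption|reflexivity|field]
          | eapply HH with (w := (c - a)%C); [assumption|reflexivity|field] ].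
Qed.

(** Bisection keeps at least a quarter of the integral, while side length and deviation of [f] from
    its affine part both scale like 2^-n, so that the factor 4^n is beaten by differentiability at
    the limit point. A closed convex region contains that point; the lemma is applied to discs and
    to half-planes. *)
Lemma goursat (Om : C -> Prop) (f : C -> C) (a b c : C) :
  convex Om -> closedC Om -> (forall w, Om w -> exists l, cdiff f w l) ->
  Om a -> Om b -> Om c -> tri f a b c = 0%C.
Proof.
  intros HO Hcl Hf Ha Hb Hc.
  assert (Hcont : forall w, Om w -> continuous f w).
  { intros w Hw. destruct (Hf w Hw) as [l Hl]. apply (cdiff_continuous _ _ _ Hl). }
  set (d := Cmod (b - a) + Cmod (c - b) + Cmod (a - c)).
  assert (HT : tri_in Om d (a, b, c)).
  { pose proof (Cmod_ge_0 (b - a)). pose proof (Cmod_ge_0 (c - b)).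
    pose proof (Cmod_ge_0 (a - c)). unfold tri_in, d; repeat split; try assumption; lra. }
  set (nxt := fun (e : R) (T : C * C * C) => epsilon (inhabits T) (fun T' =>
    tri_in Om (e / 2) T' /\ Cmod (fst (fst T') - fst (fst T)) <= e / 2 /\
    let '(a, b, c) := T in let '(a', b', c') := T' in
    Cmod (tri f a b c) <= 4 * Cmod (tri f a' b' c'))).
  assert (Hnxt : forall e T, tri_in Om e T -> let T' := nxt e T in
    tri_in Om (e / 2) T' /\ Cmod (fst (fst T') - fst (fst T)) <= e / 2 /\
    let '(a, b, c) := T in let '(a', b', c') := T' in
    Cmod (tri f a b c) <= 4 * Cmod (tri f a' b' c')).
  { intros e T He. apply epsilon_spec. apply tri_step; assumption. }
  set (T := fix T n := match n with O => (a, b, c) | S n => nxt (d / 2 ^ n) (T n) end).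
  assert (Hin : forall n, tri_in Om (d / 2 ^ n) (T n)).
  { induction n.
    - simpl. replace (d / 1) with d by field. exact HT.
    - replace (d / 2 ^ S n) with (d / 2 ^ n / 2)
        by (simpl; field; apply pow_nonzero; lra).
      apply (Hnxt _ _ IHn). }
  assert (Hval : forall n, Cmod (tri f a b c) <=
            4 ^ n * (let '(x, y, z) := T n in Cmod (tri f x y z))).
  { induction n.
    - simpl. lra.
    - eapply Rle_trans; [exact IHn|].
      pose proof (Hnxt _ _ (Hin n)) as (_ & _ & H).
      change (nxt (d / 2 ^ n) (T n)) with (T (S n)) in H.
      destruct (T n) as [[x y] z]. destruct (T (S n)) as [[x' y'] z'].
      replace (4 ^ S n) with (4 ^ n * 4) by (simpl; ring). rewrite Rmult_assoc.
      apply Rmult_le_compat_l; [apply pow_le; lra|exact H]. }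
  destruct (C_geom_lim (fun n => fst (fst (T n))) d) as [zs Hzs].
  { intros n. replace (d / 2 ^ S n) with (d / 2 ^ n / 2)
      by (simpl; field; apply pow_nonzero; lra).
    apply (Hnxt _ _ (Hin n)). }
  assert (Hd0 : 0 <= d).
  { unfold d. pose proof (Cmod_ge_0 (b - a)). pose proof (Cmod_ge_0 (c - b)).
    pose proof (Cmod_ge_0 (a - c)). lra. }
  assert (Ozs : Om zs).
  { apply Hcl. intros eps He. destruct (geom_small d eps Hd0 He) as [n Hn].
    exists (fst (fst (T n))). split.
    - specialize (Hin n). destruct (T n) as [[x y] z]. apply Hin.
    - rewrite Cmod_minus_sym. eapply Rle_lt_trans; [apply Hzs|exact Hn]. }
  destruct (Hf zs Ozs) as [l Hl].
  apply Cmod_eq_0. apply Rle_antisym; [|apply Cmod_ge_0].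
  apply le_epsilon. intros eps He. rewrite Rplus_0_l.
  (* Each of the three sides contributes at most e (2 dn) dn, so 4^n times the total is 6 e d^2; the
     1 covers d = 0. *)
  set (e := eps / (6 * (d * d + 1))).
  assert (He' : 0 < e) by (apply Rdiv_lt_0_compat; nra).
  destruct (Hl e He') as [del [Hdel Hw]].
  destruct (geom_small d (del / 2) Hd0) as [n Hn]; [lra|].
  eapply Rle_trans; [apply (Hval n)|].
  specialize (Hin n). specialize (Hzs n). set (dn := d / 2 ^ n) in *.
  assert (Hdn : 0 <= dn) by (eapply Rle_trans; [apply Cmod_ge_0|exact Hzs]).
  destruct (T n) as [[x y] z]. simpl in Hzs.
  destruct Hin as (Ox & Oy & Oz & L1 & L2 & L3).
  (* A primitive of the affine approximation of [f] at [zs]. *)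
  set (P := fun w => (f zs * w + l / 2 * ((w - zs) * (w - zs)))%C).
  set (p := fun w => (f zs + l * (w - zs))%C).
  assert (HP : forall w, cdiff P w (p w)).
  { intros w. unfold P, p.
    replace (f zs + l * (w - zs))%C with (f zs + l / 2 * (2 * (w - zs) * (1 - 0)))%C by field.
    apply cdiff_plus; [apply cdiff_lin|].
    apply cdiff_scal, (cdiff_comp (fun w => (w * w)%C) (fun w => (w - zs)%C));
      [apply cdiff_minus; [apply cdiff_id|apply cdiff_const]|apply cdiff_sqr]. }
  assert (Hp : forall w, continuous p w).
  { intros w. eapply cdiff_continuous, cdiff_plus; [apply cdiff_const|].
    apply cdiff_scal, cdiff_minus; [apply cdiff_id|apply cdiff_const]. }
  assert (SS : forall u v, Om u -> Om v -> Cmod (u - zs) <= 2 * dn -> Cmod (v - zs) <= 2 * dn ->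
     Cmod (v - u) <= dn -> Cmod (seg f u v - (P v - P u)) <= e * (2 * dn) * dn).
  { intros u v Ou Ov Du Dv Duv.
    apply Rle_trans with (e * (2 * dn) * Cmod (v - u)).
    2: { apply Rmult_le_compat_l; [nra|exact Duv]. }
    apply (seg_approx f P p).
    - intros t Ht. apply Hcont, HO; assumption.
    - intros t Ht. apply HP.
    - intros t Ht. apply Hp.
    - intros t Ht. set (w := (u + RtoC t * (v - u))%C).
      assert (Dw : Cmod (w - zs) <= 2 * dn).
      { replace (w - zs)%C with (RtoC (1 - t) * (u - zs) + RtoC t * (v - zs))%C
          by (unfold w; rewrite RtoC_minus; ring).
        eapply Rle_trans; [apply Cmod_triangle|].
        rewrite !Cmod_mult, !Cmod_R, !Rabs_pos_eq by lra. nra. }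
      unfold p. replace (f w - (f zs + l * (w - zs)))%C with (f w - f zs - l * (w - zs))%C by ring.
      eapply Rle_trans; [apply Hw; lra|]. apply Rmult_le_compat_l; lra. }
  rewrite Cmod_minus_sym in Hzs.
  assert (Dx : Cmod (x - zs) <= 2 * dn) by lra.
  assert (Dy : Cmod (y - zs) <= 2 * dn).
  { eapply Rle_trans; [apply (Cmod_dist_triangle _ x)|]. lra. }
  assert (Dz : Cmod (z - zs) <= 2 * dn).
  { eapply Rle_trans; [apply (Cmod_dist_triangle _ x)|].
    rewrite (Cmod_minus_sym z). lra. }
  pose proof (SS x y Ox Oy Dx Dy L1) as S1.
  pose proof (SS y z Oy Oz Dy Dz L2) as S2.
  pose proof (SS z x Oz Ox Dz Dx L3) as S3.
  assert (ST : Cmod (tri f x y z) <= 6 * e * (dn * dn)).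
  { unfold tri. replace (seg f x y + seg f y z + seg f z x)%C with
      ((seg f x y - (P y - P x)) + (seg f y z - (P z - P y)) + (seg f z x - (P x - P z)))%C
      by ring.
    eapply Rle_trans; [apply Cmod_triangle|].
    eapply Rle_trans; [apply Rplus_le_compat_r, Cmod_triangle|]. nra. }
  apply Rle_trans with (4 ^ n * (6 * e * (dn * dn))).
  { apply Rmult_le_compat_l; [apply pow_le; lra|exact ST]. }
  replace (4 ^ n * (6 * e * (dn * dn))) with (6 * e * (d * d)).
  - unfold e. apply Rmult_le_reg_r with (d * d + 1); [nra|].
    replace (6 * (eps / (6 * (d * d + 1))) * (d * d) * (d * d + 1)) with (eps * (d * d))
      by (field; nra). nra.
  - unfold dn. replace 4 with (2 * 2) by ring. rewrite Rpow_mult_distr. field.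
    apply pow_nonzero; lra.
Qed.

(** * Primitives and means over circles *)

Lemma holo_cdiff (f : C -> C) (z : C) : holo f -> inD z -> cdiff f z (cderiv f z).
Proof. intros H Hz. apply is_derive_cdiff, C_derive_correct; [exact z|]. apply H, Hz. Qed.

Lemma holo_intro (f : C -> C) : (forall z, inD z -> exists l, cdiff f z l) -> holo f.
Proof. intros H z Hz. destruct (H z Hz) as [l Hl]. exists l. apply is_derive_cdiff, Hl. Qed.

Lemma cderiv_unique (f : C -> C) (z l : C) : cdiff f z l -> cderiv f z = l.
Proof. intros H. apply is_C_derive_unique, is_derive_cdiff, H. Qed.

Lemma holo_continuous (f : C -> C) (z : C) : holo f -> inD z -> continuous f z.
Proof. intros H Hz. apply cdiff_continuous with (cderiv f z), holo_cdiff; assumption. Qed.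

(** Projecting on the direction D = f b - f a, that is, applying the real mean value theorem to Re
    (conj D f), gives |D|^2 <= |D| K |b - a|. *)
Lemma mean_value_ineq (f p : C -> C) (a b : C) (K : R) :
  on_seg (fun w => cdiff f w (p w)) a b -> on_seg (fun w => Cmod (p w) <= K) a b ->
  Cmod (f b - f a) <= K * Cmod (b - a).
Proof.
  intros H HK. set (D := (f b - f a)%C).
  assert (HK0 : 0 <= K).
  { eapply Rle_trans; [apply Cmod_ge_0|]. apply (HK 0); lra. }
  set (g := fun t : R => Re (Cconj D * f (a + RtoC t * (b - a)))%C).
  set (dg := fun t : R => Re (Cconj D * (p (a + RtoC t * (b - a)) * (b - a)))%C).
  destruct (mean_value g dg 0 1) as [c [Hc E]]; [lra| |].
  { intros t Ht. apply rdiff_Re. unfold g, dg. rewrite Cmult_assoc.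
    apply (rdiff_line (fun w => Cconj D * f w)%C), cdiff_scal, H, Ht. }
  assert (E1 : g 1 - g 0 = Cmod D ^ 2).
  { unfold g. replace (a + RtoC 1 * (b - a))%C with b by ring.
    replace (a + RtoC 0 * (b - a))%C with a by ring.
    rewrite Cmod2_alt. rewrite !re_mult.
    replace (f b) with (f a + D)%C by (unfold D; ring).
    destruct D, (f a). simpl. unfold Re, Im; simpl. ring. }
  assert (E2 : dg c <= Cmod D * (K * Cmod (b - a))).
  { unfold dg. eapply Rle_trans; [apply Rle_abs|].
    eapply Rle_trans; [apply re_le_Cmod|]. rewrite !Cmod_mult, Cmod_conj.
    apply Rmult_le_compat_l; [apply Cmod_ge_0|].
    apply Rmult_le_compat_r; [apply Cmod_ge_0|]. apply HK, Hc. }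
  destruct (Rle_lt_or_eq_dec 0 (Cmod D) (Cmod_ge_0 D)) as [Hp|Hz].
  + apply Rmult_le_reg_l with (Cmod D); [exact Hp|]. simpl in E1. lra.
  + rewrite <- Hz. apply Rmult_le_pos; [exact HK0|apply Cmod_ge_0].
Qed.

Definition disc (r : R) (z : C) : Prop := Cmod z <= r.

Lemma disc_convex (r : R) : convex (disc r).
Proof.
  intros a b Ha Hb t Ht. unfold disc in *.
  replace (a + RtoC t * (b - a))%C with (RtoC (1 - t) * a + RtoC t * b)%C
    by (rewrite RtoC_minus; ring).
  eapply Rle_trans; [apply Cmod_triangle|].
  rewrite !Cmod_mult, !Cmod_R, !Rabs_pos_eq by lra. nra.
Qed.

Lemma disc_closed (r : R) : closedC (disc r).
Proof.
  intros z H. unfold disc. apply le_epsilon. intros eps He.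
  destruct (H eps He) as [w [Hw Hd]]. unfold disc in Hw.
  pose proof (Cmod_triangle_inv z w) as Ht. rewrite Cmod_minus_sym in Ht. lra.
Qed.

Lemma inD_convex : convex inD.
Proof.
  intros a b Ha Hb t Ht. unfold inD in *.
  apply Rle_lt_trans with (Rmax (Cmod a) (Cmod b)); [|apply Rmax_lub_lt; assumption].
  apply (disc_convex (Rmax (Cmod a) (Cmod b))); [apply Rmax_l|apply Rmax_r|exact Ht].
Qed.

Lemma inD_range z : inD z -> 0 <= Cmod z < 1.
Proof. intros Hz. split; [apply Cmod_ge_0|exact Hz]. Qed.

Lemma inD_0 : inD 0%C.
Proof. unfold inD. rewrite Cmod_0. lra. Qed.

Lemma goursat_disc (f : C -> C) (a b c : C) :
  holo f -> inD a -> inD b -> inD c -> tri f a b c = 0%C.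
Proof.
  intros Hf Ha Hb Hc.
  set (r := Rmax (Cmod a) (Rmax (Cmod b) (Cmod c))).
  apply (goursat (disc r)).
  - apply disc_convex.
  - apply disc_closed.
  - intros w Hw. exists (cderiv f w). apply holo_cdiff; [exact Hf|].
    unfold inD in *. eapply Rle_lt_trans; [exact Hw|]. repeat apply Rmax_lub_lt; assumption.
  - apply Rmax_l.
  - eapply Rle_trans; [apply Rmax_l|apply Rmax_r].
  - eapply Rle_trans; [apply Rmax_r|apply Rmax_r].
Qed.

(** Goursat on the triangle 0, z, w turns the increment of the primitive into the integral over
    [z,w], which is compared with the constant [k z]. *)
Lemma cdiff_primitive (k : C -> C) (z : C) : holo k -> inD z -> cdiff (seg k 0) z (k z).
Proof.
  intros Hk Hz eps He.
  destruct (cdiff_near k z _ (holo_cdiff k z Hk Hz) eps He) as [d [Hd Hn]].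
  exists (Rmin d (1 - Cmod z)). unfold inD in Hz. split; [apply Rmin_glb_lt; lra|].
  intros w Bw.
  destruct (Rmin_Rgt_l _ _ _ Bw) as [B1 B2].
  assert (Hw : inD w).
  { unfold inD. pose proof (Cmod_triangle_inv w z). lra. }
  assert (Sc : forall x y, inD x -> inD y -> on_seg (fun w => continuous k w) x y).
  { intros x y Hx Hy t Ht. apply holo_continuous; [exact Hk|]. apply inD_convex; assumption. }
  pose proof (goursat_disc k 0 z w Hk inD_0 Hz Hw) as T. unfold tri in T.
  rewrite (seg_swap k 0 w) in T by (apply Sc; [apply inD_0|exact Hw]).
  replace (seg k 0 w - seg k 0 z - k z * (w - z))%C
    with (seg k z w - (k z * w - k z * z) - (seg k 0 z + seg k z w + - seg k 0 w))%C by ring.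
  rewrite T. replace (seg k z w - (k z * w - k z * z) - 0)%C
    with (seg k z w - (k z * w - k z * z))%C by ring.
  apply (seg_approx k (fun w => (k z * w)%C) (fun _ => k z)).
  - apply Sc; assumption.
  - intros t Ht. apply cdiff_lin.
  - intros t Ht. eapply cdiff_continuous, cdiff_const.
  - intros t Ht. apply Rlt_le, Hn.
    replace (z + RtoC t * (w - z) - z)%C with (RtoC t * (w - z))%C by ring.
    rewrite Cmod_mult, Cmod_R, Rabs_pos_eq by lra.
    pose proof (Cmod_ge_0 (w - z)). nra.
Qed.

(** * The complex exponential *)

Lemma cexp_plus (z w : C) : cexp (z + w) = (cexp z * cexp w)%C.
Proof.
  destruct z as [x y], w as [u v]. unfold cexp, Re, Im. simpl.
  rewrite exp_plus, cos_plus, sin_plus. apply injective_projections; simpl; ring.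
Qed.

Lemma deriv_at_0 (f : R -> R) (l : R) : derivable_pt_lim f 0 l ->
  forall eps, 0 < eps -> exists d, 0 < d /\ forall h, Rabs h < d ->
    Rabs (f h - f 0 - l * h) <= eps * Rabs h.
Proof.
  intros H eps He. destruct (H eps He) as [d Hd]. exists d. split; [apply cond_pos|].
  intros h Hh. destruct (Req_dec h 0) as [->|Hn].
  - replace (f 0 - f 0 - l * 0) with 0 by ring. rewrite Rabs_R0. lra.
  - specialize (Hd h Hn Hh). rewrite Rplus_0_l in Hd.
    replace (f h - f 0 - l * h) with (((f h - f 0) / h - l) * h) by (field; exact Hn).
    rewrite Rabs_mult. apply Rmult_le_compat_r; [apply Rabs_pos|lra].
Qed.

Lemma cdiff_cexp_0 : cdiff cexp 0 1.
Proof.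
  (* Real and imaginary part of the remainder each cost at most 4 e h with h = |w|, together less
     than eps h. *)
  intros eps He. set (e := Rmin 1 (eps / 10)).
  assert (He0 : 0 < e) by (apply Rmin_glb_lt; lra).
  assert (He1 : e <= 1) by apply Rmin_l. assert (He2 : e <= eps / 10) by apply Rmin_r.
  destruct (deriv_at_0 exp 1 derivable_pt_lim_exp_0 e He0) as [d1 [Hd1 H1]].
  destruct (deriv_at_0 sin 1 derivable_pt_lim_sin_0 e He0) as [d2 [Hd2 H2]].
  destruct (deriv_at_0 cos 0 derivable_pt_lim_cos_0 e He0) as [d3 [Hd3 H3]].
  rewrite exp_0 in H1. rewrite sin_0 in H2. rewrite cos_0 in H3.
  exists (Rmin (Rmin d1 d2) (Rmin d3 (e / 2))).
  split; [repeat apply Rmin_glb_lt; lra|].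
  intros w Bw. replace (w - 0)%C with w in * by ring.
  destruct (Rmin_Rgt_l _ _ _ Bw) as [M1 M2].
  destruct (Rmin_Rgt_l _ _ _ M1) as [M3 M4]. destruct (Rmin_Rgt_l _ _ _ M2) as [M5 M6].
  pose proof (re_le_Cmod w) as R1.
  pose proof (im_le_Cmod w) as R2.
  destruct w as [x y]. unfold Re, Im in R1, R2. simpl in R1, R2.
  set (h := Cmod (x, y)) in *.
  assert (A1 : Rabs (exp x - 1 - 1 * x) <= e * Rabs x) by (apply H1; lra).
  assert (A2 : Rabs (sin y - 0 - 1 * y) <= e * Rabs y) by (apply H2; lra).
  assert (A3 : Rabs (cos y - 1 - 0 * y) <= e * Rabs y) by (apply H3; lra).
  pose proof (Rabs_pos x) as Px. pose proof (Rabs_pos y) as Py.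
  assert (A4 : Rabs (exp x - 1) <= 2 * Rabs x).
  { replace (exp x - 1) with ((exp x - 1 - 1 * x) + x) by ring.
    eapply Rle_trans; [apply Rabs_triang|]. nra. }
  assert (A5 : exp x <= 3).
  { pose proof (Rle_abs (exp x - 1)). lra. }
  assert (B1 : Rabs (Re (cexp (x, y) - cexp 0 - 1 * (x, y))%C) <= 4 * e * h).
  { replace (Re (cexp (x, y) - cexp 0 - 1 * (x, y))%C)
      with (exp x * (cos y - 1 - 0 * y) + (exp x - 1 - 1 * x)).
    2: { unfold cexp, Re, Im; simpl. rewrite exp_0, cos_0. ring. }
    eapply Rle_trans; [apply Rabs_triang|]. rewrite Rabs_mult, (Rabs_pos_eq (exp x))
      by (left; apply exp_pos).
    assert (exp x * Rabs (cos y - 1 - 0 * y) <= 3 * (e * Rabs y)).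
    { apply Rmult_le_compat; try assumption. left; apply exp_pos. apply Rabs_pos. }
    nra. }
  assert (B2 : Rabs (Im (cexp (x, y) - cexp 0 - 1 * (x, y))%C) <= 4 * e * h).
  { replace (Im (cexp (x, y) - cexp 0 - 1 * (x, y))%C)
      with (exp x * (sin y - 0 - 1 * y) + y * (exp x - 1)).
    2: { unfold cexp, Re, Im; simpl. rewrite exp_0, sin_0. ring. }
    eapply Rle_trans; [apply Rabs_triang|]. rewrite !Rabs_mult, (Rabs_pos_eq (exp x))
      by (left; apply exp_pos).
    assert (exp x * Rabs (sin y - 0 - 1 * y) <= 3 * (e * Rabs y)).
    { apply Rmult_le_compat; try assumption. left; apply exp_pos. apply Rabs_pos. }
    assert (Rabs y * Rabs (exp x - 1) <= Rabs y * e).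
    { apply Rmult_le_compat_l; lra. }
    nra. }
  eapply Rle_trans; [apply Cmod_le_abs|]. unfold Re, Im in B1, B2.
  assert (Hh : 0 <= h) by lra. nra.
Qed.

Lemma cdiff_cexp (z : C) : cdiff cexp z (cexp z).
Proof.
  apply cdiff_ext with (fun w => (cexp z * cexp (w - z))%C).
  { intros w. rewrite <- cexp_plus. f_equal. ring. }
  assert (H : cdiff (fun w => cexp z * cexp (w - z))%C z (cexp z * (1 * (1 - 0)))%C).
  2: { replace (cexp z * (1 * (1 - 0)))%C with (cexp z) in H by ring. exact H. }
  apply cdiff_scal. apply (cdiff_comp cexp (fun w => (w - z)%C)).
  - apply cdiff_minus; [apply cdiff_id|apply cdiff_const].
  - replace (z - z)%C with (RtoC 0) by ring. apply cdiff_cexp_0.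
Qed.

Lemma Cmod_cexp (z : C) : Cmod (cexp z) = exp (Re z).
Proof.
  unfold cexp, Cmod. simpl.
  replace (exp (Re z) * cos (Im z) * (exp (Re z) * cos (Im z) * 1) +
           exp (Re z) * sin (Im z) * (exp (Re z) * sin (Im z) * 1))
    with (exp (Re z) * exp (Re z)).
  - apply sqrt_square. left; apply exp_pos.
  - pose proof (sin2_cos2 (Im z)) as H. unfold Rsqr in H.
    transitivity (exp (Re z) * exp (Re z) *
      (sin (Im z) * sin (Im z) + cos (Im z) * cos (Im z))); [rewrite H|]; ring.
Qed.

(** Parametrised by [0,1], so that integrals in t are means over the circle and no factor 1/(2 pi i)
    appears. *)
Definition circ (t : R) : C := (cos (2 * PI * t), sin (2 * PI * t)).

Lemma Cmod_circ (t : R) : Cmod (circ t) = 1.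
Proof.
  unfold circ, Cmod. simpl.
  replace (cos (2 * PI * t) * (cos (2 * PI * t) * 1) + sin (2 * PI * t) * (sin (2 * PI * t) * 1))
    with 1; [apply sqrt_1|].
  pose proof (sin2_cos2 (2 * PI * t)) as H. unfold Rsqr in H. lra.
Qed.

Lemma continuous_circ (a : C) (rho t : R) : continuous (fun t => (a + RtoC rho * circ t)%C) t.
Proof.
  set (tau := (0, 2 * PI) : C).
  apply continuous_ext with (fun t => (a + RtoC rho * cexp (0 + RtoC t * tau))%C).
  { intros s. do 2 f_equal. unfold cexp, circ, tau, Re, Im. simpl.
    replace (0 + (s * 0 - 0 * (2 * PI))) with 0 by ring.
    replace (0 + (s * (2 * PI) + 0 * 0)) with (2 * PI * s) by ring.
    rewrite exp_0, !Rmult_1_l. reflexivity. }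
  eapply rdiff_continuous, (rdiff_line (fun w => (a + RtoC rho * cexp w)%C)).
  apply cdiff_plus; [apply cdiff_const|apply cdiff_scal, cdiff_cexp].
Qed.

Lemma circ_neq_0 (rho t : R) : 0 < rho -> (RtoC rho * circ t)%C <> 0%C.
Proof.
  intros H. apply Cmod_gt_0. rewrite Cmod_mult, Cmod_circ, Cmod_R, Rabs_pos_eq; lra.
Qed.

Lemma Cmod_rho_circ (rho t : R) : 0 <= rho -> Cmod (RtoC rho * circ t) = rho.
Proof. intros H. rewrite Cmod_mult, Cmod_circ, Cmod_R, Rabs_pos_eq; lra. Qed.

Lemma continuous_comp_circ (q : C -> C) (a : C) (r r2 t : R) : 0 < r <= r2 ->
  (forall z, z <> a -> Cmod (z - a) <= r2 -> exists l, cdiff q z l) ->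
  continuous (fun t => q (a + RtoC r * circ t)%C) t.
Proof.
  intros Hr Hq. apply (continuous_comp (fun t => (a + RtoC r * circ t)%C) q); [apply continuous_circ|].
  assert (M : (a + RtoC r * circ t - a)%C = (RtoC r * circ t)%C) by ring.
  destruct (Hq (a + RtoC r * circ t)%C) as [l Hl].
  - intros E. apply (circ_neq_0 r t); [lra|]. rewrite <- M, E. ring.
  - rewrite M, Cmod_rho_circ; lra.
  - apply cdiff_continuous with l, Hl.
Qed.

(** The map w -> a + [cexp w] sends this half-plane onto the punctured closed disc of radius exp L
    about a. *)
Lemma half_plane_convex (L : R) : convex (fun z => Re z <= L).
Proof.
  intros [a1 a2] [b1 b2] Ha Hb t Ht. unfold Re in *. simpl in *. nra.
Qed.

Lemma half_plane_closed (L : R) : closedC (fun z => Re z <= L).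
Proof.
  intros z H. apply le_epsilon. intros eps He.
  destruct (H eps He) as [w [Hw Hd]].
  pose proof (re_le_Cmod (w - z)) as Ht.
  replace (Re (w - z)%C) with (Re w - Re z) in Ht by reflexivity.
  rewrite Rabs_minus_sym in Ht. pose proof (Rle_abs (Re z - Re w)). lra.
Qed.

(* In the coordinate w = log(z - a) concentric circles become parallel vertical segments, and
   Goursat's lemma on the rectangle between them needs no continuity of the derivative. *)
Lemma mean_circ_const (q : C -> C) (a : C) (r1 r2 : R) : 0 < r1 <= r2 ->
  (forall z, z <> a -> Cmod (z - a) <= r2 -> exists l, cdiff q z l) ->
  CI (fun t => q (a + RtoC r1 * circ t)%C) 0 1 = CI (fun t => q (a + RtoC r2 * circ t)%C) 0 1.
Proof.
  intros Hr Hq.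
  set (W := fun w => q (a + cexp w)%C). set (L := ln r2).
  set (Om := fun z : C => Re z <= L).
  assert (HW : forall w, Om w -> exists l, cdiff W w l).
  { intros w Hw. destruct (Hq (a + cexp w)%C) as [l Hl].
    - intros E. assert (E' : cexp w = 0%C).
      { replace (cexp w) with (a + cexp w - a)%C by ring. rewrite E. ring. }
      pose proof (exp_pos (Re w)) as P. rewrite <- Cmod_cexp, E', Cmod_0 in P. lra.
    - replace (a + cexp w - a)%C with (cexp w) by ring. rewrite Cmod_cexp.
      rewrite <- (exp_ln r2) by lra. destruct Hw as [Hw|Hw].
      + left; apply exp_increasing, Hw.
      + right. rewrite Hw. reflexivity.
    - exists (l * (0 + cexp w))%C. apply (cdiff_comp q (fun w => (a + cexp w)%C)); [|exact Hl].
      apply cdiff_plus; [apply cdiff_const|apply cdiff_cexp]. }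
  assert (Wc : forall x y, Om x -> Om y -> on_seg (fun w => continuous W w) x y).
  { intros x y Hx Hy t Ht. destruct (HW (x + RtoC t * (y - x))%C) as [l Hl].
    - apply half_plane_convex; assumption.
    - apply cdiff_continuous with l, Hl. }
  set (A := (ln r1, 0) : C). set (B := (ln r2, 0) : C).
  set (E := (ln r2, 2 * PI) : C). set (D := (ln r1, 2 * PI) : C).
  assert (Hln : ln r1 <= ln r2).
  { destruct Hr as [Hr1 [Hr2|Hr2]]; [left; apply ln_increasing; assumption|right; congruence]. }
  assert (OA : Om A) by exact Hln. assert (OB : Om B) by (right; reflexivity).
  assert (OE : Om E) by (right; reflexivity). assert (OD : Om D) by exact Hln.
  pose proof (goursat Om W A B E (half_plane_convex L) (half_plane_closed L) HW OA OB OE) as T1.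
  pose proof (goursat Om W A E D (half_plane_convex L) (half_plane_closed L) HW OA OE OD) as T2.
  unfold tri in T1, T2.
  rewrite (seg_swap W A E) in T1 by (apply Wc; assumption).
  rewrite (seg_swap W A D) in T2 by (apply Wc; assumption).
  (* [W] has period 2 pi i, so the two horizontal sides of the rectangle cancel and the vertical
     ones must agree. *)
  assert (P1 : seg W E D = seg W B A).
  { unfold seg. apply (RInt_ext (V := C_R_CompleteNormedModule)). intros t _.
    assert (E1 : (D - E)%C = (A - B)%C).
    { unfold A, B, D, E. apply injective_projections; simpl; ring. }
    rewrite E1. f_equal. unfold W. do 2 f_equal.
    unfold cexp, A, B, E, Re, Im. simpl.
    replace (2 * PI + (t * (0 + - 0) + 0 * (ln r1 + - ln r2)))
      with (0 + (t * (0 + - 0) + 0 * (ln r1 + - ln r2)) + 2 * PI) by ring.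
    set (x := 0 + (t * (0 + - 0) + 0 * (ln r1 + - ln r2))). rewrite (cos_plus x), (sin_plus x), cos_2PI, sin_2PI.
    apply injective_projections; simpl; ring. }
  rewrite (seg_swap W A B) in P1 by (apply Wc; assumption).
  set (tau := (0, 2 * PI) : C).
  assert (V : forall r, 0 < r <= r2 -> seg W (ln r, 0)%R (ln r, 2 * PI)%R =
              (tau * CI (fun t => q (a + RtoC r * circ t)%C) 0 1)%C).
  { intros r Hr'. unfold seg. apply CI_unique.
    assert (V1 : ((ln r, 2 * PI)%R - (ln r, 0)%R)%C = tau).
    { apply injective_projections; simpl; ring. }
    apply is_CI_ext with (fun t => (tau * q (a + RtoC r * circ t))%C).
    - intros t _. rewrite V1. rewrite Cmult_comm. f_equal. unfold W. do 2 f_equal.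
      unfold cexp, circ, tau, Re, Im. simpl.
      replace (ln r + (t * 0 - 0 * (2 * PI))) with (ln r) by ring. rewrite exp_ln by lra.
      replace (0 + (t * (2 * PI) + 0 * 0)) with (2 * PI * t) by ring.
      apply injective_projections; simpl; ring.
    - apply is_CI_scal, CI_correct, ex_CI_continuous; [lra|]. intros t _.
      apply (continuous_comp_circ q a r r2); assumption. }
  pose proof (V r1 ltac:(lra)) as V1. pose proof (V r2 ltac:(lra)) as V2.
  change (ln r1, 0)%R with A in V1. change (ln r1, 2 * PI)%R with D in V1.
  change (ln r2, 0)%R with B in V2. change (ln r2, 2 * PI)%R with E in V2.
  assert (Eq : seg W A D = seg W B E).
  { rewrite P1 in T2.
    replace (seg W B E) with (seg W A D + ((seg W A B + seg W B E + - seg W A E)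
       + (seg W A E + - seg W A B + - seg W A D)))%C by ring.
    rewrite T1, T2. ring. }
  rewrite V1, V2 in Eq.
  assert (N : tau <> 0%C).
  { intros X. injection X as X. pose proof PI_RGT_0. lra. }
  apply (f_equal (fun w => (/ tau * w)%C)) in Eq.
  rewrite !Cmult_assoc, Cinv_l, !Cmult_1_l in Eq by exact N. exact Eq.
Qed.

(** * Cauchy estimates *)

Lemma heine_disc (f : C -> C) (r : R) : (forall z, Cmod z <= r -> continuous f z) ->
  forall eps, 0 < eps -> exists d, 0 < d /\ forall z w, Cmod z <= r -> Cmod w <= r ->
    Cmod (z - w) < d -> Cmod (f z - f w) < eps.
Proof.
  intros Hf eps He.
  (* The factor 3 is spent as 2 + 1: the point w lies within 2d of the centre, d for each
     coordinate, and z within d of w. A centre outside the disc gets a ball that misses the disc. *)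
  assert (L : forall z : C, exists d : posreal, forall w w', Cmod w <= r -> Cmod w' <= r ->
    Cmod (w - z) < 3 * d -> Cmod (w' - z) < 3 * d -> Cmod (f w - f w') < eps).
  { intros z. destruct (Rle_lt_dec (Cmod z) r) as [Hz|Hz].
    - destruct (continuous_C_elim _ f z (Hf z Hz) (eps / 2) ltac:(lra)) as [d Hd].
      assert (Hp : 0 < d / 3) by (pose proof (cond_pos d); lra).
      exists (mkposreal _ Hp). simpl. intros w w' _ _ B B'.
      replace (3 * (d / 3)) with (pos d) in B, B' by field.
      pose proof (Hd w (C_NormedModule_mixin_compat1 _ _ _ B)) as D1.
      pose proof (Hd w' (C_NormedModule_mixin_compat1 _ _ _ B')) as D2.
      pose proof (Cmod_dist_triangle (f w) (f z) (f w')) as T.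
      rewrite (Cmod_minus_sym (f z)) in T. lra.
    - assert (Hp : 0 < (Cmod z - r) / 3) by lra.
      exists (mkposreal _ Hp). simpl. intros w w' Hw _ B _.
      pose proof (Cmod_triangle_inv z w) as T. rewrite Cmod_minus_sym in T. lra. }
  set (del := fun z : C => proj1_sig (constructive_indefinite_description _ (L z))).
  assert (Hdel : forall z w w', Cmod w <= r -> Cmod w' <= r ->
    Cmod (w - z) < 3 * del z -> Cmod (w' - z) < 3 * del z -> Cmod (f w - f w') < eps).
  { intros z. unfold del. destruct (constructive_indefinite_description _ (L z)) as [x Hx].
    exact Hx. }
  destruct (compactness_value_2d (-r) r (-r) r (fun u v => del (u, v))) as [d Hd].
  exists d. split; [apply cond_pos|]. intros z w Hz Hw B.
  pose proof (Rmax_Cmod w) as M.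
  assert (Hx : - r <= fst w <= r).
  { apply Rabs_le_between. pose proof (Rmax_l (Rabs (fst w)) (Rabs (snd w))). lra. }
  assert (Hy : - r <= snd w <= r).
  { apply Rabs_le_between. pose proof (Rmax_r (Rabs (fst w)) (Rabs (snd w))). lra. }
  apply NNPP. intros Hn. apply (Hd (fst w) (snd w) Hx Hy).
  intros (u & v & _ & _ & D1 & D2 & D3). apply Hn.
  assert (E : Cmod (w - (u, v)) < 2 * del (u, v)).
  { eapply Rle_lt_trans; [apply Cmod_le_abs|].
    change (fst (w - (u, v))%C) with (fst w - u). change (snd (w - (u, v))%C) with (snd w - v).
    lra. }
  apply (Hdel (u, v)); try assumption.
  - pose proof (Cmod_dist_triangle z w (u, v)). lra.
  - pose proof (cond_pos (del (u, v))). lra.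
Qed.

(** Walking from 0 to z in steps shorter than the modulus of uniform continuity for 1, [f] changes
    by less than 1 per step, and the number of steps is the same for the whole disc. *)
Lemma bounded_disc (f : C -> C) (r : R) : (forall z, Cmod z <= r -> continuous f z) ->
  exists M, 0 <= M /\ forall z, Cmod z <= r -> Cmod (f z) <= M.
Proof.
  intros Hf. destruct (heine_disc f r Hf 1 Rlt_0_1) as [d [Hd H]].
  assert (G : forall n z, Cmod z <= r -> Cmod z <= INR n * (d / 2) ->
            Cmod (f z) <= Cmod (f 0%C) + INR n).
  { induction n; intros z Hz Hn.
    - simpl in *. rewrite Rmult_0_l in Hn.
      rewrite (Cmod_eq_0 z); [lra|]. apply Rle_antisym; [exact Hn|apply Cmod_ge_0].
    - rewrite S_INR in *. pose proof (pos_INR n) as Pn. pose proof (Cmod_ge_0 z) as Pz.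
      set (s := / (INR n + 1)).
      assert (Hs : (INR n + 1) * s = 1) by (apply Rinv_r; lra).
      assert (Hs0 : 0 < s) by (apply Rinv_0_lt_compat; lra).
      assert (Hzs : Cmod z * s <= d / 2) by nra.
      set (w := (RtoC (1 - s) * z)%C).
      assert (Ew : Cmod w = (1 - s) * Cmod z)
        by (unfold w; rewrite Cmod_mult, Cmod_R, Rabs_pos_eq; nra).
      assert (Hw : Cmod (f w) <= Cmod (f 0%C) + INR n) by (apply IHn; rewrite Ew; nra).
      assert (D : Cmod (f z - f w) < 1).
      { apply H; [exact Hz|rewrite Ew; nra|].
        replace (z - w)%C with (RtoC s * z)%C by (unfold w; rewrite RtoC_minus; ring).
        rewrite Cmod_mult, Cmod_R, Rabs_pos_eq; lra. }
      pose proof (Cmod_triangle_inv (f z) (f w)). lra. }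
  destruct (INR_unbounded (r / (d / 2))) as [N HN].
  exists (Cmod (f 0%C) + INR N).
  split; [pose proof (Cmod_ge_0 (f 0%C)); pose proof (pos_INR N); lra|].
  intros z Hz. apply G; [exact Hz|].
  apply Rmult_gt_compat_r with (r := d / 2) in HN; [|lra].
  replace (r / (d / 2) * (d / 2)) with r in HN by (field; lra). lra.
Qed.

(** The difference quotient at a is differentiable off a, so its mean over circles about a does not
    depend on the radius; letting the radius shrink identifies the mean with f'(a). This form of
    Cauchy's formula uses no continuity of f'. *)
Lemma cauchy_derivative (f : C -> C) (a : C) (rho : R) :
  holo f -> 0 < rho -> Cmod a + rho < 1 ->
  is_CI (fun t => ((f (a + RtoC rho * circ t) - f a) / (RtoC rho * circ t))%C) 0 1 (cderiv f a).
Proof.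
  intros Hf Hrho Ha.
  assert (Da : inD a) by (unfold inD; lra).
  set (q := fun z => ((f z - f a) / (z - a))%C).
  assert (Hq : forall z, z <> a -> Cmod (z - a) <= rho -> exists l, cdiff q z l).
  { intros z Hz Bz.
    assert (Dz : inD z).
    { unfold inD. pose proof (Cmod_triangle_inv z a). lra. }
    eexists. apply (cdiff_mult (fun z => (f z - f a)%C) (fun z => (/ (z - a))%C)).
    - apply cdiff_minus; [apply holo_cdiff; assumption|apply cdiff_const].
    - apply (cdiff_inv (fun z => (z - a)%C)).
      + apply Cminus_eq_contra, Hz.
      + apply cdiff_minus; [apply cdiff_id|apply cdiff_const]. }
  assert (Iq : forall s, 0 < s <= rho ->
    is_CI (fun t => q (a + RtoC s * circ t)%C) 0 1 (CI (fun t => q (a + RtoC s * circ t)%C) 0 1)).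
  { intros s Hs. apply CI_correct, ex_CI_continuous; [lra|]. intros t _.
    apply (continuous_comp_circ q a s rho); assumption. }
  assert (Eq : CI (fun t => q (a + RtoC rho * circ t)%C) 0 1 = cderiv f a).
  { apply Ceq_minus, Cmod_eq_0, Rle_antisym; [|apply Cmod_ge_0].
    apply le_epsilon. intros eps He. rewrite Rplus_0_l.
    destruct (holo_cdiff f a Hf Da eps He) as [d [Hd Hw]].
    set (s := Rmin (d / 2) rho).
    assert (Hs : 0 < s) by (apply Rmin_glb_lt; lra).
    assert (Hs1 : s <= d / 2) by apply Rmin_l. assert (Hs2 : s <= rho) by apply Rmin_r.
    rewrite <- (mean_circ_const q a s rho); [|lra|exact Hq].
    replace eps with (eps * (1 - 0)) by ring.
    eapply is_CI_norm_const; [lra| |apply is_CI_minus; [apply Iq; lra|]].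
    2: { assert (X : is_CI (fun _ => cderiv f a) 0 1 (scal (1 - 0) (cderiv f a)))
          by apply (is_RInt_const (V := C_R_NormedModule)).
         rewrite scal_R_Cmult in X. replace (RtoC (1 - 0) * cderiv f a)%C with (cderiv f a) in X.
         - exact X.
         - rewrite Rminus_0_r, Cmult_1_l. reflexivity. }
    intros t _. simpl. unfold q.
    assert (M : (a + RtoC s * circ t - a)%C = (RtoC s * circ t)%C) by ring.
    rewrite M. specialize (Hw (a + RtoC s * circ t)%C). rewrite M, Cmod_rho_circ in Hw by lra.
    specialize (Hw ltac:(lra)).
    replace ((f (a + RtoC s * circ t) - f a) / (RtoC s * circ t) - cderiv f a)%C
      with ((f (a + RtoC s * circ t) - f a - cderiv f a * (RtoC s * circ t)) / (RtoC s * circ t))%C.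
    - rewrite Cmod_div, Cmod_rho_circ by (first [lra | apply circ_neq_0; exact Hs]).
      apply Rle_div_l; assumption.
    - field. split.
      + intros E. apply (circ_neq_0 s t Hs). rewrite E. ring.
      + intros E. apply (circ_neq_0 s t Hs). rewrite E. ring. }
  rewrite <- Eq. eapply is_CI_ext; [|apply (Iq rho); lra].
  intros t _. unfold q. f_equal. ring.
Qed.

Lemma cauchy_estimate (f : C -> C) (a : C) (rho M : R) :
  holo f -> 0 < rho -> Cmod a + rho < 1 ->
  (forall z, Cmod (z - a) <= rho -> Cmod (f z) <= M) -> Cmod (cderiv f a) <= 2 * M / rho.
Proof.
  intros Hf Hrho Ha HM. replace (2 * M / rho) with (2 * M / rho * (1 - 0)) by ring.
  eapply is_CI_norm_const; [lra| |apply (cauchy_derivative f a rho); assumption].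
  intros t _. simpl.
  rewrite Cmod_div, Cmod_rho_circ by (first [lra | apply circ_neq_0; exact Hrho]).
  apply Rmult_le_compat_r; [left; apply Rinv_0_lt_compat, Hrho|].
  eapply Rle_trans; [apply Cmod_triangle_minus|].
  assert (Cmod (f (a + RtoC rho * circ t)%C) <= M).
  { apply HM. replace (a + RtoC rho * circ t - a)%C with (RtoC rho * circ t)%C by ring.
    rewrite Cmod_rho_circ; lra. }
  assert (Cmod (f a) <= M).
  { apply HM. replace (a - a)%C with (RtoC 0) by ring. rewrite Cmod_0. lra. }
  lra.
Qed.

Lemma cauchy_estimate_disc (f : C -> C) (r r' M : R) :
  holo f -> r < r' < 1 -> (forall z, Cmod z <= r' -> Cmod (f z) <= M) ->
  forall z, Cmod z <= r -> Cmod (cderiv f z) <= 2 * M / (r' - r).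
Proof.
  intros Hf Hr HM z Hz. apply cauchy_estimate; [exact Hf|lra|lra|].
  intros w Hw. apply HM. pose proof (Cmod_triangle_inv w z). lra.
Qed.

Lemma holo_bounded (f : C -> C) (r : R) : holo f -> r < 1 ->
  exists M, 0 <= M /\ forall z, Cmod z <= r -> Cmod (f z) <= M.
Proof.
  intros Hf Hr. apply bounded_disc. intros z Hz.
  apply holo_continuous; [exact Hf|]. unfold inD; lra.
Qed.

Lemma cderiv_bounded (f : C -> C) (r : R) : holo f -> r < 1 ->
  exists M, 0 <= M /\ forall z, Cmod z <= r -> Cmod (cderiv f z) <= M.
Proof.
  intros Hf Hr. destruct (holo_bounded f ((1 + r) / 2) Hf) as [M [HM0 HM]]; [lra|].
  exists (2 * M / ((1 + r) / 2 - r)). split.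
  - apply Rdiv_le_0_compat; lra.
  - apply cauchy_estimate_disc; [exact Hf|lra|exact HM].
Qed.

Lemma disc_seg (P : C -> Prop) (r : R) (a b : C) :
  (forall z, Cmod z <= r -> P z) -> Cmod a <= r -> Cmod b <= r -> on_seg P a b.
Proof. intros H Ha Hb t Ht. apply H, disc_convex; assumption. Qed.

Lemma holo_lipschitz (f : C -> C) (r K : R) (a b : C) : holo f -> r < 1 ->
  (forall z, Cmod z <= r -> Cmod (cderiv f z) <= K) -> Cmod a <= r -> Cmod b <= r ->
  Cmod (f b - f a) <= K * Cmod (b - a).
Proof.
  intros Hf Hr HK Ha Hb. apply mean_value_ineq with (p := cderiv f).
  - apply disc_seg with r; try assumption.
    intros z Hz. apply holo_cdiff; [exact Hf|]. unfold inD; lra.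
  - apply disc_seg with r; assumption.
Qed.

(** Subtracting Cauchy's formulas at a and b over circles of equal radius leaves increments of [f]
    from a to b and from a+u to b+u, both controlled by a bound on f'. *)
Lemma cderiv_lipschitz (f : C -> C) (r : R) : holo f -> r < 1 ->
  exists K, 0 <= K /\ forall a b, Cmod a <= r -> Cmod b <= r ->
    Cmod (cderiv f b - cderiv f a) <= K * Cmod (b - a).
Proof.
  intros Hf Hr. set (r' := (1 + r) / 2). set (rho := (1 - r) / 2).
  destruct (cderiv_bounded f r' Hf) as [K [HK0 HK]]; [unfold r'; lra|].
  exists (2 * K / rho). split; [apply Rdiv_le_0_compat; unfold rho; lra|].
  intros a b Ha Hb.
  replace (2 * K / rho * Cmod (b - a)) with (2 * K / rho * Cmod (b - a) * (1 - 0)) by ring.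
  eapply is_CI_norm_const;
    [lra| |apply is_CI_minus; apply (cauchy_derivative f _ rho); try assumption; unfold rho; lra].
  assert (Hrho : 0 < rho) by (unfold rho; lra).
  intros t _. simpl. set (u := (RtoC rho * circ t)%C).
  assert (Mu : Cmod u = rho) by (apply Cmod_rho_circ; lra).
  assert (Hu : u <> 0%C) by (apply circ_neq_0; exact Hrho).
  assert (In : forall z, Cmod z <= r -> Cmod (z + u) <= r').
  { intros z Hz. eapply Rle_trans; [apply Cmod_triangle|]. rewrite Mu. unfold r', rho. lra. }
  replace ((f (b + u) - f b) / u - (f (a + u) - f a) / u)%C
    with (((f (b + u) - f (a + u)) - (f b - f a)) / u)%C by (field; exact Hu).
  rewrite Cmod_div, Mu by exact Hu.
  replace (2 * K / rho * Cmod (b - a)) with ((2 * K * Cmod (b - a)) / rho) by (field; lra).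
  apply Rmult_le_compat_r; [left; apply Rinv_0_lt_compat, Hrho|].
  eapply Rle_trans; [apply Cmod_triangle_minus|].
  assert (Cmod (f (b + u)%C - f (a + u)%C) <= K * Cmod (b - a)).
  { replace (b - a)%C with (b + u - (a + u))%C by ring.
    apply (holo_lipschitz f r'); try assumption; [unfold r'; lra|apply In, Ha|apply In, Hb]. }
  assert (Cmod (f b - f a) <= K * Cmod (b - a)).
  { apply (holo_lipschitz f r'); try assumption; unfold r'; lra. }
  lra.
Qed.

Lemma holo_taylor1 (f : C -> C) (r K : R) (a b : C) : holo f -> r < 1 ->
  (forall a b, Cmod a <= r -> Cmod b <= r -> Cmod (cderiv f b - cderiv f a) <= K * Cmod (b - a)) ->
  0 <= K -> Cmod a <= r -> Cmod b <= r ->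
  Cmod (f b - f a - cderiv f a * (b - a)) <= K * Cmod (b - a) * Cmod (b - a).
Proof.
  intros Hf Hr HK HK0 Ha Hb.
  replace (f b - f a - cderiv f a * (b - a))%C
    with ((f b - cderiv f a * b) - (f a - cderiv f a * a))%C by ring.
  apply (mean_value_ineq (fun z => (f z - cderiv f a * z)%C) (fun z => (cderiv f z - cderiv f a)%C)).
  - apply disc_seg with r; try assumption. intros z Hz.
    apply cdiff_minus; [apply holo_cdiff; [exact Hf|unfold inD; lra]|apply cdiff_lin].
  - intros t Ht. eapply Rle_trans.
    + apply HK; [exact Ha|]. apply disc_convex; assumption.
    + apply Rmult_le_compat_l; [exact HK0|].
      replace (a + RtoC t * (b - a) - a)%C with (RtoC t * (b - a))%C by ring.
      rewrite Cmod_mult, Cmod_R, Rabs_pos_eq by lra. pose proof (Cmod_ge_0 (b - a)). nra.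
Qed.

(** Differentiation of Cauchy's formula for f'(a) under the integral in a: the candidate [J] is the
    mean of (f'(a+u) - f'(a))/u, and the error is the difference of two first-order Taylor
    remainders, quadratic in b - a. *)
Theorem holo_cderiv (f : C -> C) : holo f -> holo (cderiv f).
Proof.
  intros Hf. apply holo_intro. intros a Ha. unfold inD in Ha.
  set (r := (1 + Cmod a) / 2). set (r' := (1 + r) / 2). set (rho := (1 - r) / 2).
  assert (Hrho : 0 < rho) by (unfold rho, r; lra).
  destruct (cderiv_lipschitz f r' Hf) as [K [HK0 HK]]; [unfold r', r; lra|].
  assert (In : forall z t, Cmod z <= r -> Cmod (z + RtoC rho * circ t) <= r').
  { intros z t Hz. eapply Rle_trans; [apply Cmod_triangle|].
    rewrite Cmod_rho_circ by lra. unfold r', rho. lra. }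
  set (J := CI (fun t => ((cderiv f (a + RtoC rho * circ t) - cderiv f a) /
                                (RtoC rho * circ t))%C) 0 1).
  assert (IJ : is_CI (fun t => ((cderiv f (a + RtoC rho * circ t) - cderiv f a) /
                                (RtoC rho * circ t))%C) 0 1 J).
  { apply CI_correct, ex_CI_continuous; [lra|]. intros t _.
    apply (continuous_Cmult _ (fun t => (cderiv f (a + RtoC rho * circ t) - cderiv f a)%C)
             (fun t => (/ (RtoC rho * circ t))%C)).
    - apply (continuous_comp (fun t => (a + RtoC rho * circ t)%C)
        (fun z => (cderiv f z - cderiv f a)%C)); [apply continuous_circ|].
      apply continuous_Cminus; [|apply continuous_const].
      apply continuous_C_intro. intros eps He.
      set (w := (a + RtoC rho * circ t)%C).
      assert (Hw : Cmod w < r').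
      { unfold w. eapply Rle_lt_trans; [apply Cmod_triangle|].
        rewrite Cmod_rho_circ by lra. unfold r', rho, r. lra. }
      apply (locally_C_ball w _ (Rmin (r' - Cmod w) (eps / (K + 1)))).
      { apply Rmin_glb_lt; [lra|]. apply Rdiv_lt_0_compat; lra. }
      intros v Bv. destruct (Rmin_Rgt_l _ _ _ Bv) as [B1 B2].
      pose proof (Cmod_triangle_inv v w).
      eapply Rle_lt_trans; [apply HK; lra|].
      apply Rle_lt_trans with ((K + 1) * Cmod (v - w)).
      { apply Rmult_le_compat_r; [apply Cmod_ge_0|lra]. }
      replace eps with ((K + 1) * (eps / (K + 1))) by (field; lra).
      apply Rmult_lt_compat_l; lra.
    - apply continuous_Cinv; [apply circ_neq_0, Hrho|].
      apply continuous_ext with (fun t => (0 + RtoC rho * circ t)%C); [intros s; apply Cplus_0_l|].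
      apply continuous_circ. }
  exists J. intros eps He.
  exists (Rmin (r - Cmod a) (eps * rho / (2 * K + 1))). split.
  { apply Rmin_glb_lt; [unfold r; lra|]. apply Rdiv_lt_0_compat; nra. }
  intros b Bb.
  destruct (Rmin_Rgt_l _ _ _ Bb) as [Bb1 Bb2].
  assert (Hb : Cmod b <= r) by (pose proof (Cmod_triangle_inv b a); lra).
  assert (Hr : Cmod a <= r) by (unfold r; lra).
  set (h := Cmod (b - a)) in *. assert (Hh : 0 <= h) by apply Cmod_ge_0.
  apply Rle_trans with (2 * K * h * h / rho * (1 - 0)).
  - eapply is_CI_norm_const; [lra| |].
    2: { apply is_CI_minus; [apply is_CI_minus; apply (cauchy_derivative f _ rho);
           try assumption; unfold rho, r in *; lra|].
         rewrite Cmult_comm. apply is_CI_scal, IJ. }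
    intros t _. cbv beta. set (u := (RtoC rho * circ t)%C).
    assert (Hu : u <> 0%C) by (apply circ_neq_0, Hrho).
    replace ((f (b + u) - f b) / u - (f (a + u) - f a) / u
             - (b - a) * ((cderiv f (a + u) - cderiv f a) / u))%C
      with (((f (b + u) - f (a + u) - cderiv f (a + u) * ((b + u) - (a + u)))
            - (f b - f a - cderiv f a * (b - a))) / u)%C by (field; exact Hu).
    rewrite Cmod_div by exact Hu.
    assert (Mu : Cmod u = rho) by (apply Cmod_rho_circ; lra). rewrite Mu.
    apply Rmult_le_compat_r; [left; apply Rinv_0_lt_compat, Hrho|].
    eapply Rle_trans; [apply Cmod_triangle_minus|].
    assert (T1 : Cmod (f (b + u)%C - f (a + u)%C - cderiv f (a + u)%C * ((b + u) - (a + u)))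
              <= K * h * h).
    { unfold h. replace (b - a)%C with (b + u - (a + u))%C by ring.
      apply (holo_taylor1 f r'); try assumption; [unfold r', r; lra|apply In, Hr|apply In, Hb]. }
    assert (T2 : Cmod (f b - f a - cderiv f a * (b - a)) <= K * h * h).
    { apply (holo_taylor1 f r'); try assumption; unfold r', r in *; lra. }
    lra.
  - rewrite Rminus_0_r, Rmult_1_r.
    replace (2 * K * h * h / rho) with (2 * K * h / rho * h) by (field; lra).
    apply Rmult_le_compat_r; [exact Hh|].
    apply Rle_div_l; [exact Hrho|]. apply Rlt_div_r in Bb2; [|lra]. nra.
Qed.

(** * The theorems of Weierstrass and Montel *)

Definition unif_cauchy (fs : nat -> C -> C) : Prop :=
  forall r eps, r < 1 -> 0 < eps -> exists N, forall n m, (N <= n)%nat -> (N <= m)%nat ->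
    forall z, Cmod z <= r -> Cmod (fs n z - fs m z) <= eps.

Definition unif_lim (fs : nat -> C -> C) (f : C -> C) : Prop :=
  forall r eps, r < 1 -> 0 < eps -> exists N, forall n, (N <= n)%nat ->
    forall z, Cmod z <= r -> Cmod (fs n z - f z) <= eps.

Lemma holo_minus (f g : C -> C) : holo f -> holo g -> holo (fun z => (f z - g z)%C).
Proof.
  intros Hf Hg. apply holo_intro. intros z Hz. exists (cderiv f z - cderiv g z)%C.
  apply cdiff_minus; apply holo_cdiff; assumption.
Qed.

Lemma holo_mult (f g : C -> C) : holo f -> holo g -> holo (fun z => (f z * g z)%C).
Proof.
  intros Hf Hg. apply holo_intro. intros z Hz. eexists.
  apply cdiff_mult; apply holo_cdiff; assumption.
Qed.

Lemma holo_const a : holo (fun _ => a).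
Proof. apply holo_intro. intros z _. eexists. apply cdiff_const. Qed.

Lemma holo_id : holo (fun z => z).
Proof. apply holo_intro. intros z _. eexists. apply cdiff_id. Qed.

Lemma holo_inv (f : C -> C) : holo f -> (forall z, inD z -> f z <> 0%C) -> holo (fun z => (/ f z)%C).
Proof.
  intros Hf H0. apply holo_intro. intros z Hz. eexists.
  apply cdiff_inv; [apply H0, Hz|apply holo_cdiff; assumption].
Qed.

Lemma holo_pow f n : holo f -> holo (fun z => (f z ^ n)%C).
Proof.
  intros Hf. induction n; simpl.
  - apply holo_const.
  - apply holo_mult; assumption.
Qed.

Lemma cderiv_minus (f g : C -> C) (z : C) : holo f -> holo g -> inD z ->
  cderiv (fun z => (f z - g z)%C) z = (cderiv f z - cderiv g z)%C.
Proof.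
  intros Hf Hg Hz. apply cderiv_unique, cdiff_minus; apply holo_cdiff; assumption.
Qed.

Lemma unif_cauchy_lim (fs : nat -> C -> C) : unif_cauchy fs -> exists f, unif_lim fs f.
Proof.
  intros H.
  assert (P : forall z, exists l, inD z ->
    forall eps, 0 < eps -> exists N, forall n, (N <= n)%nat -> Cmod (fs n z - l) < eps).
  { intros z. destruct (classic (inD z)) as [Hz|Hz]; [|exists 0%C; tauto].
    destruct (C_cauchy_lim (fun n => fs n z)) as [l Hl]; [|exists l; intros _; exact Hl].
    intros eps He. destruct (H (Cmod z) (eps / 2) Hz ltac:(lra)) as [N HN].
    exists N. intros n m Hn Hm. specialize (HN n m Hn Hm z (Rle_refl _)). lra. }
  exists (fun z => proj1_sig (constructive_indefinite_description _ (P z))).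
  intros r eps Hr He. destruct (H r eps Hr He) as [N HN]. exists N. intros n Hn z Hz.
  destruct (constructive_indefinite_description _ (P z)) as [l Hl]. simpl.
  assert (Dz : inD z) by (unfold inD; lra).
  rewrite Cmod_minus_sym. apply (C_lim_le (fun n => fs n z) l (fs n z) eps N (Hl Dz)).
  intros m Hm. apply HN; assumption.
Qed.

Lemma unif_cauchy_cderiv (fs : nat -> C -> C) :
  (forall n, holo (fs n)) -> unif_cauchy fs -> unif_cauchy (fun n => cderiv (fs n)).
Proof.
  intros Hh H r eps Hr He. set (r' := (1 + r) / 2).
  assert (Hp : 0 < eps * (r' - r) / 2).
  { apply Rdiv_lt_0_compat; [|lra]. apply Rmult_lt_0_compat; unfold r'; lra. }
  destruct (H r' _ ltac:(unfold r'; lra) Hp) as [N HN]. exists N. intros n m Hn Hm z Hz.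
  rewrite <- cderiv_minus; [|apply Hh|apply Hh|unfold inD; lra].
  replace eps with (2 * (eps * (r' - r) / 2) / (r' - r)) by (unfold r'; field; lra).
  apply (cauchy_estimate_disc (fun z => (fs n z - fs m z)%C) r r').
  - apply holo_minus; apply Hh.
  - unfold r'; lra.
  - apply HN; assumption.
  - exact Hz.
Qed.

(** Cauchy's estimate on a larger disc makes the derivatives uniformly Cauchy; it remains to see
    that their limit [d] differentiates [f], by a three-term estimate. *)
Theorem weierstrass (fs : nat -> C -> C) :
  (forall n, holo (fs n)) -> unif_cauchy fs ->
  exists f, holo f /\ unif_lim fs f /\ unif_lim (fun n => cderiv (fs n)) (cderiv f).
Proof.
  intros Hh H.
  destruct (unif_cauchy_lim fs H) as [f Hf].
  pose proof (unif_cauchy_cderiv fs Hh H) as H'.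
  destruct (unif_cauchy_lim _ H') as [d Hd].
  assert (D : forall z, inD z -> cdiff f z (d z)).
  { intros z Hz eps He. unfold inD in Hz. set (r := (1 + Cmod z) / 2).
    destruct (H' r (eps / 3) ltac:(unfold r; lra) ltac:(lra)) as [N1 HN1].
    destruct (Hd r (eps / 3) ltac:(unfold r; lra) ltac:(lra)) as [N2 HN2].
    set (n := max N1 N2).
    destruct (holo_cdiff (fs n) z (Hh n) Hz (eps / 3) ltac:(lra)) as [del [Hdel Hw]].
    exists (Rmin del (r - Cmod z)). split; [apply Rmin_glb_lt; unfold r; lra|].
    intros w Bw.
    destruct (Rmin_Rgt_l _ _ _ Bw) as [B1 B2].
    assert (Rz : Cmod z <= r) by (unfold r; lra).
    assert (Rw : Cmod w <= r) by (pose proof (Cmod_triangle_inv w z); lra).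
    (* The Lipschitz constant eps/3 of [fs n - fs m], which comes from the bound on its derivative,
       survives the limit in m. *)
    assert (A : Cmod ((fs n w - fs n z) - (f w - f z)) <= eps / 3 * Cmod (w - z)).
    { apply le_epsilon. intros e2 He2.
      destruct (Hf r (e2 / 2) ltac:(unfold r; lra) ltac:(lra)) as [N3 HN3].
      set (m := max N1 N3).
      pose proof (HN3 m ltac:(lia) w Rw) as E1. pose proof (HN3 m ltac:(lia) z Rz) as E2.
      assert (E3 : Cmod ((fs n w - fs m w) - (fs n z - fs m z)) <= eps / 3 * Cmod (w - z)).
      { apply (holo_lipschitz (fun z => (fs n z - fs m z)%C) r); try assumption.
        - apply holo_minus; apply Hh.
        - unfold r; lra.
        - intros v Hv. rewrite cderiv_minus; [|apply Hh|apply Hh|unfold inD, r in *; lra].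
          apply HN1; [lia|lia|exact Hv]. }
      replace ((fs n w - fs n z) - (f w - f z))%C
        with (((fs n w - fs m w) - (fs n z - fs m z)) + ((fs m w - f w) - (fs m z - f z)))%C by ring.
      eapply Rle_trans; [apply Cmod_triangle|].
      pose proof (Cmod_triangle_minus (fs m w - f w) (fs m z - f z)). lra. }
    specialize (Hw w B1). specialize (HN2 n ltac:(lia) z Rz). simpl in HN2.
    replace (f w - f z - d z * (w - z))%C
      with ((fs n w - fs n z - cderiv (fs n) z * (w - z)) + (cderiv (fs n) z - d z) * (w - z)
            - ((fs n w - fs n z) - (f w - f z)))%C by ring.
    eapply Rle_trans; [apply Cmod_triangle_minus|].
    eapply Rle_trans; [apply Rplus_le_compat_r, Cmod_triangle|]. rewrite Cmod_mult.
    assert (Cmod (cderiv (fs n) z - d z) * Cmod (w - z) <= eps / 3 * Cmod (w - z))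
      by (apply Rmult_le_compat_r; [apply Cmod_ge_0|exact HN2]).
    lra. }
  exists f. split; [|split].
  - apply holo_intro. intros z Hz. exists (d z). apply D, Hz.
  - exact Hf.
  - intros r eps Hr He. destruct (Hd r eps Hr He) as [N HN]. exists N. intros n Hn z Hz.
    rewrite (cderiv_unique f z (d z)); [apply HN; assumption|]. apply D. unfold inD; lra.
Qed.

(** * Montel's theorem, with subsequences encoded as unbounded sets of indices *)

Definition infinite (A : nat -> Prop) : Prop := forall n, exists m, (n <= m)%nat /\ A m.

Lemma pigeonhole_R (u : nat -> R) (e lo : R) (k : nat) (A : nat -> Prop) :
  0 <= e -> infinite A -> (forall n, A n -> lo <= u n <= lo + INR k * e) ->
  exists B : nat -> Prop, infinite B /\ (forall n, B n -> A n) /\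
    forall n m, B n -> B m -> Rabs (u n - u m) <= e.
Proof.
  intros He. revert lo A. induction k; intros lo A HA Hu.
  - exists A. split; [exact HA|split; [tauto|]]. intros n m Hn Hm.
    pose proof (Hu n Hn) as Un. pose proof (Hu m Hm) as Um. simpl in *.
    replace (u n - u m) with 0 by lra. rewrite Rabs_R0. exact He.
  - destruct (classic (infinite (fun n => A n /\ u n <= lo + e))) as [Hi|Hi].
    + exists (fun n => A n /\ u n <= lo + e). split; [exact Hi|split; [tauto|]].
      intros n m [Hn Un] [Hm Um]. pose proof (Hu n Hn). pose proof (Hu m Hm).
      apply Rabs_le. lra.
    + apply not_all_ex_not in Hi. destruct Hi as [N HN].
      destruct (IHk (lo + e) (fun n => A n /\ lo + e <= u n)) as [B [HB1 [HB2 HB3]]].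
      * intros n. destruct (HA (max n N)) as [m [Hm Am]]. exists m. split; [lia|].
        split; [exact Am|]. destruct (Rle_lt_dec (lo + e) (u m)) as [Hl|Hl]; [exact Hl|].
        exfalso. apply HN. exists m. split; [lia|]. split; [exact Am|lra].
      * intros n [Hn Un]. pose proof (Hu n Hn) as X. rewrite S_INR in X. lra.
      * exists B. split; [exact HB1|split; [|exact HB3]]. intros n Bn. apply HB2, Bn.
Qed.

Lemma pigeonhole_C (u : nat -> C) (e M : R) (A : nat -> Prop) :
  0 < e -> infinite A -> (forall n, A n -> Cmod (u n) <= M) ->
  exists B : nat -> Prop, infinite B /\ (forall n, B n -> A n) /\
    forall n m, B n -> B m -> Cmod (u n - u m) <= e.
Proof.
  intros He HA Hu.
  set (k := Z.to_nat (up (2 * M / (e / 2)))).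
  assert (Hk : 0 <= M -> 2 * M <= INR k * (e / 2)).
  { intros HM. unfold k. destruct (archimed (2 * M / (e / 2))) as [X _].
    assert (Y : 0 <= 2 * M / (e / 2)) by (apply Rdiv_le_0_compat; lra).
    rewrite INR_IZR_INZ, Z2Nat.id by (apply le_IZR; lra).
    replace (2 * M) with (2 * M / (e / 2) * (e / 2)) at 1 by (field; lra).
    apply Rmult_le_compat_r; lra. }
  assert (Hb : forall n, A n -> 0 <= M /\ - M <= Re (u n) <= M /\ - M <= Im (u n) <= M).
  { intros n Hn. specialize (Hu n Hn). pose proof (Cmod_ge_0 (u n)).
    pose proof (re_le_Cmod (u n)).
    pose proof (im_le_Cmod (u n)).
    split; [lra|]. split; apply Rabs_le_between; lra. }
  destruct (pigeonhole_R (fun n => Re (u n)) (e / 2) (- M) k A) as [B [HB1 [HB2 HB3]]];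
    [lra|exact HA| |].
  { intros n Hn. destruct (Hb n Hn) as (H1 & H2 & _). specialize (Hk H1). lra. }
  destruct (pigeonhole_R (fun n => Im (u n)) (e / 2) (- M) k B) as [D [HD1 [HD2 HD3]]];
    [lra|exact HB1| |].
  { intros n Hn. destruct (Hb n (HB2 n Hn)) as (H1 & _ & H2). specialize (Hk H1). lra. }
  exists D. split; [exact HD1|split; [auto|]]. intros n m Hn Hm.
  eapply Rle_trans; [apply Cmod_le_abs|].
  specialize (HB3 n m (HD2 n Hn) (HD2 m Hm)). specialize (HD3 n m Hn Hm).
  change (fst (u n - u m)%C) with (Re (u n) - Re (u m)).
  change (snd (u n - u m)%C) with (Im (u n) - Im (u m)). lra.
Qed.

Lemma pigeonhole_list (fs : nat -> C -> C) (e M : R) (L : list C) (A : nat -> Prop) :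
  0 < e -> infinite A -> (forall n p, A n -> In p L -> Cmod (fs n p) <= M) ->
  exists B : nat -> Prop, infinite B /\ (forall n, B n -> A n) /\
    forall n m p, B n -> B m -> In p L -> Cmod (fs n p - fs m p) <= e.
Proof.
  intros He. revert A. induction L as [|p L IH]; intros A HA Hf.
  - exists A. split; [exact HA|split; [tauto|]]. intros n m p _ _ [].
  - destruct (pigeonhole_C (fun n => fs n p) e M A He HA) as [B [HB1 [HB2 HB3]]].
    { intros n Hn. apply Hf; [exact Hn|left; reflexivity]. }
    destruct (IH B HB1) as [D [HD1 [HD2 HD3]]].
    { intros n q Hn Hq. apply Hf; [apply HB2, Hn|right; exact Hq]. }
    exists D. split; [exact HD1|split; [auto|]]. intros n m q Hn Hm [<-|Hq].
    + apply HB3; auto.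
    + apply HD3; assumption.
Qed.

Lemma disc_net (r d : R) : 0 < d -> r < 1 -> exists L : list C,
  (forall p, In p L -> Cmod p <= r + d) /\
  forall z, Cmod z <= r -> exists p, In p L /\ Cmod (z - p) <= d.
Proof.
  intros Hd Hr. set (s := d / 2). assert (Hs : 0 < s) by (unfold s; lra).
  destruct (archimed_cor1 s Hs) as [N [HN1 HN2]].
  assert (HN : 1 < INR N * s).
  { apply Rmult_lt_reg_l with (/ INR N); [apply Rinv_0_lt_compat, lt_0_INR, HN2|].
    rewrite <- Rmult_assoc, Rinv_l, Rmult_1_l, Rmult_1_r; [exact HN1|].
    apply not_0_INR. lia. }
  set (X := map (fun k => (INR k - INR N) * s) (seq 0 (2 * N + 1))).
  assert (HX : forall x, Rabs x < 1 -> exists y, In y X /\ Rabs (x - y) <= s).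
  { intros x Hx. apply Rabs_lt_between in Hx.
    destruct (archimed ((x + INR N * s) / s)) as [U1 U2].
    set (j := up ((x + INR N * s) / s)) in *.
    assert (Q : (x + INR N * s) / s = x / s + INR N) by (field; lra).
    assert (Q1 : 0 < (x + INR N * s) / s) by (apply Rdiv_lt_0_compat; lra).
    assert (Q2 : x / s < INR N).
    { apply Rlt_div_l; lra. }
    assert (J1 : (0 < j)%Z) by (apply lt_IZR; lra).
    assert (J2 : (j < 2 * Z.of_nat N + 2)%Z).
    { apply lt_IZR. rewrite plus_IZR, mult_IZR, <- INR_IZR_INZ. lra. }
    exists ((INR (Z.to_nat (j - 1)) - INR N) * s). split.
    - apply (in_map (fun k => (INR k - INR N) * s)). apply in_seq. lia.
    - rewrite (INR_IZR_INZ (Z.to_nat (j - 1))), Z2Nat.id, minus_IZR by lia.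
      replace x with (((x + INR N * s) / s - INR N) * s) at 1 by (field; lra).
      rewrite <- Rmult_minus_distr_r, Rabs_mult, (Rabs_pos_eq s) by lra.
      apply Rle_trans with (1 * s); [|lra]. apply Rmult_le_compat_r; [lra|].
      apply Rabs_le. lra. }
  (* The square grid leaves the unit disc at its corners; filtering keeps the net where a locally
     bounded family is controlled. *)
  exists (filter (fun p => if Rle_dec (Cmod p) (r + d) then true else false) (list_prod X X)).
  split.
  - intros p Hp. apply filter_In in Hp. destruct Hp as [_ Hp].
    destruct (Rle_dec (Cmod p) (r + d)); [assumption|discriminate].
  - intros [x y] Hz. pose proof (Rmax_Cmod (x, y)) as Hm. simpl in Hm.
    pose proof (Rmax_l (Rabs x) (Rabs y)). pose proof (Rmax_r (Rabs x) (Rabs y)).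
    destruct (HX x) as [x' [Ix Dx]]; [lra|]. destruct (HX y) as [y' [Iy Dy]]; [lra|].
    assert (D : Cmod ((x, y) - (x', y')) <= d).
    { eapply Rle_trans; [apply Cmod_le_abs|]. simpl. unfold s in *.
      replace (x + - x') with (x - x') by ring. replace (y + - y') with (y - y') by ring. lra. }
    exists (x', y'). split; [|exact D]. apply filter_In. split.
    + apply in_prod; assumption.
    + destruct (Rle_dec (Cmod (x', y')) (r + d)) as [|Hn]; [reflexivity|].
      exfalso. apply Hn. pose proof (Cmod_triangle_inv (x', y') (x, y)) as T.
      rewrite Cmod_minus_sym in T. lra.
Qed.

Definition loc_bounded (fs : nat -> C -> C) : Prop :=
  forall r, r < 1 -> exists M, forall n z, Cmod z <= r -> Cmod (fs n z) <= M.

(** Cauchy's estimate gives a common Lipschitz constant, so agreement up to e/3 on a finite net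
    spreads to agreement up to e on the disc. *)
Lemma montel_step (fs : nat -> C -> C) (r e : R) (A : nat -> Prop) :
  (forall n, holo (fs n)) -> loc_bounded fs -> r < 1 -> 0 < e -> infinite A ->
  exists B : nat -> Prop, infinite B /\ (forall n, B n -> A n) /\
    forall n m z, B n -> B m -> Cmod z <= r -> Cmod (fs n z - fs m z) <= e.
Proof.
  intros Hh Hb Hr He HA. set (r1 := (1 + r) / 2). set (r2 := (1 + r1) / 2).
  destruct (Hb r2) as [M HM]; [unfold r2, r1; lra|].
  set (K := 2 * M / (r2 - r1)).
  assert (HK : forall n z, Cmod z <= r1 -> Cmod (cderiv (fs n) z) <= K).
  { intros n. apply cauchy_estimate_disc; [apply Hh|unfold r2, r1; lra|apply HM]. }
  destruct (Rle_lt_dec 0 r) as [Hr0|Hr0].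
  2: { exists A. split; [exact HA|split; [tauto|]]. intros n m z _ _ Hz.
       pose proof (Cmod_ge_0 z). lra. }
  assert (HK0 : 0 <= K).
  { eapply Rle_trans; [apply Cmod_ge_0|]. apply (HK 0%nat 0%C). rewrite Cmod_0. unfold r1; lra. }
  set (d := Rmin (r1 - r) (e / (3 * (K + 1)))).
  assert (Hd : 0 < d).
  { apply Rmin_glb_lt; [unfold r1; lra|]. apply Rdiv_lt_0_compat; lra. }
  assert (Hd1 : d <= r1 - r) by apply Rmin_l.
  assert (Hd2 : K * d <= e / 3).
  { apply Rle_trans with ((K + 1) * (e / (3 * (K + 1)))).
    - apply Rmult_le_compat; [lra|lra|lra|apply Rmin_r].
    - right. field. lra. }
  destruct (disc_net r d Hd Hr) as [L [HL1 HL2]].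
  destruct (pigeonhole_list fs (e / 3) M L A) as [B [HB1 [HB2 HB3]]]; [lra|exact HA| |].
  { intros n p _ Hp. apply HM. specialize (HL1 p Hp). unfold r2, r1 in *. lra. }
  exists B. split; [exact HB1|split; [exact HB2|]]. intros n m z Hn Hm Hz.
  destruct (HL2 z Hz) as [p [Ip Dp]].
  assert (Lp : forall k, Cmod (fs k z - fs k p) <= e / 3).
  { intros k. apply Rle_trans with (K * Cmod (z - p)).
    - apply (holo_lipschitz (fs k) r1); [apply Hh|unfold r1; lra|apply HK| |unfold r1; lra].
      specialize (HL1 p Ip). lra.
    - eapply Rle_trans; [|exact Hd2]. apply Rmult_le_compat_l; assumption. }
  specialize (HB3 n m p Hn Hm Ip). pose proof (Lp n) as L1. pose proof (Lp m) as L2.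
  replace (fs n z - fs m z)%C
    with ((fs n z - fs n p) + (fs n p - fs m p) - (fs m z - fs m p))%C by ring.
  eapply Rle_trans; [apply Cmod_triangle_minus|].
  pose proof (Cmod_triangle (fs n z - fs n p) (fs n p - fs m p)). lra.
Qed.

Theorem montel (fs : nat -> C -> C) :
  (forall n, holo (fs n)) -> loc_bounded fs ->
  exists phi : nat -> nat, (forall n, (phi n < phi (S n))%nat) /\
    unif_cauchy (fun n => fs (phi n)).
Proof.
  intros Hh Hb.
  (* One index governs both radius and tolerance, so a single diagonal sequence serves all discs and
     all eps. *)
  set (ok := fun (j : nat) (A B : nat -> Prop) => infinite B /\ (forall n, B n -> A n) /\
    forall n m z, B n -> B m -> Cmod z <= 1 - / INR (S j) ->
      Cmod (fs n z - fs m z) <= / INR (S j)).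
  assert (Hok : forall j A, infinite A -> exists B, ok j A B).
  { intros j A HA. assert (0 < / INR (S j)) by (apply Rinv_0_lt_compat, lt_0_INR; lia).
    apply montel_step; try assumption. lra. }
  set (nxt := fun j A => epsilon (inhabits A) (fun B => ok j A B)).
  set (AA := fix AA j := match j with O => (fun _ : nat => True) | S i => nxt i (AA i) end).
  assert (HAA : forall j, infinite (AA j) /\ ok j (AA j) (AA (S j))).
  { assert (I : forall j, infinite (AA j)).
    { induction j; [intros n; exists n; split; [lia|exact I]|].
      apply (epsilon_spec (inhabits (AA j)) (fun B => ok j (AA j) B)), Hok, IHj. }
    intros j. split; [apply I|].
    apply (epsilon_spec (inhabits (AA j)) (fun B => ok j (AA j) B)), Hok, I. }
  set (pick := fun (A : nat -> Prop) n => epsilon (inhabits 0%nat) (fun m => (n <= m)%nat /\ A m)).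
  assert (Hpick : forall j n, (n <= pick (AA j) n)%nat /\ AA j (pick (AA j) n)).
  { intros j n. unfold pick.
    apply (epsilon_spec (inhabits 0%nat) (fun m => (n <= m)%nat /\ AA j m)).
    apply (proj1 (HAA j)). }
  (* The choice at step n is made in [AA (S n)], beyond the previous choice: the sequence increases
     strictly and from step j on stays in [AA (S j)]. *)
  set (phi := fix phi n := match n with O => pick (AA 1%nat) 0%nat
                           | S k => pick (AA (S (S k))) (S (phi k)) end).
  assert (Hphi : forall n, AA (S n) (phi n)).
  { destruct n; apply Hpick. }
  exists phi. split.
  { intros n. pose proof (Hpick (S (S n)) (S (phi n))) as [X _]. exact X. }
  assert (Hdec : forall j k n, AA (j + k)%nat n -> AA j n).
  { intros j k n. induction k.
    - rewrite Nat.add_0_r. tauto.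
    - intros H. apply IHk. replace (j + S k)%nat with (S (j + k)) in H by lia.
      apply (proj1 (proj2 (proj2 (HAA (j + k)%nat)))), H. }
  intros r eps Hr He.
  destruct (archimed_cor1 (Rmin eps (1 - r))) as [N [HN1 HN2]]; [apply Rmin_glb_lt; lra|].
  pose proof (Rmin_l eps (1 - r)) as M1. pose proof (Rmin_r eps (1 - r)) as M2.
  destruct N as [|j]; [lia|]. exists j. intros n m Hn Hm z Hz.
  eapply Rle_trans; [apply (proj2 (proj2 (proj2 (HAA j))))|]; [| |lra|lra].
  - apply (Hdec (S j) (n - j)%nat). replace (S j + (n - j))%nat with (S n) by lia. apply Hphi.
  - apply (Hdec (S j) (m - j)%nat). replace (S j + (m - j))%nat with (S m) by lia. apply Hphi.
Qed.

(** * The gliding hump *)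

(** The weights 2^-n make sums of equibounded functions converge and are outgrown by humps of height
    4^n. *)
Fixpoint psum (v : nat -> C -> C) (N : nat) (z : C) : C :=
  match N with O => 0%C | S n => (psum v n z + RtoC ((1 / 2) ^ n) * v n z)%C end.

Lemma cdiff_psum (v d : nat -> C -> C) (z : C) (N : nat) :
  (forall n, cdiff (v n) z (d n z)) -> cdiff (psum v N) z (psum d N z).
Proof.
  intros H. induction N; simpl.
  - apply cdiff_const.
  - apply (cdiff_plus (psum v N)); [exact IHN|]. apply cdiff_scal, H.
Qed.

Lemma half_pow_pos (n : nat) : 0 < (1 / 2) ^ n.
Proof. apply pow_lt; lra. Qed.

Lemma psum_diff (v : nat -> C -> C) (z : C) (M : R) (N k : nat) :
  (forall n, Cmod (v n z) <= M) ->
  Cmod (psum v (N + k) z - psum v N z) <= 2 * M * ((1 / 2) ^ N - (1 / 2) ^ (N + k)).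
Proof.
  intros HM. induction k.
  - replace (N + 0)%nat with N by lia.
    replace (psum v N z - psum v N z)%C with (RtoC 0) by ring. rewrite Cmod_0. lra.
  - replace (N + S k)%nat with (S (N + k)) by lia. simpl psum.
    replace (psum v (N + k) z + RtoC ((1 / 2) ^ (N + k)) * v (N + k)%nat z - psum v N z)%C
      with ((psum v (N + k) z - psum v N z) + RtoC ((1 / 2) ^ (N + k)) * v (N + k)%nat z)%C by ring.
    eapply Rle_trans; [apply Cmod_triangle|].
    rewrite Cmod_mult, Cmod_R, Rabs_pos_eq by (left; apply half_pow_pos).
    pose proof (half_pow_pos (N + k)) as Hp. specialize (HM (N + k)%nat).
    assert ((1 / 2) ^ (N + k) * Cmod (v (N + k)%nat z) <= (1 / 2) ^ (N + k) * M)
      by (apply Rmult_le_compat_l; lra).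
    replace ((1 / 2) ^ S (N + k)) with (1 / 2 * (1 / 2) ^ (N + k)) by reflexivity. lra.
Qed.

Lemma psum_diff_le (v : nat -> C -> C) (z : C) (M : R) (N m : nat) :
  (forall n, Cmod (v n z) <= M) -> (N <= m)%nat ->
  Cmod (psum v m z - psum v N z) <= 2 * M * (1 / 2) ^ N.
Proof.
  intros HM Hm. replace m with (N + (m - N))%nat by lia.
  eapply Rle_trans; [apply psum_diff, HM|].
  assert (0 <= M) by (eapply Rle_trans; [apply Cmod_ge_0|apply (HM 0%nat)]).
  pose proof (half_pow_pos (N + (m - N))). nra.
Qed.

Lemma half_pow_small (eps : R) : 0 < eps -> exists N, (1 / 2) ^ N < eps.
Proof.
  intros He. destruct (pow_small (1 / 2) eps ltac:(lra) He) as [N HN]. exists N. apply HN, le_n.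
Qed.

Lemma psum_unif_cauchy (v : nat -> C -> C) : loc_bounded v -> unif_cauchy (psum v).
Proof.
  intros Hb r eps Hr He. destruct (Hb r Hr) as [M HM].
  set (M' := Rmax M 1). assert (HM1 : 1 <= M') by apply Rmax_r.
  assert (HM2 : forall n z, Cmod z <= r -> Cmod (v n z) <= M').
  { intros n z Hz. eapply Rle_trans; [apply HM, Hz|apply Rmax_l]. }
  destruct (half_pow_small (eps / (4 * M'))) as [N HN]; [apply Rdiv_lt_0_compat; lra|].
  assert (HN' : 2 * M' * (1 / 2) ^ N <= eps / 2).
  { apply Rle_trans with (2 * M' * (eps / (4 * M'))).
    - apply Rmult_le_compat_l; lra.
    - right. field. lra. }
  exists N. intros n m Hn Hm z Hz.
  eapply Rle_trans; [apply (Cmod_dist_triangle _ (psum v N z))|].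
  rewrite (Cmod_minus_sym (psum v N z)).
  pose proof (psum_diff_le v z M' N n (fun k => HM2 k z Hz) Hn).
  pose proof (psum_diff_le v z M' N m (fun k => HM2 k z Hz) Hm). lra.
Qed.

Lemma psum_limit (v : nat -> C -> C) : (forall n, holo (v n)) -> loc_bounded v ->
  exists f, holo f /\ unif_lim (psum v) f /\ unif_lim (psum (fun n => cderiv (v n))) (cderiv f).
Proof.
  intros Hh Hb.
  assert (D : forall N z, inD z -> cdiff (psum v N) z (psum (fun n => cderiv (v n)) N z)).
  { intros N z Hz. apply cdiff_psum. intros n. apply holo_cdiff; [apply Hh|exact Hz]. }
  destruct (weierstrass (psum v)) as [f [Hf [L1 L2]]].
  - intros N. apply holo_intro. intros z Hz. eexists. apply D, Hz.
  - apply psum_unif_cauchy, Hb.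
  - exists f. split; [exact Hf|split; [exact L1|]].
    intros r eps Hr He. destruct (L2 r eps Hr He) as [N HN]. exists N. intros n Hn z Hz.
    rewrite <- (cderiv_unique _ _ _ (D n z ltac:(unfold inD; lra))). apply HN; assumption.
Qed.

(** Convertible to the second half of [H0 w f], and at [cderiv f] to that of [B0 w f], so one lemma
    on sums serves both spaces. *)
Definition little_o (w : R -> R) (f : C -> C) : Prop :=
  forall eps, 0 < eps -> exists r0, r0 < 1 /\
    forall z, r0 < Cmod z < 1 -> w (Cmod z) * Cmod (f z) < eps.

Lemma unif_lim_at (fs : nat -> C -> C) (f : C -> C) (z : C) : unif_lim fs f -> inD z ->
  forall eps, 0 < eps -> exists N, forall n, (N <= n)%nat -> Cmod (fs n z - f z) < eps.
Proof.
  intros H Hz eps He. destruct (H (Cmod z) (eps / 2) Hz ltac:(lra)) as [N HN].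
  exists N. intros n Hn. specialize (HN n Hn z (Rle_refl _)). lra.
Qed.

(** The common bound 1 makes the tail after N terms at most 2 * 2^-N, uniformly up to the boundary,
    and the finite head is little-o. *)
Lemma little_o_psum (w : R -> R) (v : nat -> C -> C) (f : C -> C) :
  (forall r, 0 <= r < 1 -> 0 <= w r) ->
  (forall n z, inD z -> w (Cmod z) * Cmod (v n z) <= 1) ->
  (forall n, little_o w (v n)) -> unif_lim (psum v) f -> little_o w f.
Proof.
  intros Hw H1 Ho Hl eps He.
  assert (HP : forall N, little_o w (psum v N)).
  { induction N; intros e Hee; simpl.
    - exists 0. split; [lra|]. intros z Hz. rewrite Cmod_0. lra.
    - destruct (IHN (e / 2) ltac:(lra)) as [r1 [Hr1 B1]].
      destruct (Ho N (e / 2) ltac:(lra)) as [r2 [Hr2 B2]].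
      exists (Rmax r1 r2). split; [apply Rmax_lub_lt; assumption|]. intros z Hz.
      pose proof (Rmax_l r1 r2). pose proof (Rmax_r r1 r2).
      specialize (B1 z ltac:(lra)). specialize (B2 z ltac:(lra)).
      assert (Wz : 0 <= w (Cmod z)) by (apply Hw; split; [apply Cmod_ge_0|lra]).
      pose proof (Cmod_triangle (psum v N z) (RtoC ((1 / 2) ^ N) * v N z)) as T.
      rewrite Cmod_mult, Cmod_R, Rabs_pos_eq in T by (left; apply half_pow_pos).
      assert (P1 : (1 / 2) ^ N <= 1).
      { apply Rle_trans with (1 ^ N); [apply pow_incr; lra|rewrite pow1; lra]. }
      pose proof (half_pow_pos N). pose proof (Cmod_ge_0 (v N z)).
      assert (T2 : Cmod (psum v N z + RtoC ((1 / 2) ^ N) * v N z) <=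
                   Cmod (psum v N z) + Cmod (v N z)) by nra.
      nra. }
  destruct (half_pow_small (eps / 8)) as [N HN]; [lra|].
  destruct (HP N (eps / 2) ltac:(lra)) as [r0 [Hr0 B]].
  exists (Rmax r0 0). split; [apply Rmax_lub_lt; lra|]. intros z Hz.
  pose proof (Rmax_l r0 0). pose proof (Rmax_r r0 0).
  specialize (B z ltac:(lra)). assert (Dz : inD z) by (unfold inD; lra).
  assert (Wz : 0 <= w (Cmod z)) by (apply Hw; lra).
  assert (E : w (Cmod z) * Cmod (f z - psum v N z) <= eps / 4).
  (* Division by the weight needs it positive; where it vanishes the claim is trivial. *)
  { destruct Wz as [Wz|Wz]; [|rewrite <- Wz; lra].
    assert (Hb : forall n, Cmod (v n z) <= / w (Cmod z)).
    { intros n. apply Rmult_le_reg_l with (w (Cmod z)); [exact Wz|].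
      rewrite Rinv_r by lra. apply H1, Dz. }
    assert (X : Cmod (f z - psum v N z) <= 2 * / w (Cmod z) * (1 / 2) ^ N).
    { apply (C_lim_le (fun n => psum v n z) _ _ _ N (unif_lim_at _ _ z Hl Dz)).
      intros n Hn. apply psum_diff_le; assumption. }
    apply Rle_trans with (w (Cmod z) * (2 * / w (Cmod z) * (1 / 2) ^ N)).
    - apply Rmult_le_compat_l; lra.
    - replace (w (Cmod z) * (2 * / w (Cmod z) * (1 / 2) ^ N)) with (2 * (1 / 2) ^ N)
        by (field; lra). lra. }
  pose proof (Cmod_triangle (f z - psum v N z) (psum v N z)) as T.
  replace (f z - psum v N z + psum v N z)%C with (f z) in T by ring. nra.
Qed.

(** Non-negative real parts exclude cancellation, so a single summand bounds the whole series from
    below. *)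
Lemma psum_lower (v : nat -> C -> C) (f : C -> C) (z : C) (n : nat) :
  inD z -> (forall k, 0 <= Re (v k z)) -> unif_lim (psum v) f ->
  (1 / 2) ^ n * Re (v n z) <= Re (f z).
Proof.
  intros Hz H0 Hl.
  assert (Rs : forall N, Re (psum v (S N) z) = Re (psum v N z) + (1 / 2) ^ N * Re (v N z)).
  { intros N. simpl psum. rewrite <- re_scal_l. reflexivity. }
  assert (Mono : forall N, 0 <= Re (psum v N z)).
  { induction N; [simpl; lra|]. rewrite Rs. pose proof (half_pow_pos N).
    specialize (H0 N). nra. }
  assert (L : forall k, (1 / 2) ^ n * Re (v n z) <= Re (psum v (S n + k) z)).
  { induction k.
    - rewrite Nat.add_0_r, Rs. specialize (Mono n). lra.
    - rewrite Nat.add_succ_r, Rs. pose proof (half_pow_pos (S n + k)).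
      specialize (H0 (S n + k)%nat). nra. }
  apply le_epsilon. intros eps He.
  destruct (unif_lim_at _ _ z Hl Hz eps He) as [N HN].
  specialize (HN (S n + N)%nat ltac:(lia)). specialize (L N).
  pose proof (re_le_Cmod (psum v (S n + N) z - f z)) as R1.
  replace (Re (psum v (S n + N) z - f z)%C) with (Re (psum v (S n + N) z) - Re (f z)) in R1
    by reflexivity.
  pose proof (Rle_abs (Re (psum v (S n + N) z) - Re (f z))). lra.
Qed.

Lemma little_o_bounded (w : R -> R) (f : C -> C) (W : R) :
  (forall r, 0 <= r < 1 -> 0 <= w r <= W) -> holo f -> little_o w f ->
  exists M, forall z, inD z -> w (Cmod z) * Cmod (f z) <= M.
Proof.
  intros Hw Hf Ho. destruct (Ho 1 Rlt_0_1) as [r0 [Hr0 B]].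
  destruct (holo_bounded f r0 Hf Hr0) as [M [HM0 HM]].
  exists (Rmax 1 (W * M)). intros z Hz. unfold inD in Hz.
  destruct (Rle_lt_dec (Cmod z) r0) as [H|H].
  - eapply Rle_trans; [|apply Rmax_r]. specialize (HM z H).
    destruct (Hw (Cmod z)) as [W1 W2]; [split; [apply Cmod_ge_0|lra]|].
    apply Rmult_le_compat; try assumption. apply Cmod_ge_0.
  - eapply Rle_trans; [|apply Rmax_l]. left. apply B. lra.
Qed.

(** Used twice: to replace a function by a dilate with half its value, and to keep s^n >= 1/2. *)
Lemma near_one (phi : R -> R) : continuous phi 1 -> 0 < phi 1 ->
  exists rho, 0 < rho < 1 /\ phi 1 / 2 <= phi rho.
Proof.
  intros Hc Hp. assert (H2 : 0 < phi 1 / 2) by lra.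
  destruct (proj1 (filterlim_locally phi (phi 1)) Hc (mkposreal _ H2)) as [d Hd].
  pose proof (cond_pos d). set (e := Rmin (d / 2) (1 / 2)).
  assert (He : 0 < e) by (apply Rmin_glb_lt; lra).
  assert (He1 : e <= d / 2) by apply Rmin_l. assert (He2 : e <= 1 / 2) by apply Rmin_r.
  exists (1 - e). split; [lra|].
  assert (B : ball (phi 1) (phi 1 / 2) (phi (1 - e))).
  { apply Hd. change (Rabs (1 - e - 1) < d). rewrite Rabs_left; lra. }
  change (Rabs (phi (1 - e) - phi 1) < phi 1 / 2) in B. apply Rabs_lt_between in B. lra.
Qed.

Lemma continuous_Re_comp (f : C -> C) (c : R -> C) (t : R) :
  continuous c t -> continuous f (c t) -> continuous (fun s => Re (f (c s))) t.
Proof.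
  intros Hc Hf. apply (continuous_comp (fun s => f (c s)) Re).
  - apply (continuous_comp c f); assumption.
  - apply (continuous_fst (U := R_UniformSpace) (V := R_UniformSpace)).
Qed.

Lemma continuous_ray (z : C) (t : R) : continuous (fun s => (RtoC s * z)%C) t.
Proof.
  apply continuous_ext with (fun s => (0 + RtoC s * z)%C).
  - intros s; apply Cplus_0_l.
  - apply continuous_line.
Qed.

Lemma cdiff_dilate (f : C -> C) (rho z l : C) :
  cdiff f (rho * z) l -> cdiff (fun w => f (rho * w)%C) z (rho * l)%C.
Proof.
  intros H. rewrite Cmult_comm. apply (cdiff_comp f (fun w => (rho * w)%C)); [|exact H].
  apply cdiff_lin.
Qed.

Lemma inD_dilate (rho : R) (z : C) : 0 <= rho <= 1 -> inD z -> inD (RtoC rho * z).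
Proof.
  unfold inD. intros Hr Hz. rewrite Cmod_mult, Cmod_R, Rabs_pos_eq by lra.
  pose proof (Cmod_ge_0 z). nra.
Qed.

Lemma pow2_unbounded (M : R) : exists n, M < 2 ^ n.
Proof.
  destruct (Pow_x_infinity 2) with (b := M + 1) as [N HN]; [rewrite Rabs_pos_eq; lra|].
  exists N. specialize (HN N (le_n N)). rewrite Rabs_pos_eq in HN by (apply pow_le; lra). lra.
Qed.

(* Otherwise choose r_n and s_n < 1 with w(r_n) Re (v s_n r_n) > 4^n / 2; by positivity
   the sum of 2^-n v s_n is at least 2^n / (2 w) at r_n. *)
Lemma gliding_hump (w : R -> R) (v : R -> C -> C) :
  (forall r, 0 <= r < 1 -> 0 <= w r) ->
  (forall r, 0 <= r < 1 -> continuous (fun s => Re (v s (RtoC r))) 1) ->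
  (forall s r, 0 <= s <= 1 -> 0 <= r < 1 -> 0 <= Re (v s (RtoC r))) ->
  (forall rho : nat -> R, (forall n, 0 < rho n < 1) -> exists f M,
     unif_lim (psum (fun n => v (rho n))) f /\
     forall z, inD z -> w (Cmod z) * Cmod (f z) <= M) ->
  exists K, 0 <= K /\ forall r, 0 <= r < 1 -> w r * Re (v 1 (RtoC r)) <= K.
Proof.
  intros Hw Hc Hpos Hsum. apply NNPP. intros HN.
  assert (Hp : forall n : nat, exists p : R * R, 0 <= fst p < 1 /\ 0 < snd p < 1 /\
            4 ^ n < 2 * (w (fst p) * Re (v (snd p) (RtoC (fst p))))).
  { intros n. assert (P4 : 0 < 4 ^ n) by (apply pow_lt; lra).
    assert (Hr : exists r, 0 <= r < 1 /\ 4 ^ n < w r * Re (v 1 (RtoC r))).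
    { apply NNPP. intros Hn. apply HN. exists (4 ^ n). split; [lra|].
      intros r Hr. apply Rnot_lt_le. intros H. apply Hn. exists r. split; assumption. }
    destruct Hr as [r [Hr1 Hr2]]. specialize (Hw r Hr1).
    destruct (near_one (fun s => Re (v s (RtoC r))) (Hc r Hr1)) as [s [H1 H2]]; [nra|].
    exists (r, s). simpl. split; [exact Hr1|split; [exact H1|nra]]. }
  destruct (choice _ Hp) as [p Hp'].
  destruct (Hsum (fun n => snd (p n))) as (f & M & Hl & HM); [apply Hp'|].
  destruct (pow2_unbounded (2 * M)) as [n Hn].
  destruct (Hp' n) as (H1 & H2 & H3). set (r := fst (p n)) in *.
  assert (Dr : inD (RtoC r)) by (unfold inD; rewrite Cmod_R, Rabs_pos_eq; lra).
  specialize (HM _ Dr). rewrite Cmod_R, Rabs_pos_eq in HM by lra.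
  pose proof (psum_lower (fun k => v (snd (p k))) f (RtoC r) n Dr
    (fun k => Hpos (snd (p k)) r ltac:(destruct (Hp' k) as (_ & X & _); lra) H1) Hl) as L.
  set (y := Re (v (snd (p n)) (RtoC r))) in *. pose proof (Hw r H1) as W.
  assert (Y : (1 / 2) ^ n * y <= Cmod (f (RtoC r))).
  { eapply Rle_trans; [exact L|]. eapply Rle_trans; [apply Rle_abs|apply re_le_Cmod]. }
  assert (E4 : (1 / 2) ^ n * 4 ^ n = 2 ^ n).
  { rewrite <- Rpow_mult_distr. f_equal. lra. }
  assert (Z : w r * ((1 / 2) ^ n * y) <= M).
  { eapply Rle_trans; [|exact HM]. apply Rmult_le_compat_l; assumption. }
  apply Rlt_le, (Rmult_le_compat_l ((1 / 2) ^ n)) in H3; [|left; apply half_pow_pos].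
  rewrite E4 in H3. lra.
Qed.

Lemma psum_lim_ext (u v : nat -> C -> C) (f : C -> C) :
  (forall n z, inD z -> u n z = v n z) -> unif_lim (psum u) f -> unif_lim (psum v) f.
Proof.
  intros E H r eps Hr He. destruct (H r eps Hr He) as [N HN]. exists N. intros n Hn z Hz.
  replace (psum v n z) with (psum u n z); [apply HN; assumption|].
  clear Hn. induction n; simpl; [reflexivity|]. rewrite IHn, E by (unfold inD; lra). reflexivity.
Qed.

Lemma one_minus_sq r : 0 <= r < 1 -> 0 < 1 - r ^ 2 <= 1.
Proof. intros Hr. simpl. nra. Qed.

Lemma Cmod_one_minus_sq z : inD z -> 1 - Cmod z ^ 2 <= Cmod (1 - z * z).
Proof.
  intros Hz. pose proof (Cmod_triangle_inv 1 (z * z)) as H.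
  rewrite Cmod_1, Cmod_mult in H. simpl. lra.
Qed.

Lemma one_minus_sq_neq_0 z : inD z -> (1 - z * z)%C <> 0%C.
Proof.
  intros Hz. apply Cmod_gt_0. eapply Rlt_le_trans; [|apply Cmod_one_minus_sq, Hz].
  apply one_minus_sq. apply inD_range, Hz.
Qed.

(** On [0,1) this is 1/((1-r^2) nu(r)), the kernel of the limit condition. As |1-z^2| >= 1-|z|^2 and
    |F(z)| <= F(|z|), its modulus at z is at most its value at |z|. *)
Definition kern (F : C -> C) (z : C) : C := (F z / (1 - z * z))%C.

Lemma holo_kern F : holo F -> holo (kern F).
Proof.
  intros HF. apply (holo_mult F (fun z => (/ (1 - z * z))%C)); [exact HF|].
  apply (holo_inv (fun z => (1 - z * z)%C)); [|exact one_minus_sq_neq_0].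
  apply holo_minus; [apply holo_const|]. apply holo_mult; apply holo_id.
Qed.

Lemma Cmod_kern F z : inD z -> Cmod (kern F z) <= Cmod (F z) / (1 - Cmod z ^ 2).
Proof.
  intros Hz. unfold kern. rewrite Cmod_div by (apply one_minus_sq_neq_0, Hz).
  apply Rmult_le_compat_l; [apply Cmod_ge_0|]. apply Rinv_le_contravar.
  - apply one_minus_sq. split; [apply Cmod_ge_0|exact Hz].
  - apply Cmod_one_minus_sq, Hz.
Qed.

Lemma holo_primitive k : holo k -> holo (seg k 0).
Proof. intros Hk. apply holo_intro. intros z Hz. exists (k z). apply cdiff_primitive; assumption. Qed.

(** * Analytic quasi-normal weights *)

Definition radial (F : C -> C) (r : R) : R := Re (F (RtoC r)).

(** Fixes the witness [F] that [analytic_weight] hides under an existential. *)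
Record aweight (nu : R -> R) (F : C -> C) : Prop := {
  aw_weight : weight nu;
  aw_holo : holo F;
  aw_inv : forall r, 0 <= r < 1 -> (RtoC (nu r) * F (RtoC r))%C = 1%C;
  aw_max : forall z, inD z -> Cmod (F z) <= Re (F (RtoC (Cmod z))) }.

(** * Polar coordinates and integrals along rays *)

Lemma polar_exists (z : C) : exists theta, 0 <= theta < 2 * PI /\ z = polar (Cmod z) theta.
Proof.
  pose proof PI_RGT_0 as HPI.
  destruct (Req_dec (Cmod z) 0) as [E|E].
  - exists 0. split; [lra|]. rewrite (Cmod_eq_0 z E), Cmod_0. unfold polar.
    apply injective_projections; simpl; ring.
  - assert (HP : 0 < Cmod z) by (pose proof (Cmod_ge_0 z); lra).
    set (r := Cmod z) in *. destruct z as [x y].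
    assert (Hr : r ^ 2 = x ^ 2 + y ^ 2) by (unfold r; rewrite Cmod2_alt; reflexivity).
    set (c := x / r). set (s := y / r).
    assert (Ex : x = r * c) by (unfold c; field; lra).
    assert (Ey : y = r * s) by (unfold s; field; lra).
    assert (Hcs : c ^ 2 + s ^ 2 = 1).
    { unfold c, s. replace ((x / r) ^ 2 + (y / r) ^ 2) with ((x ^ 2 + y ^ 2) / r ^ 2)
        by (field; lra). rewrite <- Hr. field. lra. }
    assert (Hc : -1 <= c <= 1) by (simpl in Hcs; nra).
    pose proof (acos_bound c) as Hb.
    destruct (Rle_lt_dec 0 s) as [Hs|Hs].
    + exists (acos c). split; [lra|]. unfold polar.
      rewrite cos_acos, sin_acos by exact Hc.
      replace (1 - Rsqr c) with (Rsqr s) by (unfold Rsqr; simpl in Hcs; lra).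
      rewrite sqrt_Rsqr by exact Hs. rewrite <- Ex, <- Ey. reflexivity.
    + exists (2 * PI - acos c). split.
      (* The angle has to stay strictly below 2 pi: acos c = 0 would force c = 1 and s = 0. *)
      * split; [lra|]. destruct Hb as [[Hb|Hb] _]; [lra|exfalso].
        assert (c = 1) by (rewrite <- (cos_acos c Hc), <- Hb; apply cos_0).
        simpl in Hcs. nra.
      * unfold polar. rewrite cos_minus, sin_minus, cos_2PI, sin_2PI, cos_acos, sin_acos by exact Hc.
        replace (1 - Rsqr c) with (Rsqr (- s)) by (unfold Rsqr; simpl in Hcs; lra).
        rewrite sqrt_Rsqr by lra. rewrite Ex, Ey at 1.
        apply injective_projections; simpl; ring.
Qed.

Lemma Cmod_polar r theta : 0 <= r -> Cmod (polar r theta) = r.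
Proof.
  intros Hr. unfold polar, Cmod. simpl.
  pose proof (sin2_cos2 theta) as H. unfold Rsqr in H.
  replace (r * cos theta * (r * cos theta * 1) + r * sin theta * (r * sin theta * 1))
    with (r * r * (sin theta * sin theta + cos theta * cos theta)) by ring.
  rewrite H, Rmult_1_r. apply sqrt_square, Hr.
Qed.

Lemma polar_scal r theta : polar r theta = (RtoC r * polar 1 theta)%C.
Proof. unfold polar. apply injective_projections; simpl; ring. Qed.

Lemma inD_polar r theta : 0 <= r < 1 -> inD (polar r theta).
Proof. intros H. unfold inD. rewrite Cmod_polar; lra. Qed.

Lemma continuous_polar theta r : continuous (fun r => polar r theta) r.
Proof.
  apply continuous_ext with (fun r => (RtoC r * polar 1 theta)%C).
  - intros s. symmetry. apply polar_scal.
  - apply continuous_ray.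
Qed.

(** With the radius as variable, the integrand no longer depends on the end point, so the integral
    can be cut at an intermediate radius. *)
Lemma seg_ray (k : C -> C) (R theta : R) : holo k -> 0 <= R < 1 ->
  is_CI (fun r => (k (polar r theta) * polar 1 theta)%C) 0 R (seg k 0 (polar R theta)).
Proof.
  intros Hk HR.
  assert (E : ex_CI (fun r => (k (polar r theta) * polar 1 theta)%C) 0 R).
  { apply ex_CI_continuous; [lra|]. intros r Hr.
    apply continuous_Cmult; [|apply continuous_const].
    apply (continuous_comp (fun r => polar r theta) k); [apply continuous_polar|].
    apply holo_continuous; [exact Hk|]. apply inD_polar; lra. }
  apply CI_correct in E. set (l := CI _ 0 R) in E.
  replace (seg k 0 (polar R theta)) with l; [exact E|].
  symmetry. unfold seg. apply CI_unique.
  assert (E' : is_CI (fun r => (k (polar r theta) * polar 1 theta)%C) (R * 0 + 0) (R * 1 + 0) l).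
  { replace (R * 0 + 0) with 0 by ring. replace (R * 1 + 0) with R by ring. exact E. }
  apply (is_RInt_comp_lin (V := C_R_NormedModule)) in E'.
  eapply is_CI_ext; [|exact E']. intros t _. cbv beta. rewrite scal_R_Cmult.
  replace (0 + RtoC t * (polar R theta - 0))%C with (polar (R * t + 0) theta).
  - rewrite (polar_scal R). ring.
  - unfold polar. apply injective_projections; simpl; ring.
Qed.

Lemma continuous_Cmod (U : UniformSpace) (c : U -> C) (t : U) :
  continuous c t -> continuous (fun s => Cmod (c s)) t.
Proof.
  intros H. apply filterlim_locally. intros eps.
  eapply filter_imp; [|exact (continuous_C_elim U c t H eps (cond_pos eps))].
  intros s Hs. change (Rabs (Cmod (c s) - Cmod (c t)) < eps).
  apply Rabs_def1.
  - pose proof (Cmod_triangle_inv (c s) (c t)). lra.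
  - pose proof (Cmod_triangle_inv (c t) (c s)) as T. rewrite Cmod_minus_sym in T. lra.
Qed.

Lemma Sg_seg (g f : C -> C) (z : C) : Sg g f z = seg (fun w => (cderiv f w * g w)%C) 0 z.
Proof.
  unfold Sg, seg. apply (RInt_ext (V := C_R_CompleteNormedModule)). intros t _.
  replace (0 + RtoC t * (z - 0))%C with (RtoC t * z)%C by ring.
  replace (z - 0)%C with z by ring. reflexivity.
Qed.

Lemma holo_ext (f h : C -> C) : (forall z, f z = h z) -> holo f -> holo h.
Proof.
  intros E Hf. apply holo_intro. intros z Hz. exists (cderiv f z).
  apply cdiff_ext with f; [exact E|]. apply holo_cdiff; assumption.
Qed.

Lemma holo_Sg (g f : C -> C) : holo g -> holo f -> holo (Sg g f).
Proof.
  intros Hg Hf. apply holo_ext with (seg (fun w => (cderiv f w * g w)%C) 0).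
  - intros z. symmetry. apply Sg_seg.
  - apply holo_primitive, holo_mult; [apply holo_cderiv, Hf|exact Hg].
Qed.

Lemma seg_bound (k : C -> C) (z : C) (K : R) : holo k -> inD z ->
  (forall w, Cmod w <= Cmod z -> Cmod (k w) <= K) -> Cmod (seg k 0 z) <= K * Cmod z.
Proof.
  intros Hk Hz HK.
  assert (Hs : forall P : C -> Prop, (forall w, Cmod w <= Cmod z -> P w) -> on_seg P 0 z).
  { intros P HP. apply disc_seg with (Cmod z); [exact HP| |apply Rle_refl].
    rewrite Cmod_0. apply Cmod_ge_0. }
  replace (K * Cmod z) with (K * Cmod z * (1 - 0)) by ring.
  eapply is_CI_norm_const; [lra| |apply is_CI_seg].
  - intros t Ht. cbv beta. rewrite Cmod_mult. replace (z - 0)%C with z at 2 by ring.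
    apply Rmult_le_compat_r; [apply Cmod_ge_0|].
    apply (Hs (fun w => Cmod (k w) <= K) HK t Ht).
  - apply Hs. intros w Hw. apply holo_continuous; [exact Hk|]. unfold inD in *; lra.
Qed.

Lemma Sg_minus (g f1 f2 : C -> C) (z : C) : holo g -> holo f1 -> holo f2 -> inD z ->
  (Sg g f1 z - Sg g f2 z)%C = Sg g (fun w => (f1 w - f2 w)%C) z.
Proof.
  intros Hg H1 H2 Hz.
  assert (Hs : forall P : C -> Prop, (forall w, inD w -> P w) -> on_seg P 0 z).
  { intros P HP t Ht. apply HP, inD_convex; [apply inD_0|exact Hz|exact Ht]. }
  assert (Hc : forall f, holo f -> on_seg (fun w => continuous (fun w => (cderiv f w * g w)%C) w) 0 z).
  { intros f Hf. apply Hs. intros w Hw.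
    apply (holo_continuous (fun w => (cderiv f w * g w)%C)); [|exact Hw].
    apply holo_mult; [apply holo_cderiv, Hf|exact Hg]. }
  rewrite !Sg_seg. symmetry. apply CI_unique.
  eapply is_CI_ext; [|apply is_CI_minus; apply is_CI_seg; apply Hc; assumption].
  rewrite Rmin_left, Rmax_right by lra. intros t Ht. cbv beta.
  rewrite cderiv_minus; [ring|exact H1|exact H2|].
  apply (Hs inD (fun w Hw => Hw) t Ht).
Qed.

(** * Sums of peak functions *)

Fixpoint rsum (u : nat -> R) (n : nat) : R :=
  match n with O => 0 | S k => rsum u k + u k end.

Fixpoint csum (u : nat -> C) (n : nat) : C :=
  match n with O => 0%C | S k => (csum u k + u k)%C end.

Lemma rsum_le (u v : nat -> R) (n : nat) : (forall k, u k <= v k) -> rsum u n <= rsum v n.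
Proof. intros H. induction n; simpl; [lra|]. specialize (H n). lra. Qed.

Lemma rsum_scal (c : R) (u : nat -> R) (n : nat) : rsum (fun k => c * u k) n = c * rsum u n.
Proof. induction n; simpl; [ring|]. rewrite IHn. ring. Qed.

Lemma Cmod_csum (u : nat -> C) (n : nat) : Cmod (csum u n) <= rsum (fun k => Cmod (u k)) n.
Proof.
  induction n; simpl; [rewrite Cmod_0; lra|].
  eapply Rle_trans; [apply Cmod_triangle|]. lra.
Qed.

Lemma Re_csum (u : nat -> C) (n : nat) : Re (csum u n) = rsum (fun k => Re (u k)) n.
Proof. induction n; simpl; [reflexivity|]. rewrite <- IHn. reflexivity. Qed.

Lemma csum_scal (c : C) (u : nat -> C) (n : nat) :
  (c * csum u n)%C = csum (fun k => (c * u k)%C) n.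
Proof. induction n; simpl; [ring|]. rewrite <- IHn. ring. Qed.

Lemma holo_csum (u : nat -> C -> C) (n : nat) :
  (forall k, holo (u k)) -> holo (fun z => csum (fun k => u k z) n).
Proof.
  intros H. induction n; simpl; [apply holo_const|].
  apply holo_intro. intros z Hz. eexists.
  apply (cdiff_plus (fun z => csum (fun k => u k z) n)); apply holo_cdiff; try exact Hz;
    [exact IHn|apply H].
Qed.

(** Keeps one favourable term and charges all the others to a summable error. *)
Lemma rsum_lower (u e : nat -> R) (n k : nat) : (k < n)%nat ->
  (forall j, 0 <= e j) -> (forall j, - e j <= u j) -> u k - rsum e n <= rsum u n.
Proof.
  intros Hk He Hu.
  assert (L : forall n, - rsum e n <= rsum u n).
  { induction n0; simpl; [lra|]. specialize (Hu n0). lra. }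
  induction n; [lia|]. simpl. destruct (Nat.eq_dec k n) as [->|Hn].
  - specialize (L n). specialize (He n). lra.
  - specialize (IHn ltac:(lia)). specialize (Hu n). lra.
Qed.

(** With x = exp(2d) this is 1/cosh^2 d; on a radius d is the hyperbolic distance to the node. *)
Definition bump (x : R) : R := 4 * x / ((1 + x) * (1 + x)).

Lemma inv_lt_1 x : 1 < x -> 0 < / x < 1.
Proof.
  intros H. split; [apply Rinv_0_lt_compat; lra|].
  rewrite <- Rinv_1. apply Rinv_lt_contravar; lra.
Qed.

Lemma bump_nonneg x : 0 < x -> 0 < bump x.
Proof. intros H. apply Rdiv_lt_0_compat; nra. Qed.

(* s/(1+s) - qs/(1+qs) = (1-q) s/((1+s)(1+qs)), so the bumps along a geometric grid telescope. *)
Lemma bump_sum x q n : 0 < x -> 0 < q < 1 ->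
  rsum (fun k => bump (x * q ^ k)) n <= 4 / (1 - q).
Proof.
  intros Hx Hq. set (Phi := fun s => s / (1 + s)).
  assert (S1 : forall s, 0 < s -> bump s <= 4 / (1 - q) * (Phi s - Phi (q * s))).
  { intros s Hs. unfold bump, Phi.
    assert (0 < q * s) by nra.
    replace (4 / (1 - q) * (s / (1 + s) - q * s / (1 + q * s)))
      with (4 * s / ((1 + s) * (1 + q * s))) by (field; lra).
    apply Rmult_le_compat_l; [lra|]. apply Rinv_le_contravar; nra. }
  assert (Hs : forall k, 0 < x * q ^ k).
  { intros k. apply Rmult_lt_0_compat; [lra|apply pow_lt; lra]. }
  assert (T : rsum (fun k => bump (x * q ^ k)) n <= 4 / (1 - q) * (Phi x - Phi (x * q ^ n))).
  { induction n; simpl.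
    - rewrite Rmult_1_r. lra.
    - specialize (S1 _ (Hs n)). replace (q * (x * q ^ n)) with (x * (q * q ^ n)) in S1 by ring.
      lra. }
  eapply Rle_trans; [exact T|].
  assert (P1 : Phi x <= 1).
  { apply Rle_div_l; lra. }
  assert (P2 : 0 <= Phi (x * q ^ n)).
  { pose proof (Hs n). apply Rdiv_le_0_compat; lra. }
  assert (0 < 4 / (1 - q)) by (apply Rdiv_lt_0_compat; lra). nra.
Qed.

(** The hypothesis says |ln x| >= |ln y|: [bump] is invariant under x -> 1/x and decreases away from
    1. *)
Lemma bump_le x y : 0 < x -> 0 < y -> (x - y) * (1 - x * y) <= 0 -> bump x <= bump y.
Proof.
  intros Hx Hy H. unfold bump. apply Rle_div_l; [apply Rmult_lt_0_compat; lra|].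
  replace (4 * y / ((1 + y) * (1 + y)) * ((1 + x) * (1 + x)))
    with (4 * y * ((1 + x) * (1 + x)) / ((1 + y) * (1 + y))) by (field; lra).
  apply -> Rle_div_r; [nra|apply Rmult_lt_0_compat; lra].
Qed.

Lemma bump_lt_1 x : 1 < x -> bump x < 1.
Proof.
  intros H. unfold bump. apply Rlt_div_l; nra.
Qed.

(** In terms of d this is cosh(2d) >= cosh^2 d: doubling the distance at least squares the decay,
    which is what lets a large exponent separate near from far nodes. *)
Lemma bump_sqr x : 1 <= x -> bump (x * x) <= bump x * bump x.
Proof.
  intros H. unfold bump.
  apply Rmult_le_reg_r with ((1 + x * x) * (1 + x * x) * ((1 + x) * (1 + x) * ((1 + x) * (1 + x))));
    [repeat apply Rmult_lt_0_compat; nra|].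
  replace (4 * (x * x) / ((1 + x * x) * (1 + x * x)) *
    ((1 + x * x) * (1 + x * x) * ((1 + x) * (1 + x) * ((1 + x) * (1 + x)))))
    with (x * x * 4 * (((1 + x) * (1 + x)) * ((1 + x) * (1 + x)))) by (field; nra).
  replace (4 * x / ((1 + x) * (1 + x)) * (4 * x / ((1 + x) * (1 + x))) *
    ((1 + x * x) * (1 + x * x) * ((1 + x) * (1 + x) * ((1 + x) * (1 + x)))))
    with (x * x * 4 * ((2 * (1 + x * x)) * (2 * (1 + x * x)))) by (field; lra).
  apply Rmult_le_compat_l; [nra|]. apply Rmult_le_compat; nra.
Qed.

(** The ratio of the grid is sg^2, so every point is within a factor sg of some node, and nodes 0 to
    N cover [1, lam^N]. *)
Lemma grid_near lam sg t N : 1 < sg -> lam = sg * sg -> 1 <= t -> t <= lam ^ N ->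
  exists k, (k <= N)%nat /\ / sg <= t * (/ lam) ^ k <= sg.
Proof.
  intros Hs Hl Ht.
  pose proof (inv_lt_1 sg Hs) as Hi.
  induction N; intros HN.
  - exists 0%nat. split; [lia|]. simpl in *. lra.
  - destruct (Rle_lt_dec t (lam ^ N)) as [H|H].
    + destruct (IHN H) as [k [Hk1 Hk2]]. exists k. split; [lia|exact Hk2].
    + assert (P : 0 < lam ^ N) by (apply pow_lt; nra).
      assert (Pl : 0 < lam) by nra.
      set (y := t * (/ lam) ^ N).
      assert (Ey : t = y * lam ^ N) by (unfold y; rewrite pow_inv; field; lra).
      assert (Hy1 : 1 < y) by nra.
      assert (Hy2 : y <= lam).
      { simpl in HN. rewrite Ey in HN. apply Rmult_le_reg_r with (lam ^ N); lra. }
      destruct (Rle_lt_dec y sg) as [Hy|Hy].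
      * exists N. split; [lia|]. fold y. lra.
      * exists (S N). split; [lia|]. simpl.
        replace (t * (/ lam * (/ lam) ^ N)) with (y / lam) by (unfold y; field; lra).
        split.
        -- apply Rle_div_r; [lra|].
           replace (/ sg * lam) with sg by (rewrite Hl; field; lra). lra.
        -- apply Rle_div_l; nra.
Qed.

(** The nearest node, within a factor sg, contributes at least bump(sg)^(m+1)/2. Other nodes within
    a factor lam have positive weight. Beyond lam the weights may be -1, but there m powers are at
    most bump(lam)^m and the remaining one is summed by [bump_sum]. *)
Lemma bump_weighted_sum (lam sg t : R) (c : nat -> R) (m N : nat) :
  1 < sg -> lam = sg * sg -> 1 <= t -> t <= lam ^ N ->
  (forall k, -1 <= c k) ->
  (forall k, / lam <= t * (/ lam) ^ k <= lam -> 1 / 2 <= c k) ->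
  bump sg ^ S m / 2 - bump lam ^ m * (4 / (1 - / lam)) <=
  rsum (fun k => c k * bump (t * (/ lam) ^ k) ^ S m) (S N).
Proof.
  intros Hs Hl Ht HN Hc1 Hc2.
  assert (Pl : 1 < lam) by nra.
  pose proof (inv_lt_1 lam ltac:(lra)) as Hi.
  pose proof (inv_lt_1 sg ltac:(lra)) as His.
  assert (Hil : / lam <= / sg) by (apply Rinv_le_contravar; nra).
  set (x := fun k => t * (/ lam) ^ k).
  assert (Hx : forall k, 0 < x k).
  { intros k. apply Rmult_lt_0_compat; [lra|apply pow_lt; lra]. }
  destruct (grid_near lam sg t N Hs Hl Ht HN) as [k [Hk1 Hk2]]. fold (x k) in Hk2.
  set (e := fun j => bump lam ^ m * bump (x j)).
  assert (He : forall j, 0 <= e j).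
  { intros j. apply Rmult_le_pos; [apply pow_le; left; apply bump_nonneg; lra|].
    left; apply bump_nonneg, Hx. }
  assert (Hu : forall j, - e j <= c j * bump (x j) ^ S m).
  { intros j. pose proof (bump_nonneg _ (Hx j)) as B. specialize (He j).
    assert (P : 0 <= bump (x j) ^ S m) by (apply pow_le; lra).
    destruct (classic (/ lam <= x j <= lam)) as [Hn|Hn].
    - specialize (Hc2 j Hn). nra.
    - assert (Q : bump (x j) <= bump lam).
      { apply bump_le; [apply Hx|lra|].
        destruct (Rle_lt_dec (/ lam) (x j)) as [H1|H1].
        - assert (lam < x j) by (apply Rnot_le_lt; intros H2; apply Hn; split; assumption).
          assert (1 < x j * lam) by nra. nra.
        - assert (x j * lam < 1).
          { apply Rmult_lt_compat_r with (r := lam) in H1; [|lra].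
            rewrite Rinv_l in H1 by lra. exact H1. }
          assert (x j < lam) by lra. nra. }
      assert (Q2 : bump (x j) ^ S m <= e j).
      { unfold e. simpl. rewrite (Rmult_comm (bump (x j))).
        apply Rmult_le_compat_r; [lra|]. apply pow_incr. lra. }
      specialize (Hc1 j). nra. }
  pose proof (rsum_lower (fun j => c j * bump (x j) ^ S m) e (S N) k ltac:(lia) He Hu) as L.
  cbv beta in L.
  assert (L1 : bump sg ^ S m / 2 <= c k * bump (x k) ^ S m).
  { assert (B : bump sg ^ S m <= bump (x k) ^ S m).
    { apply pow_incr. split; [left; apply bump_nonneg; lra|]. apply bump_le; [lra|apply Hx|].
      assert (1 <= x k * sg).
      { destruct Hk2 as [Hk2 _]. apply Rmult_le_compat_r with (r := sg) in Hk2; [|lra].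
        rewrite Rinv_l in Hk2 by lra. exact Hk2. }
      nra. }
    specialize (Hc2 k). fold (x k) in Hc2. specialize (Hc2 ltac:(nra)).
    assert (0 <= bump sg ^ S m) by (apply pow_le; left; apply bump_nonneg; lra). nra. }
  assert (L2 : rsum e (S N) <= bump lam ^ m * (4 / (1 - / lam))).
  { unfold e. rewrite (rsum_scal (bump lam ^ m) (fun j => bump (x j))).
    apply Rmult_le_compat_l; [apply pow_le; left; apply bump_nonneg; lra|].
    apply bump_sum; lra. }
  unfold x in *. lra.
Qed.

(** With P = bump(sg), [bump_sqr] bounds the error by P^(2m) K; once P^m K <= P/4 this is at most
    half of the main term P^(m+1)/2. *)
Lemma bump_exponent (sg : R) : 1 < sg -> exists m c, 0 < c /\
  c <= bump sg ^ S m / 2 - bump (sg * sg) ^ m * (4 / (1 - / (sg * sg))).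
Proof.
  intros Hs. set (P := bump sg). set (K := 4 / (1 - / (sg * sg))).
  assert (HP : 0 < P < 1) by (split; [apply bump_nonneg; lra|apply bump_lt_1, Hs]).
  assert (HK : 0 < K).
  { apply Rdiv_lt_0_compat; [lra|].
    pose proof (inv_lt_1 (sg * sg) ltac:(nra)). lra. }
  assert (He : 0 < P / (4 * K)) by (apply Rdiv_lt_0_compat; lra).
  destruct (pow_small P _ ltac:(lra) He) as [m Hm]. specialize (Hm m (le_n m)).
  exists m, (P ^ S m / 4).
  assert (Pm : 0 < P ^ m) by (apply pow_lt; lra). split; [simpl; nra|].
  assert (B : bump (sg * sg) ^ m <= P ^ m * P ^ m).
  { rewrite <- Rpow_mult_distr. apply pow_incr.
    split; [left; apply bump_nonneg; nra|apply bump_sqr; lra]. }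
  assert (B2 : bump (sg * sg) ^ m * K <= P ^ m * P ^ m * K) by (apply Rmult_le_compat_r; lra).
  assert (B3 : P ^ m * K <= P / 4).
  { apply Rle_trans with (P / (4 * K) * K); [apply Rmult_le_compat_r; lra|].
    right. field. lra. }
  simpl. fold K. nra.
Qed.

(** Analytic in z, equal to 1 at z = p, and on [0,1) equal to 1 minus the squared pseudohyperbolic
    distance to p; the square in the denominator makes its values there real and positive. *)
Definition peak (p : R) (z : C) : C :=
  ((1 - z * z) * RtoC (1 - p * p) / ((1 - RtoC p * z) * (1 - RtoC p * z)))%C.

Lemma one_minus_pz p z : 0 <= p < 1 -> inD z -> (1 - RtoC p * z)%C <> 0%C.
Proof.
  intros Hp Hz E. assert (Cmod (RtoC p * z) < 1) as H.
  { apply inD_dilate; [lra|exact Hz]. }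
  replace (RtoC p * z)%C with (1 - (1 - RtoC p * z))%C in H by ring.
  rewrite E in H. replace (1 - 0)%C with (RtoC 1) in H by ring. rewrite Cmod_1 in H. lra.
Qed.

Lemma holo_peak p : 0 <= p < 1 -> holo (peak p).
Proof.
  intros Hp. assert (Hl : holo (fun z => (1 - RtoC p * z)%C)).
  { apply holo_minus; [apply holo_const|]. apply holo_mult; [apply holo_const|apply holo_id]. }
  apply (holo_mult (fun z => ((1 - z * z) * RtoC (1 - p * p))%C)
          (fun z => (/ ((1 - RtoC p * z) * (1 - RtoC p * z)))%C)).
  - apply holo_mult; [|apply holo_const].
    apply holo_minus; [apply holo_const|]. apply holo_mult; apply holo_id.
  - apply (holo_inv (fun z => ((1 - RtoC p * z) * (1 - RtoC p * z))%C)); [apply holo_mult; exact Hl|].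
    intros z Hz. apply Cmult_neq_0; apply one_minus_pz; assumption.
Qed.

Lemma peak_real p r : 0 <= p < 1 -> 0 <= r < 1 ->
  peak p (RtoC r) = RtoC (bump ((1 + r) / (1 - r) / ((1 + p) / (1 - p)))).
Proof.
  intros Hp Hr. unfold peak, bump.
  assert (H1 : 0 < 1 - p * r) by nra.
  replace (4 * ((1 + r) / (1 - r) / ((1 + p) / (1 - p))) /
    ((1 + (1 + r) / (1 - r) / ((1 + p) / (1 - p))) * (1 + (1 + r) / (1 - r) / ((1 + p) / (1 - p)))))
    with ((1 - r * r) * (1 - p * p) / ((1 - p * r) * (1 - p * r))).
  - rewrite RtoC_div by nra. rewrite !RtoC_mult, !RtoC_minus, !RtoC_mult. reflexivity.
  - field. repeat split; nra.
Qed.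

Lemma Cmod_one_pm z : inD z -> 0 < Cmod (1 - z) /\ 0 < Cmod (1 + z).
Proof.
  unfold inD. intros Hz. split.
  - pose proof (Cmod_triangle_inv 1 z) as H. rewrite Cmod_1 in H. lra.
  - pose proof (Cmod_triangle_inv 1 (- z)) as H. rewrite Cmod_1, Cmod_opp in H.
    replace (1 - - z)%C with (1 + z)%C in H by ring. lra.
Qed.

(** 2(1-pz) is the sum of (1-z)(1+p) and (1+z)(1-p), whose moduli are U and V. They enclose an acute
    angle, since Re((1-z) conj(1+z)) = 1-|z|^2 > 0, so U^2 + V^2 <= 4|1-pz|^2. As the peak has
    modulus UV/|1-pz|^2, leaving the radius costs a factor of at most 2. *)
Lemma peak_bound p z : 0 <= p < 1 -> inD z ->
  let x := Cmod (1 + z) / Cmod (1 - z) / ((1 + p) / (1 - p)) in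
  0 < x /\ Cmod (peak p z) <= 2 /\ Cmod (peak p z) <= 2 * bump x.
Proof.
  intros Hp Hz x. destruct (Cmod_one_pm z Hz) as [HA HB].
  set (A := Cmod (1 - z)) in *. set (B := Cmod (1 + z)) in *.
  set (U := A * (1 + p)). set (V := B * (1 - p)).
  assert (HU : 0 < U) by (unfold U; nra). assert (HV : 0 < V) by (unfold V; nra).
  assert (Ex : x = V / U) by (unfold x, U, V; field; lra).
  assert (Hx : 0 < x) by (rewrite Ex; apply Rdiv_lt_0_compat; assumption).
  assert (HZ : Cmod z ^ 2 < 1).
  { unfold inD in Hz. pose proof (Cmod_ge_0 z). simpl. nra. }
  set (Q := Cmod (1 - RtoC p * z)).
  assert (HQ : U * U + V * V <= 4 * (Q * Q)).
  { assert (E1 : A * A = Cmod (1 - z) ^ 2) by (unfold A; simpl; ring).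
    assert (E2 : B * B = Cmod (1 + z) ^ 2) by (unfold B; simpl; ring).
    assert (E3 : Q * Q = Cmod (1 - RtoC p * z) ^ 2) by (unfold Q; simpl; ring).
    replace (U * U + V * V) with (A * A * ((1 + p) * (1 + p)) + B * B * ((1 - p) * (1 - p)))
      by (unfold U, V; ring).
    rewrite E1, E2, E3. rewrite !Cmod2_alt in *. destruct z as [a b]. unfold Re, Im in *. simpl in *.
    assert (0 < (1 + p) * (1 - p)) by nra. nra. }
  assert (HQ0 : 0 < Q * Q) by nra.
  assert (HQ1 : Q <> 0) by (intros E; rewrite E in HQ0; lra).
  assert (EP : Cmod (peak p z) = U * V / (Q * Q)).
  { unfold peak. rewrite Cmod_div by (apply Cmult_neq_0; apply one_minus_pz; assumption).
    replace (1 - z * z)%C with ((1 - z) * (1 + z))%C by ring.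
    rewrite !Cmod_mult, Cmod_R, Rabs_pos_eq by nra. fold A B Q.
    replace (A * B * (1 - p * p)) with (U * V) by (unfold U, V; ring). reflexivity. }
  split; [exact Hx|]. rewrite EP. split.
  - apply Rle_div_l; [exact HQ0|]. assert (0 <= (U - V) * (U - V)) by apply Rle_0_sqr. lra.
  - rewrite Ex. unfold bump.
    replace (2 * (4 * (V / U) / ((1 + V / U) * (1 + V / U))))
      with (8 * (U * V) / ((U + V) * (U + V))) by (field; lra).
    apply Rmult_le_reg_r with ((Q * Q) * ((U + V) * (U + V))); [apply Rmult_lt_0_compat; [exact HQ0|nra]|].
    replace (U * V / (Q * Q) * (Q * Q * ((U + V) * (U + V))))
      with (U * V * ((U + V) * (U + V))) by (field; repeat split; first [exact HQ1 | apply Rgt_not_eq; lra]).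
    replace (8 * (U * V) / ((U + V) * (U + V)) * (Q * Q * ((U + V) * (U + V))))
      with (U * V * (8 * (Q * Q))) by (field; repeat split; first [exact HQ1 | apply Rgt_not_eq; lra]).
    apply Rmult_le_compat_l; [nra|]. assert (0 <= (U - V) * (U - V)) by apply Rle_0_sqr. lra.
Qed.

(** The solution p of (1+p)/(1-p) = lam^k; node 0 is the origin. *)
Definition node (lam : R) (k : nat) : R := (lam ^ k - 1) / (lam ^ k + 1).

Lemma node_range lam k : 1 < lam -> 0 <= node lam k < 1.
Proof.
  intros H. pose proof (pow_R1_Rle lam k ltac:(lra)) as P. unfold node. split.
  - apply Rdiv_le_0_compat; lra.
  - apply Rlt_div_l; lra.
Qed.

Lemma node_ratio lam k : 1 < lam -> (1 + node lam k) / (1 - node lam k) = lam ^ k.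
Proof.
  intros H. pose proof (pow_R1_Rle lam k ltac:(lra)) as P. unfold node. field. lra.
Qed.

Definition comb (lam : R) (m N : nat) (c : nat -> C) (z : C) : C :=
  csum (fun k => (c k * peak (node lam k) z ^ S m)%C) (S N).

Lemma holo_comb lam m N c : 1 < lam -> holo (comb lam m N c).
Proof.
  intros H. apply (holo_csum (fun k z => (c k * peak (node lam k) z ^ S m)%C)). intros k.
  apply holo_mult; [apply holo_const|]. apply holo_pow, holo_peak, node_range, H.
Qed.

(** In each peak m factors are bounded by 2 and the last one by 2 bump(x lam^-k). The geometric sum
    bound holds for every x > 0, hence at every z and for any number of nodes. *)
Lemma comb_bound lam m N c z : 1 < lam -> (forall k, Cmod (c k) = 1) -> inD z ->
  Cmod (comb lam m N c z) <= 2 ^ S m * (4 / (1 - / lam)).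
Proof.
  intros Hl Hc Hz.
  pose proof (inv_lt_1 lam ltac:(lra)) as Hi.
  set (x := Cmod (1 + z) / Cmod (1 - z)).
  assert (Hx : 0 < x) by (destruct (Cmod_one_pm z Hz); apply Rdiv_lt_0_compat; assumption).
  eapply Rle_trans; [apply Cmod_csum|].
  apply Rle_trans with (rsum (fun k => 2 ^ S m * bump (x * (/ lam) ^ k)) (S N)).
  - apply rsum_le. intros k. rewrite Cmod_mult, Hc, Rmult_1_l, Cmod_pow.
    destruct (peak_bound (node lam k) z (node_range lam k Hl) Hz) as (_ & B1 & B2).
    rewrite node_ratio in B2 by exact Hl. fold x in B2.
    replace (x / lam ^ k) with (x * (/ lam) ^ k) in B2
      by (rewrite pow_inv; reflexivity).
    set (w := Cmod (peak (node lam k) z)) in *. assert (Hw : 0 <= w) by apply Cmod_ge_0.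
    simpl. replace (2 * 2 ^ m * bump (x * (/ lam) ^ k)) with (2 * bump (x * (/ lam) ^ k) * 2 ^ m)
      by ring.
    apply Rmult_le_compat; [exact Hw|apply pow_le, Hw|exact B2|apply pow_incr; lra].
  - rewrite rsum_scal. apply Rmult_le_compat_l; [apply pow_le; lra|]. apply bump_sum; lra.
Qed.

(** Along a ray the Bloch bound is M/(1-s^2), the derivative of (M/2) ln((1+s)/(1-s)). *)
Lemma Im_lip_ray (h : C -> C) (M theta p r : R) : holo h -> 0 <= p -> p <= r -> r < 1 ->
  (forall z, inD z -> (1 - Cmod z ^ 2) * Cmod (cderiv h z) <= M) ->
  Rabs (Im (h (polar r theta)) - Im (h (polar p theta))) <=
  M / 2 * (ln ((1 + r) / (1 - r)) - ln ((1 + p) / (1 - p))).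
Proof.
  intros Hh Hp Hpr Hr HM.
  set (al := fun s => Im (h (polar s theta))).
  set (dal := fun s => Im (cderiv h (polar s theta) * polar 1 theta)%C).
  set (ta := fun s => M / 2 * ln ((1 + s) / (1 - s))).
  assert (Dal : forall s, 0 <= s < 1 -> is_derive al s (dal s)).
  { intros s Hs. apply rdiff_Im.
    apply rdiff_ext with (fun s => h (0 + RtoC s * polar 1 theta)%C).
    - intros u. f_equal. rewrite (polar_scal u). ring.
    - apply rdiff_line. rewrite Cplus_0_l, <- polar_scal.
      apply holo_cdiff; [exact Hh|apply inD_polar, Hs]. }
  assert (Dta : forall s, 0 <= s < 1 -> is_derive ta s (M / (1 - s ^ 2))).
  { intros s Hs. pose proof (one_minus_sq s Hs) as P. unfold ta. auto_derive.
    - split; [lra|]. split; [apply Rdiv_lt_0_compat; lra|exact I].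
    - simpl in *. field. repeat split; nra. }
  assert (Bal : forall s, 0 <= s < 1 -> Rabs (dal s) <= M / (1 - s ^ 2)).
  { intros s Hs. pose proof (one_minus_sq s Hs) as P. unfold dal.
    eapply Rle_trans; [apply im_le_Cmod|].
    rewrite Cmod_mult, (Cmod_polar 1) by lra. rewrite Rmult_1_r.
    pose proof (HM _ (inD_polar s theta Hs)) as X. rewrite Cmod_polar in X by lra.
    apply Rle_div_r; lra. }
  (* Taken at e = 1 and e = -1, this gives both sides of the absolute value. *)
  assert (G : forall e, Rabs e <= 1 -> e * (al r - al p) <= ta r - ta p).
  { intros e He.
    destruct (mean_value (fun s => ta s - e * al s) (fun s => M / (1 - s ^ 2) - e * dal s) p r)
      as [c [Hc E]]; [exact Hpr| |].
    { intros s Hs.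
      apply (is_derive_minus (K := R_AbsRing) (V := R_NormedModule) ta (fun s => e * al s));
        [apply Dta; lra|]. apply is_derive_scal, Dal. lra. }
    specialize (Bal c ltac:(lra)).
    assert (X : e * dal c <= Rabs (dal c)).
    { eapply Rle_trans; [apply Rle_abs|]. rewrite Rabs_mult.
      pose proof (Rabs_pos (dal c)). nra. }
    assert (0 <= (M / (1 - c ^ 2) - e * dal c) * (r - p)) by (apply Rmult_le_pos; lra).
    lra. }
  pose proof (G 1 ltac:(rewrite Rabs_R1; lra)) as G1.
  pose proof (G (-1) ltac:(rewrite Rabs_left; lra)) as G2.
  apply Rabs_le. fold (al r) (al p). unfold ta in *. lra.
Qed.

Lemma Im_lip_ratio (h : C -> C) (M theta p r x lam : R) : holo h -> 0 <= p < 1 -> 0 <= r < 1 ->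
  (forall z, inD z -> (1 - Cmod z ^ 2) * Cmod (cderiv h z) <= M) -> 0 <= M ->
  x = (1 + r) / (1 - r) / ((1 + p) / (1 - p)) -> 1 < lam -> / lam <= x <= lam ->
  Rabs (Im (h (polar r theta)) - Im (h (polar p theta))) <= M / 2 * ln lam.
Proof.
  intros Hh Hp Hr HM HM0 Hx Hl Hxl.
  assert (P1 : 0 < (1 + r) / (1 - r)) by (apply Rdiv_lt_0_compat; lra).
  assert (P2 : 0 < (1 + p) / (1 - p)) by (apply Rdiv_lt_0_compat; lra).
  assert (Hil : 0 < / lam) by (apply Rinv_0_lt_compat; lra).
  assert (L : Rabs (ln ((1 + r) / (1 - r)) - ln ((1 + p) / (1 - p))) <= ln lam).
  { rewrite <- ln_div by assumption. rewrite <- Hx.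
    assert (ln x <= ln lam) by (apply ln_le; lra).
    assert (ln (/ lam) <= ln x) by (apply ln_le; lra). rewrite ln_Rinv in H0 by lra.
    apply Rabs_le. lra. }
  destruct (Rle_lt_dec p r) as [H|H].
  - eapply Rle_trans; [apply (Im_lip_ray h M); try assumption; lra|].
    apply Rmult_le_compat_l; [lra|]. eapply Rle_trans; [apply Rle_abs|exact L].
  - rewrite Rabs_minus_sym. eapply Rle_trans; [apply (Im_lip_ray h M); try assumption; lra|].
    apply Rmult_le_compat_l; [lra|]. rewrite Rabs_minus_sym in L.
    eapply Rle_trans; [apply Rle_abs|exact L].
Qed.

Lemma cos_half x : Rabs x <= 1 -> 1 / 2 <= cos x.
Proof.
  intros H. pose proof PI2_1 as HP. pose proof PI_4. pose proof PI_RGT_0.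
  assert (C1 : 1 / 2 <= cos 1).
  { rewrite <- cos_PI3. apply cos_decr_1; try lra. assert (3 <= PI) by (pose proof PI2_3_2; lra). lra. }
  assert (E : cos x = cos (Rabs x)).
  { unfold Rabs. destruct (Rcase_abs x); [symmetry; apply cos_neg|reflexivity]. }
  rewrite E. eapply Rle_trans; [exact C1|].
  pose proof (Rabs_pos x). apply cos_decr_1; lra.
Qed.

(** * Growth estimates for an analytic quasi-normal weight *)

Section Weight.
Variables (nu : R -> R) (F : C -> C).
Hypothesis HA : aweight nu F.
Hypothesis HQ : quasi_normal nu.

Local Notation Fr := (radial F).

Lemma aw_eq r : 0 <= r < 1 -> nu r * Fr r = 1.
Proof.
  intros Hr. pose proof (aw_inv _ _ HA r Hr) as E. apply (f_equal Re) in E.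
  rewrite re_scal_l, re_RtoC in E. exact E.
Qed.

Lemma aw_nu_pos r : 0 <= r < 1 -> 0 < nu r.
Proof.
  intros Hr. pose proof (aw_eq r Hr). destruct (proj1 (aw_weight _ _ HA) r Hr); nra.
Qed.

Lemma aw_F_pos r : 0 <= r < 1 -> 0 < Fr r.
Proof. intros Hr. pose proof (aw_eq r Hr). pose proof (aw_nu_pos r Hr). nra. Qed.

Lemma aw_F_inv r : 0 <= r < 1 -> Fr r = / nu r.
Proof.
  intros Hr. pose proof (aw_eq r Hr) as E. pose proof (aw_nu_pos r Hr).
  apply Rmult_eq_reg_l with (nu r); [|lra]. rewrite E, Rinv_r; lra.
Qed.

Lemma aw_F_real r : 0 <= r < 1 -> F (RtoC r) = RtoC (Fr r).
Proof.
  intros Hr. pose proof (aw_inv _ _ HA r Hr) as E. pose proof (aw_nu_pos r Hr).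
  apply (f_equal Im) in E. rewrite im_scal_l, im_RtoC in E.
  apply injective_projections; simpl; [reflexivity|].
  change (Im (F (RtoC r)) = 0). apply Rmult_eq_reg_l with (nu r); lra.
Qed.

Lemma aw_F_mono r s : 0 <= r -> r <= s -> s < 1 -> Fr r <= Fr s.
Proof.
  intros H1 H2 H3. rewrite !aw_F_inv by lra. apply Rinv_le_contravar; [apply aw_nu_pos; lra|].
  apply (proj2 (proj2 (aw_weight _ _ HA))); assumption.
Qed.

Lemma aw_F_max z : inD z -> Cmod (F z) <= Fr (Cmod z).
Proof. apply (aw_max _ _ HA). Qed.

Lemma aw_le_real x K r : 0 <= r < 1 -> nu r * x <= K <-> x <= K * Fr r.
Proof.
  intros Hr. rewrite aw_F_inv, Rmult_comm by exact Hr. apply Rle_div_r, aw_nu_pos, Hr.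
Qed.

Lemma aw_le f M z : inD z -> nu (Cmod z) * Cmod (f z) <= M <-> Cmod (f z) <= M * Fr (Cmod z).
Proof. intros Hz. apply aw_le_real, inD_range, Hz. Qed.

Lemma RtoC_inD r : 0 <= r < 1 -> inD (RtoC r).
Proof. intros Hr. unfold inD. rewrite Cmod_R, Rabs_pos_eq; lra. Qed.

Lemma aw_F_derive r : 0 <= r < 1 -> is_derive Fr r (Re (cderiv F (RtoC r))).
Proof.
  intros Hr. apply (rdiff_Re (fun s => F (RtoC s))).
  apply rdiff_ext with (fun s => F (0 + RtoC s * 1)%C); [intros s; f_equal; ring|].
  rewrite <- (Cmult_1_r (cderiv F (RtoC r))). apply rdiff_line.
  replace (0 + RtoC r * 1)%C with (RtoC r) by ring.
  apply holo_cdiff; [apply (aw_holo _ _ HA)|apply RtoC_inD, Hr].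
Qed.

Lemma aw_F_derive_nonneg r : 0 <= r < 1 -> 0 <= Re (cderiv F (RtoC r)).
Proof.
  intros Hr. destruct (Rle_lt_dec 0 (Re (cderiv F (RtoC r)))) as [H|H]; [exact H|exfalso].
  pose proof (aw_F_derive r Hr) as D. set (l := Re (cderiv F (RtoC r))) in *.
  destruct D as [_ D].
  assert (Hl : 0 < - l / 2) by lra.
  destruct (D r (fun P HP => HP) (mkposreal _ Hl)) as [d Hd].
  pose proof (cond_pos d) as Pd.
  set (h := Rmin (d / 2) ((1 - r) / 2)).
  assert (Hh : 0 < h) by (apply Rmin_glb_lt; lra).
  assert (Hh1 : h <= d / 2) by apply Rmin_l. assert (Hh2 : h <= (1 - r) / 2) by apply Rmin_r.
  assert (B : ball r d (r + h)).
  { change (Rabs (r + h - r) < d). rewrite Rabs_pos_eq; lra. }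
  specialize (Hd _ B).
  change (Rabs (Fr (r + h) - Fr r - (r + h - r) * l) <= - l / 2 * Rabs (r + h - r)) in Hd.
  replace (r + h - r) with h in Hd by ring. rewrite (Rabs_pos_eq h) in Hd by lra.
  apply Rabs_le_between in Hd. pose proof (aw_F_mono r (r + h)). nra.
Qed.

(** The constant 1 has derivative 0 and so lies in the [B0] space; quasi-normality puts it into
    [H0 nu], which says that nu tends to 0. *)
Lemma aw_nu_to_0 eps : 0 < eps -> exists r0, 0 <= r0 < 1 /\ forall r, r0 < r < 1 -> nu r < eps.
Proof.
  intros He.
  assert (HB : B0 (fun r => nu r * (1 - r ^ 2)) (fun _ => 1%C)).
  { split.
    - apply holo_intro. intros z _. exists 0%C. apply cdiff_const.
    - intros e Hee. exists 0. split; [lra|]. intros z _.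
      rewrite (cderiv_unique _ _ _ (cdiff_const 1%C z)), Cmod_0. lra. }
  apply (proj2 HQ) in HB. destruct HB as [_ HB]. destruct (HB eps He) as [r0 [Hr0 H]].
  exists (Rmax r0 0). split; [split; [apply Rmax_r|apply Rmax_lub_lt; lra]|].
  intros r Hr. pose proof (Rmax_l r0 0). pose proof (Rmax_r r0 0).
  specialize (H (RtoC r)). rewrite Cmod_R, Rabs_pos_eq, Cmod_1 in H by lra.
  specialize (H ltac:(lra)). lra.
Qed.

Lemma aw_nu_le r : 0 <= r < 1 -> 0 <= nu r <= nu 0.
Proof.
  intros Hr. split; [apply (proj1 (aw_weight _ _ HA)), Hr|].
  apply (proj2 (proj2 (aw_weight _ _ HA))); lra.
Qed.

Lemma aw_little_o_bounded (w : R -> R) (f : C -> C) (M : R) :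
  (forall r, 0 <= r < 1 -> 0 <= w r <= nu r) ->
  (forall z, inD z -> Cmod (f z) <= M) -> little_o w f.
Proof.
  intros Hw HM eps He.
  assert (HM0 : 0 <= M) by (eapply Rle_trans; [apply Cmod_ge_0|apply (HM 0%C inD_0)]).
  destruct (aw_nu_to_0 (eps / (M + 1))) as [r0 [Hr0 H]]; [apply Rdiv_lt_0_compat; lra|].
  exists r0. split; [lra|]. intros z Hz. specialize (H _ Hz).
  destruct (Hw (Cmod z) ltac:(lra)) as [W1 W2].
  assert (Dz : inD z) by (unfold inD; lra). specialize (HM z Dz).
  apply Rle_lt_trans with (nu (Cmod z) * (M + 1)).
  - apply Rmult_le_compat; try lra. apply Cmod_ge_0.
  - apply Rmult_lt_compat_r with (r := M + 1) in H; [|lra].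
    replace (eps / (M + 1) * (M + 1)) with eps in H by (field; lra). exact H.
Qed.

Lemma aw_nu1_le r : 0 <= r < 1 -> 0 <= nu r * (1 - r ^ 2) <= nu r.
Proof.
  intros Hr. pose proof (one_minus_sq r Hr). pose proof (aw_nu_le r Hr). nra.
Qed.

Lemma inD_scal rho z : 0 <= rho <= 1 -> inD z ->
  Cmod (RtoC rho * z) = rho * Cmod z /\ 0 <= rho * Cmod z <= Cmod z.
Proof.
  intros Hr Hz. rewrite Cmod_mult, Cmod_R, Rabs_pos_eq by lra.
  split; [reflexivity|]. pose proof (Cmod_ge_0 z). nra.
Qed.

Lemma aw_F_dilate rho z : 0 <= rho <= 1 -> inD z -> Cmod (F (RtoC rho * z)%C) <= Fr (Cmod z).
Proof.
  intros Hr Hz. destruct (inD_scal rho z Hr Hz) as [E1 E2].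
  pose proof (aw_F_max _ (inD_dilate rho z Hr Hz)) as H. rewrite E1 in H.
  unfold inD in Hz. eapply Rle_trans; [exact H|]. apply aw_F_mono; lra.
Qed.

Lemma dilate_bounded (Q : C -> C) s : holo Q -> 0 <= s < 1 ->
  exists M, forall z, inD z -> Cmod (Q (RtoC s * z)%C) <= M.
Proof.
  intros HQ0 Hs. destruct (holo_bounded Q s HQ0) as [M [_ HM]]; [lra|].
  exists M. intros z Hz. apply HM. destruct (inD_scal s z ltac:(lra) Hz) as [E _].
  rewrite E. unfold inD in Hz. nra.
Qed.

(** Uses the inclusion of [H0] in [B0]. Dilates of [F] are bounded, hence little-o against nu, and
    satisfy nu |v n| <= 1; their series lies in [H0 nu], so its derivative is controlled, and the
    hump argument is run on the derivatives s F'(s z). *)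
Lemma deriv_bound : exists K, 0 <= K /\ forall r, 0 <= r < 1 ->
  (1 - r ^ 2) * Re (cderiv F (RtoC r)) <= K * Fr r.
Proof.
  pose proof (aw_holo _ _ HA) as HF. pose proof (holo_cderiv F HF) as HF'.
  destruct (gliding_hump (fun r => nu r * (1 - r ^ 2))
    (fun s z => (RtoC s * cderiv F (RtoC s * z))%C)) as [K [HK0 HK]].
  - intros r Hr. apply aw_nu1_le, Hr.
  - intros r Hr. apply (continuous_Re_comp (fun w => w)); [|apply continuous_id].
    apply continuous_Cmult.
    + apply continuous_ext with (fun s => (RtoC s * 1)%C); [intros s; apply Cmult_1_r|].
      apply continuous_ray.
    + apply (continuous_comp (fun s => (RtoC s * RtoC r)%C)); [apply continuous_ray|].
      rewrite Cmult_1_l. apply holo_continuous; [exact HF'|]. apply RtoC_inD, Hr.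
  - intros s r Hs Hr. rewrite re_scal_l, <- RtoC_mult.
    apply Rmult_le_pos; [lra|]. apply aw_F_derive_nonneg. nra.
  - intros rho Hrho. set (v := fun n z => F (RtoC (rho n) * z)%C).
    assert (Dv : forall n z, inD z ->
      cdiff (v n) z (RtoC (rho n) * cderiv F (RtoC (rho n) * z))%C).
    { intros n z Hz. apply cdiff_dilate, holo_cdiff; [exact HF|].
      apply inD_dilate; [|exact Hz]. specialize (Hrho n). lra. }
    assert (Bv : forall n z, inD z -> Cmod (v n z) <= Fr (Cmod z)).
    { intros n z Hz. specialize (Hrho n). apply aw_F_dilate; [lra|exact Hz]. }
    destruct (psum_limit v) as [f [Hf [L1 L2]]].
    { intros n. apply holo_intro. intros z Hz. eexists. apply Dv, Hz. }
    { intros r Hr. exists (Fr (Rmax r 0)). intros n z Hz. pose proof (Rmax_l r 0).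
      assert (Dz : inD z) by (unfold inD; lra).
      eapply Rle_trans; [apply (Bv n z Dz)|].
      apply aw_F_mono; [apply Cmod_ge_0|lra|apply Rmax_lub_lt; lra]. }
    destruct (little_o_bounded (fun r => nu r * (1 - r ^ 2)) (cderiv f) (nu 0)) as [M HM].
    + intros r Hr. pose proof (aw_nu1_le r Hr). pose proof (aw_nu_le r Hr). lra.
    + apply holo_cderiv, Hf.
    + refine (proj2 (proj1 (proj2 HQ f) (conj Hf _))).
      apply (little_o_psum nu v f); [apply (proj1 (aw_weight _ _ HA))| | |exact L1].
      * intros n z Hz. apply (aw_le (v n)); [exact Hz|]. rewrite Rmult_1_l. apply Bv, Hz.
      * intros n. destruct (dilate_bounded F (rho n) HF) as [M0 HM0]; [specialize (Hrho n); lra|].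
        apply aw_little_o_bounded with M0; [|exact HM0].
        intros r Hr. pose proof (aw_nu_le r Hr). lra.
    + exists (cderiv f), M. split; [|exact HM].
      apply (psum_lim_ext (fun n => cderiv (v n))); [|exact L2].
      intros n z Hz. apply cderiv_unique, Dv, Hz.
  - exists K. split; [exact HK0|]. intros r Hr. specialize (HK r Hr).
    rewrite !Cmult_1_l in HK. apply (aw_le_real _ K r Hr). lra.
Qed.

Local Notation Gr := (radial (seg (kern F) 0)).

Lemma kern_real r : 0 <= r < 1 -> kern F (RtoC r) = RtoC (Fr r / (1 - r ^ 2)).
Proof.
  intros Hr. unfold kern. rewrite aw_F_real by exact Hr.
  rewrite RtoC_div by (pose proof (one_minus_sq r Hr); lra).
  rewrite RtoC_minus, RtoC_pow. do 2 f_equal. ring.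
Qed.

Lemma is_RInt_kern r : 0 <= r < 1 ->
  is_RInt (fun t => r * (Fr (t * r) / (1 - (t * r) ^ 2))) 0 1 (Gr r).
Proof.
  intros Hr. assert (Hc : on_seg (fun w => continuous (kern F) w) 0 (RtoC r)).
  { intros t Ht. apply holo_continuous; [apply holo_kern, (aw_holo _ _ HA)|].
    apply inD_convex; [apply inD_0|apply RtoC_inD, Hr|exact Ht]. }
  pose proof (proj1 (proj1 (is_CI_iff _ _ _ _) (is_CI_seg (kern F) 0 (RtoC r) Hc))) as H.
  eapply is_RInt_ext; [|exact H]. rewrite Rmin_left, Rmax_right by lra. intros t Ht. cbv beta.
  replace (0 + RtoC t * (RtoC r - 0))%C with (RtoC (t * r)) by (rewrite RtoC_mult; ring).
  rewrite kern_real by nra.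
  replace (RtoC r - 0)%C with (RtoC r) by ring. rewrite re_scal_r, re_RtoC. apply Rmult_comm.
Qed.

Lemma Gr_nonneg r : 0 <= r < 1 -> 0 <= Gr r.
Proof.
  intros Hr. rewrite <- (is_RInt_unique _ _ _ _ (is_RInt_kern r Hr)).
  apply RInt_ge_0; [lra|eexists; apply is_RInt_kern, Hr|]. intros t Ht.
  assert (H : 0 <= t * r < 1) by nra.
  pose proof (aw_F_pos _ H). pose proof (one_minus_sq _ H).
  apply Rmult_le_pos; [lra|]. apply Rdiv_le_0_compat; lra.
Qed.

(** [Gr] is the integral of the radial majorant, so the comparison is made pointwise along the
    segment from 0 to z. *)
Lemma primitive_growth (d : C -> C) (K : R) (z : C) : holo d -> inD z ->
  (forall w, inD w -> Cmod (d w) <= K * (Fr (Cmod w) / (1 - Cmod w ^ 2))) ->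
  Cmod (seg d 0 z) <= K * Gr (Cmod z).
Proof.
  intros Hd Hz HK.
  assert (Hc : on_seg (fun w => continuous d w) 0 z).
  { intros t Ht. apply holo_continuous; [exact Hd|].
    apply inD_convex; [apply inD_0|exact Hz|exact Ht]. }
  pose proof (inD_range z Hz) as Hr.
  eapply is_CI_norm with (a := 0) (b := 1); [lra| |apply is_CI_seg, Hc|].
  2: { apply (is_RInt_scal (V := R_NormedModule)), is_RInt_kern, Hr. }
  intros t Ht. cbv beta. replace (0 + RtoC t * (z - 0))%C with (RtoC t * z)%C by ring.
  replace (z - 0)%C with z by ring. rewrite Cmod_mult.
  destruct (inD_scal t z Ht Hz) as [E _].
  pose proof (HK _ (inD_dilate t z Ht Hz)) as B. rewrite E in B.
  change (Cmod (d (RtoC t * z)%C) * Cmod z <=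
    K * (Cmod z * (Fr (t * Cmod z) / (1 - (t * Cmod z) ^ 2)))).
  apply Rmult_le_compat_r with (r := Cmod z) in B; [|apply Cmod_ge_0]. lra.
Qed.

(** Uses the opposite inclusion, of [B0] in [H0]. Derivatives of dilates of [G] are bounded and
    dominated by F(|z|)/(1-|z|^2), so their series is little-o against nu (1-r^2), which controls
    the series of the dilates themselves. *)
Lemma primitive_bound : exists K, 0 <= K /\ forall r, 0 <= r < 1 -> Gr r <= K * Fr r.
Proof.
  pose proof (holo_kern F (aw_holo _ _ HA)) as Hk.
  pose proof (holo_primitive _ Hk) as HG. set (G := seg (kern F) 0) in *.
  destruct (gliding_hump nu (fun s z => G (RtoC s * z)%C)) as [K [HK0 HK]].
  - apply (proj1 (aw_weight _ _ HA)).
  - intros r Hr. apply (continuous_Re_comp G (fun s => (RtoC s * RtoC r)%C)); [apply continuous_ray|].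
    rewrite Cmult_1_l. apply holo_continuous; [exact HG|]. apply RtoC_inD, Hr.
  - intros s r Hs Hr. rewrite <- RtoC_mult. apply (Gr_nonneg (s * r)). nra.
  - intros rho Hrho. set (v := fun n z => G (RtoC (rho n) * z)%C).
    assert (Dv : forall n z, inD z -> cdiff (v n) z (RtoC (rho n) * kern F (RtoC (rho n) * z))%C).
    { intros n z Hz. apply cdiff_dilate. apply cdiff_primitive; [exact Hk|].
      apply inD_dilate; [|exact Hz]. specialize (Hrho n). lra. }
    assert (Bk : forall n z, inD z -> Cmod (cderiv (v n) z) <= Cmod (kern F (RtoC (rho n) * z)%C)).
    { intros n z Hz. rewrite (cderiv_unique _ _ _ (Dv n z Hz)). specialize (Hrho n).
      rewrite Cmod_mult, Cmod_R, Rabs_pos_eq by lra.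
      pose proof (Cmod_ge_0 (kern F (RtoC (rho n) * z)%C)). nra. }
    assert (Bv : forall n z, inD z -> Cmod (cderiv (v n) z) <= Fr (Cmod z) / (1 - Cmod z ^ 2)).
    { intros n z Hz. assert (X : 0 <= rho n <= 1) by (specialize (Hrho n); lra).
      pose proof (inD_dilate (rho n) z X Hz) as Dz. destruct (inD_scal (rho n) z X Hz) as [E1 E2].
      eapply Rle_trans; [apply Bk, Hz|]. eapply Rle_trans; [apply Cmod_kern, Dz|].
      rewrite E1. pose proof (one_minus_sq _ (inD_range z Hz)).
      apply Rmult_le_compat; [apply Cmod_ge_0| |apply aw_F_dilate; assumption|].
      - left. apply Rinv_0_lt_compat, one_minus_sq. unfold inD in Hz. lra.
      - apply Rinv_le_contravar; simpl in *; nra. }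
    destruct (psum_limit v) as [f [Hf [L1 L2]]].
    { intros n. apply holo_intro. intros z Hz. eexists. apply Dv, Hz. }
    { intros r Hr. destruct (holo_bounded G r HG Hr) as [M [_ HM]].
      exists M. intros n z Hz. apply HM. specialize (Hrho n).
      rewrite Cmod_mult, Cmod_R, Rabs_pos_eq by lra. pose proof (Cmod_ge_0 z). nra. }
    destruct (little_o_bounded nu f (nu 0)) as [M HM]; [apply aw_nu_le|exact Hf| |exists f, M; tauto].
    refine (proj2 (proj2 (proj2 HQ f) (conj Hf _))).
    apply (little_o_psum (fun r => nu r * (1 - r ^ 2)) (fun n => cderiv (v n)) (cderiv f));
      [| | |exact L2].
    + apply aw_nu1_le.
    + intros n z Hz. pose proof (inD_range z Hz) as Hr.
      pose proof (aw_eq _ Hr) as E. pose proof (one_minus_sq _ Hr).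
      eapply Rle_trans; [apply Rmult_le_compat_l; [|apply (Bv n z Hz)]|].
      * apply aw_nu1_le, Hr.
      * right. rewrite <- E. field. lra.
    + intros n. destruct (dilate_bounded (kern F) (rho n) Hk) as [M0 HM0]; [specialize (Hrho n); lra|].
      apply aw_little_o_bounded with M0; [apply aw_nu1_le|].
      intros z Hz. eapply Rle_trans; [apply Bk, Hz|apply HM0, Hz].
  - exists K. split; [exact HK0|]. intros r Hr. specialize (HK r Hr).
    rewrite Cmult_1_l in HK. apply (aw_le_real _ K r Hr), HK.
Qed.

(** By [deriv_bound], (ln Fr)' <= K/(1-s), so ln Fr + K ln(1-s) does not increase. Passing from r to
    (1+r)/2 halves 1-r and costs 2^K, written exp(K ln 2) because K is real. *)
Lemma aw_doubling : exists K, 0 <= K /\ forall r, 0 <= r < 1 -> Fr ((1 + r) / 2) <= K * Fr r.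
Proof.
  destruct deriv_bound as [K [HK0 HK]]. exists (exp (K * ln 2)). split; [left; apply exp_pos|].
  intros r Hr. set (r' := (1 + r) / 2).
  set (psi := fun s => ln (Fr s) + K * ln (1 - s)).
  assert (D : forall s, r <= s <= r' -> is_derive psi s
            (Re (cderiv F (RtoC s)) / Fr s + K * (-1 / (1 - s)))).
  { intros s Hs. assert (Hs1 : 0 <= s < 1) by (unfold r' in Hs; lra).
    apply (is_derive_plus (K := R_AbsRing) (V := R_NormedModule)).
    - replace (Re (cderiv F (RtoC s)) / Fr s) with (scal (Re (cderiv F (RtoC s))) (/ Fr s))
        by reflexivity.
      apply (is_derive_comp (K := R_AbsRing) (V := R_NormedModule) ln Fr).
      + apply is_derive_Reals. apply derivable_pt_lim_ln, aw_F_pos, Hs1.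
      + apply aw_F_derive, Hs1.
    - apply (is_derive_scal (fun s => ln (1 - s))). auto_derive; [lra|]. field. lra. }
  destruct (mean_value psi (fun s => Re (cderiv F (RtoC s)) / Fr s + K * (-1 / (1 - s))) r r')
    as [c [Hc E]]; [unfold r'; lra|exact D|].
  assert (Hc1 : 0 <= c < 1) by (unfold r' in Hc; lra).
  assert (Q : Re (cderiv F (RtoC c)) / Fr c + K * (-1 / (1 - c)) <= 0).
  { pose proof (aw_F_pos c Hc1) as P1. pose proof (one_minus_sq c Hc1) as P2.
    assert (X : Re (cderiv F (RtoC c)) / Fr c <= K / (1 - c ^ 2)).
    { apply Rmult_le_reg_r with (Fr c * (1 - c ^ 2)); [nra|].
      replace (Re (cderiv F (RtoC c)) / Fr c * (Fr c * (1 - c ^ 2)))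
        with ((1 - c ^ 2) * Re (cderiv F (RtoC c))) by (field; lra).
      replace (K / (1 - c ^ 2) * (Fr c * (1 - c ^ 2))) with (K * Fr c) by (field; lra).
      apply HK, Hc1. }
    assert (Y : K / (1 - c ^ 2) <= K / (1 - c)).
    { apply Rmult_le_compat_l; [exact HK0|]. apply Rinv_le_contravar; simpl; nra. }
    replace (K * (-1 / (1 - c))) with (- (K / (1 - c))) by (field; lra). lra. }
  assert (Hp : psi r' <= psi r) by (unfold r' in *; nra).
  unfold psi in Hp.
  replace (1 - r') with ((1 - r) / 2) in Hp by (unfold r'; field).
  rewrite (ln_div (1 - r) 2) in Hp by lra.
  assert (Hr' : 0 <= r' < 1) by (unfold r'; lra).
  replace (exp (K * ln 2) * Fr r) with (exp (K * ln 2 + ln (Fr r)))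
    by (rewrite exp_plus, exp_ln by (apply aw_F_pos, Hr); reflexivity).
  rewrite <- (exp_ln (Fr r')) by (apply aw_F_pos, Hr').
  apply Rnot_lt_le. intros X. apply exp_lt_inv in X. lra.
Qed.

(** Cauchy's estimate on the disc of radius (1-r)/2 about z, where doubling bounds [Fr] by its value
    at r. The 8 comes from 2/rho = 4/(1-r) <= 8/(1-r^2). *)
Lemma deriv_growth : exists K, 0 <= K /\ forall (f : C -> C) (M : R), holo f ->
  (forall z, inD z -> nu (Cmod z) * Cmod (f z) <= M) ->
  forall z, inD z -> Cmod (cderiv f z) <= K * M * (Fr (Cmod z) / (1 - Cmod z ^ 2)).
Proof.
  destruct aw_doubling as [K [HK0 HK]]. exists (8 * K). split; [lra|].
  intros f M Hf HM z Hz. set (r := Cmod z).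
  assert (Hr : 0 <= r < 1) by (split; [apply Cmod_ge_0|exact Hz]).
  set (rho := (1 - r) / 2). assert (Hrho : 0 < rho) by (unfold rho; lra).
  assert (HM0 : 0 <= M).
  { eapply Rle_trans; [|apply (HM 0%C inD_0)]. rewrite Cmod_0.
    apply Rmult_le_pos; [apply aw_nu_le; lra|apply Cmod_ge_0]. }
  eapply Rle_trans.
  - apply (cauchy_estimate f z rho (M * (K * Fr r)) Hf Hrho); [unfold rho; fold r; lra|].
    intros w Hw.
    assert (Bw : Cmod w <= (1 + r) / 2).
    { pose proof (Cmod_triangle_inv w z). fold r in H. unfold rho in Hw. lra. }
    assert (Dw : inD w) by (unfold inD; lra).
    eapply Rle_trans; [apply (aw_le f M w Dw), HM, Dw|].
    apply Rmult_le_compat_l; [exact HM0|].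
    eapply Rle_trans; [|apply HK, Hr]. apply aw_F_mono; [apply Cmod_ge_0|exact Bw|lra].
  - pose proof (aw_F_pos r Hr) as PF. pose proof (one_minus_sq r Hr) as P1.
    replace (2 * (M * (K * Fr r)) / rho) with (K * M * Fr r * (2 / rho)) by (field; lra).
    replace (8 * K * M * (Fr r / (1 - r ^ 2))) with (K * M * Fr r * (8 / (1 - r ^ 2)))
      by (field; lra).
    apply Rmult_le_compat_l; [repeat apply Rmult_le_pos; lra|].
    replace (2 / rho) with (4 * / (1 - r)) by (unfold rho; field; lra).
    replace (8 / (1 - r ^ 2)) with (4 * (2 * / (1 - r ^ 2))) by (field; lra).
    apply Rmult_le_compat_l; [lra|].
    apply Rmult_le_reg_r with ((1 - r) * (1 - r ^ 2)); [nra|].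
    replace (/ (1 - r) * ((1 - r) * (1 - r ^ 2))) with (1 - r ^ 2) by (field; lra).
    replace (2 * / (1 - r ^ 2) * ((1 - r) * (1 - r ^ 2))) with (2 * (1 - r)) by (field; lra).
    simpl. nra.
Qed.

(** * Sufficiency of the limit condition *)

Variables (mu : R -> R) (g : C -> C).
Hypothesis Hmu : weight mu.
Hypothesis Hg : holo g.

Lemma continuous_weight_ray theta r : 0 <= r < 1 ->
  continuous (fun r => Cmod (g (polar r theta)) * (Fr r / (1 - r ^ 2))) r.
Proof.
  intros Hr. apply (continuous_mult (K := R_AbsRing)).
  - apply continuous_Cmod. apply (continuous_comp (fun r => polar r theta) g).
    + apply continuous_polar.
    + apply holo_continuous; [exact Hg|apply inD_polar, Hr].
  - apply (continuous_mult (K := R_AbsRing) Fr (fun r => / (1 - r ^ 2))).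
    + eapply derive_continuous, (aw_F_derive r Hr).
    + apply (ex_derive_continuous (K := R_AbsRing) (V := R_NormedModule)).
      pose proof (one_minus_sq r Hr). auto_derive. simpl in *. lra.
Qed.

Lemma is_RInt_weight_ray theta t2 R : 0 <= t2 <= R -> R < 1 ->
  is_RInt (fun r => Cmod (g (polar r theta)) * (Fr r / (1 - r ^ 2))) t2 R
    (RInt (fun r => Cmod (g (polar r theta)) / ((1 - r ^ 2) * nu r)) t2 R).
Proof.
  intros H1 H2.
  rewrite (RInt_ext (fun r => Cmod (g (polar r theta)) / ((1 - r ^ 2) * nu r))
    (fun r => Cmod (g (polar r theta)) * (Fr r / (1 - r ^ 2)))).
  - apply (RInt_correct (V := R_CompleteNormedModule)).
    apply (ex_RInt_continuous (V := R_CompleteNormedModule)).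
    rewrite Rmin_left, Rmax_right by lra. intros r Hr. apply continuous_weight_ray. lra.
  - rewrite Rmin_left, Rmax_right by lra. intros r Hr.
    rewrite aw_F_inv by lra.
    pose proof (one_minus_sq r ltac:(lra)). pose proof (aw_nu_pos r ltac:(lra)).
    change (@eq Rdefinitions.R (Cmod (g (polar r theta)) / ((1 - r ^ 2) * nu r))
      (Cmod (g (polar r theta)) * (/ nu r / (1 - r ^ 2)))).
    field. lra.
Qed.

Lemma mu_le r : 0 <= r < 1 -> 0 <= mu r <= mu 0.
Proof.
  intros Hr. split; [apply (proj1 Hmu), Hr|]. apply (proj2 (proj2 Hmu)); lra.
Qed.

(** The full bound [M] enters only with the small factor eps; the large constant multiplies the size
    of f' on a fixed compact disc, which a locally uniform limit makes small. Up to radius t2 the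
    integral is bounded by D, and beyond it by [deriv_growth] and the limit condition. *)
Lemma Sg_estimate : limit_condition g nu mu -> forall eps, 0 < eps ->
  exists b K, b < 1 /\ 0 <= K /\ forall (f : C -> C) (M D : R), holo f -> 0 <= M -> 0 <= D ->
    (forall z, inD z -> nu (Cmod z) * Cmod (f z) <= M) ->
    (forall z, Cmod z <= b -> Cmod (cderiv f z) <= D) ->
    forall z, inD z -> mu (Cmod z) * Cmod (Sg g f z) <= K * D + eps * M.
Proof.
  intros HL eps He. destruct deriv_growth as [K1 [HK1 HK]].
  assert (He' : 0 < eps / (K1 + 1)) by (apply Rdiv_lt_0_compat; lra).
  destruct (HL _ He') as [a [Ha H2]]. set (t2 := (a + 1) / 2).
  destruct (H2 t2) as [b [Hb H1]]; [unfold t2; lra|].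
  destruct (holo_bounded g b Hg) as [Gb [HG0 HGb]]; [lra|].
  pose proof (mu_le 0 ltac:(lra)) as Hmu0.
  exists b, (mu 0 * Gb). split; [lra|]. split; [apply Rmult_le_pos; lra|].
  intros f M D Hf HM HD Hfm Hfd z Hz.
  set (k := fun w => (cderiv f w * g w)%C).
  assert (Hk : holo k) by (apply holo_mult; [apply holo_cderiv, Hf|exact Hg]).
  assert (Hkb : forall w, Cmod w <= b -> Cmod (k w) <= D * Gb).
  { intros w Hw. unfold k. rewrite Cmod_mult.
    apply Rmult_le_compat; try apply Cmod_ge_0; auto. }
  pose proof (inD_range z Hz) as Hr.
  pose proof (mu_le _ Hr) as Hm.
  assert (HDG : 0 <= D * Gb) by (apply Rmult_le_pos; lra).
  rewrite Sg_seg. fold k.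
  destruct (Rle_lt_dec (Cmod z) b) as [Hzb|Hzb].
  - assert (B : Cmod (seg k 0 z) <= D * Gb * Cmod z).
    { apply seg_bound; [exact Hk|exact Hz|]. intros w Hw. apply Hkb. lra. }
    assert (B2 : Cmod (seg k 0 z) <= D * Gb) by nra.
    apply Rle_trans with (mu 0 * (D * Gb)).
    + apply Rmult_le_compat; try lra. apply Cmod_ge_0.
    + assert (0 <= eps * M) by (apply Rmult_le_pos; lra). lra.
  - destruct (polar_exists z) as [theta [Hth Ez]]. set (r := Cmod z) in *.
    assert (Ht2 : 0 <= t2) by (unfold t2; lra).
    pose proof (seg_ray k r theta Hk Hr) as I0. rewrite <- Ez in I0.
    assert (I1 : is_CI (fun s => (k (polar s theta) * polar 1 theta)%C) 0 t2
                   (seg k 0 (polar t2 theta))) by (apply seg_ray; [exact Hk|lra]).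
    assert (I2 : is_CI (fun s => (k (polar s theta) * polar 1 theta)%C) t2 r
                   (seg k 0 z - seg k 0 (polar t2 theta))%C).
    { replace (seg k 0 z - seg k 0 (polar t2 theta))%C
        with (- seg k 0 (polar t2 theta) + seg k 0 z)%C by ring.
      apply (is_RInt_Chasles (V := C_R_NormedModule) _ t2 0 r); [|exact I0].
      apply (is_RInt_swap (V := C_R_NormedModule)), I1. }
    assert (B1 : Cmod (seg k 0 (polar t2 theta)) <= D * Gb).
    { assert (X : Cmod (seg k 0 (polar t2 theta)) <= D * Gb * t2).
      { rewrite <- (Cmod_polar t2 theta) at 2 by exact Ht2.
        apply seg_bound; [exact Hk|apply inD_polar; lra|]. intros w Hw.
        rewrite Cmod_polar in Hw by exact Ht2. apply Hkb. lra. }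
      nra. }
    assert (B2 : Cmod (seg k 0 z - seg k 0 (polar t2 theta)) <=
      K1 * M * RInt (fun s => Cmod (g (polar s theta)) / ((1 - s ^ 2) * nu s)) t2 r).
    { eapply is_CI_norm; [|  |exact I2|
        apply (is_RInt_scal (V := R_NormedModule)), is_RInt_weight_ray; lra]; [lra|].
      intros s Hs. cbv beta. unfold k. rewrite !Cmod_mult, (Cmod_polar 1) by lra.
      rewrite Rmult_1_r.
      change (Cmod (cderiv f (polar s theta)) * Cmod (g (polar s theta)) <=
        K1 * M * (Cmod (g (polar s theta)) * (Fr s / (1 - s ^ 2)))).
      pose proof (HK f M Hf Hfm (polar s theta) ltac:(apply inD_polar; lra)) as X.
      rewrite Cmod_polar in X by lra.
      apply Rmult_le_compat_r with (r := Cmod (g (polar s theta))) in X; [|apply Cmod_ge_0].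
      lra. }
    specialize (H1 r ltac:(lra) theta Hth).
    set (J := RInt (fun s => Cmod (g (polar s theta)) / ((1 - s ^ 2) * nu s)) t2 r) in *.
    assert (B3 : Cmod (seg k 0 z) <= D * Gb + K1 * M * J).
    { replace (seg k 0 z) with (seg k 0 (polar t2 theta) + (seg k 0 z - seg k 0 (polar t2 theta)))%C
        by ring. eapply Rle_trans; [apply Cmod_triangle|]. lra. }
    apply Rle_trans with (mu r * (D * Gb) + K1 * M * (mu r * J)).
    { apply Rle_trans with (mu r * (D * Gb + K1 * M * J)); [apply Rmult_le_compat_l; lra|lra]. }
    assert (X1 : mu r * (D * Gb) <= mu 0 * (D * Gb)) by (apply Rmult_le_compat_r; lra).
    assert (X2 : K1 * M * (mu r * J) <= K1 * M * (eps / (K1 + 1)))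
      by (apply Rmult_le_compat_l; [apply Rmult_le_pos; lra|exact H1]).
    assert (X3 : K1 * M * (eps / (K1 + 1)) <= eps * M).
    { replace (K1 * M * (eps / (K1 + 1))) with (K1 * (eps * M) / (K1 + 1)) by (field; lra).
      apply Rle_div_l; [lra|].
      assert (0 <= eps * M) by (apply Rmult_le_pos; lra). lra. }
    lra.
Qed.

Lemma sufficiency : limit_condition g nu mu -> Sg_compact g nu mu.
Proof.
  intros HL.
  assert (HB : forall f, Hinf nu f -> Hinf mu (Sg g f)).
  { intros f [Hf [M HM]]. split; [apply holo_Sg; assumption|].
    (* For boundedness alone any fixed eps will do. *)
    destruct (Sg_estimate HL 1 Rlt_0_1) as [b [K [Hb [HK0 H]]]].
    destruct (cderiv_bounded f b Hf Hb) as [D [HD0 HD]].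
    exists (K * D + 1 * Rmax M 0). intros z Hz. apply H; try assumption.
    - apply Rmax_r.
    - intros w Hw. eapply Rle_trans; [apply HM, Hw|apply Rmax_l]. }
  split; [exact HB|].
  intros fs Hfs [M0 HM0]. set (M := Rmax M0 0).
  assert (HMp : 0 <= M) by apply Rmax_r.
  assert (HM : forall n z, inD z -> nu (Cmod z) * Cmod (fs n z) <= M).
  { intros n z Hz. eapply Rle_trans; [apply HM0, Hz|apply Rmax_l]. }
  destruct (montel fs) as [phi [Hphi Hc]].
  { intros n. apply Hfs. }
  { intros r Hr. exists (M * Fr (Rmax r 0)). intros n z Hz.
    assert (Dz : inD z) by (unfold inD; lra).
    eapply Rle_trans; [apply (aw_le (fs n) M z Dz), HM, Dz|].
    apply Rmult_le_compat_l; [exact HMp|]. pose proof (Rmax_l r 0).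
    apply aw_F_mono; [apply Cmod_ge_0|lra|apply Rmax_lub_lt; lra]. }
  destruct (weierstrass (fun n => fs (phi n))) as [f [Hf [L1 L2]]]; [intros n; apply Hfs|exact Hc|].
  exists phi. split; [exact Hphi|].
  assert (HfM : forall z, inD z -> nu (Cmod z) * Cmod (f z) <= M).
  { intros z Hz. apply (aw_le f M z Hz).
    replace (f z) with (f z - 0)%C by ring.
    apply (C_lim_le (fun n => fs (phi n) z) (f z) 0 _ 0 (unif_lim_at _ f z L1 Hz)).
    intros n _. replace (fs (phi n) z - 0)%C with (fs (phi n) z) by ring.
    apply (aw_le _ M z Hz), HM, Hz. }
  exists (Sg g f). split; [apply HB; split; [exact Hf|exists M; exact HfM]|].
  intros eps He.
  (* The difference of two functions with bound M has bound 2M; each of the two terms of the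
     estimate is to cost at most eps/2. *)
  destruct (Sg_estimate HL (eps / (2 * (2 * M + 1)))) as [b [K [Hb [HK0 H]]]];
    [apply Rdiv_lt_0_compat; lra|].
  destruct (L2 b (eps / (2 * (K + 1))) Hb) as [N HN]; [apply Rdiv_lt_0_compat; lra|].
  exists N. intros n Hn z Hz.
  rewrite Sg_minus; [|exact Hg|apply Hfs|exact Hf|exact Hz].
  eapply Rle_trans.
  - apply (H (fun w => (fs (phi n) w - f w)%C) (2 * M) (eps / (2 * (K + 1)))).
    + apply holo_minus; [apply Hfs|exact Hf].
    + lra.
    + apply Rdiv_le_0_compat; lra.
    + intros w Hw. pose proof (HM (phi n) w Hw) as A1. pose proof (HfM w Hw) as A2.
      pose proof (Cmod_triangle_minus (fs (phi n) w) (f w)) as T.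
      assert (0 <= nu (Cmod w)) by (apply aw_nu_le; split; [apply Cmod_ge_0|exact Hw]).
      nra.
    + intros w Hw. rewrite cderiv_minus; [apply HN; assumption|apply Hfs|exact Hf|unfold inD; lra].
    + exact Hz.
  - assert (Y1 : K * (eps / (2 * (K + 1))) <= eps / 2).
    { replace (K * (eps / (2 * (K + 1)))) with (K * eps / (2 * (K + 1))) by (field; lra).
      apply Rle_div_l; nra. }
    assert (Y2 : eps / (2 * (2 * M + 1)) * (2 * M) <= eps / 2).
    { replace (eps / (2 * (2 * M + 1)) * (2 * M)) with (eps * (2 * M) / (2 * (2 * M + 1)))
        by (field; lra). apply Rle_div_l; nra. }
    lra.
Qed.

(** * Necessity of the limit condition *)

Variables (h : C -> C) (B : R).
Hypothesis Hh : holo h.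
Hypothesis Hgh : forall z, inD z -> cexp (h z) = g z.
Hypothesis HB0 : 0 <= B.
Hypothesis HB : forall z, inD z -> (1 - Cmod z ^ 2) * Cmod (cderiv h z) <= B.

(* The phases undo the argument of g at the nodes; between nodes it moves by at most 1. *)
Lemma phase_comb : exists lam m c0 C0, 1 < lam /\ 0 < c0 /\ 0 <= C0 /\
  forall theta t1, 0 <= t1 < 1 -> exists N c,
    (forall k : nat, Cmod (c k) = 1) /\
    (forall z, inD z -> Cmod (comb lam m N c z) <= C0) /\
    forall r, 0 <= r <= t1 ->
      c0 * Cmod (g (polar r theta)) <= Re (comb lam m N c (RtoC r) * g (polar r theta))%C.
Proof.
  (* Within a factor lam the phase moves by at most (B/2) ln lam = B/(B+1) <= 1, and the cosine of
     such an angle is at least 1/2. *)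
  set (sg := exp (1 / (B + 1))). set (lam := sg * sg).
  assert (Hs0 : 0 < 1 / (B + 1)) by (apply Rdiv_lt_0_compat; lra).
  assert (Hs : 1 < sg) by (apply exp_increasing in Hs0; rewrite exp_0 in Hs0; exact Hs0).
  assert (Hl : 1 < lam) by (unfold lam; nra).
  assert (Hln : B / 2 * ln lam <= 1).
  { unfold lam. rewrite ln_mult by lra. unfold sg. rewrite ln_exp.
    replace (B / 2 * (1 / (B + 1) + 1 / (B + 1))) with (B / (B + 1)) by (field; lra).
    apply Rle_div_l; lra. }
  destruct (bump_exponent sg Hs) as [m [c0 [Hc0 Hm]]]. fold lam in Hm.
  pose proof (inv_lt_1 lam Hl) as Hi.
  exists lam, m, c0, (2 ^ S m * (4 / (1 - / lam))).
  split; [exact Hl|]. split; [exact Hc0|].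
  split; [apply Rmult_le_pos; [apply pow_le; lra|apply Rdiv_le_0_compat; lra]|].
  intros theta t1 HR.
  set (al := fun s => Im (h (polar s theta))).
  set (c := fun k => (cos (al (node lam k)), - sin (al (node lam k))) : C).
  (* Enough nodes to cover [0, t1]; this is the only choice that depends on [t1]. *)
  destruct (Pow_x_infinity lam) with (b := (1 + t1) / (1 - t1)) as [N HN];
    [rewrite Rabs_pos_eq; lra|].
  specialize (HN N (le_n N)). rewrite Rabs_pos_eq in HN by (apply pow_le; lra).
  assert (Hc : forall k, Cmod (c k) = 1).
  { intros k. unfold c, Cmod. simpl. pose proof (sin2_cos2 (al (node lam k))) as S.
    unfold Rsqr in S.
    match goal with |- sqrt ?e = 1 => replace e with 1 by lra end. apply sqrt_1. }
  exists N, c. split; [exact Hc|]. split.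
  { intros z Hz. apply comb_bound; assumption. }
  intros r Hr. set (t := (1 + r) / (1 - r)).
  assert (Hr1 : 0 <= r < 1) by lra.
  assert (Ht1 : 1 <= t).
  { apply Rle_div_r; lra. }
  assert (Ht2 : t <= lam ^ N).
  { apply Rle_trans with ((1 + t1) / (1 - t1)); [|lra]. unfold t.
    apply Rmult_le_compat; [lra|left; apply Rinv_0_lt_compat; lra|lra|].
    apply Rinv_le_contravar; lra. }
  assert (Gp : g (polar r theta) =
    (RtoC (Cmod (g (polar r theta))) * (cos (al r), sin (al r)))%C).
  { rewrite <- Hgh by (apply inD_polar, Hr1). rewrite Cmod_cexp. unfold cexp, al.
    apply injective_projections; simpl; ring. }
  set (G := Cmod (g (polar r theta))) in *.
  assert (HG : 0 <= G) by apply Cmod_ge_0.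
  assert (E : Re (comb lam m N c (RtoC r) * g (polar r theta))%C =
    G * rsum (fun k => cos (al r - al (node lam k)) * bump (t * (/ lam) ^ k) ^ S m) (S N)).
  { rewrite Gp. unfold comb.
    rewrite Cmult_comm, csum_scal, Re_csum, <- rsum_scal.
    assert (X : forall u v n, (forall k, u k = v k) -> rsum u n = rsum v n).
    { intros u v n H. induction n; simpl; [reflexivity|]. rewrite IHn, H. reflexivity. }
    apply X. intros k. rewrite peak_real by (first [apply node_range, Hl | exact Hr1]).
    rewrite node_ratio by exact Hl. fold t.
    replace (t / lam ^ k) with (t * (/ lam) ^ k) by (rewrite pow_inv; reflexivity).
    rewrite <- RtoC_pow. rewrite Cmult_assoc, re_scal_r, <- Cmult_assoc, re_scal_l.
    rewrite cos_minus. unfold c, Re. simpl. ring. }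
  rewrite E. rewrite (Rmult_comm c0). apply Rmult_le_compat_l; [exact HG|].
  eapply Rle_trans; [exact Hm|].
  apply (bump_weighted_sum lam sg t (fun k => cos (al r - al (node lam k))) m N); try assumption.
  - reflexivity.
  - intros k. apply COS_bound.
  - intros k Hk. apply cos_half. eapply Rle_trans; [|exact Hln].
    apply (Im_lip_ratio h B theta (node lam k) r (t * (/ lam) ^ k) lam); try assumption.
    + apply node_range, Hl.
    + rewrite node_ratio by exact Hl. rewrite pow_inv. reflexivity.
Qed.

(** The order of quantifiers is the point: both constants come before n, the ray and the interval,
    so the functions form a bounded family. Only t2^n is lost in the lower bound. *)
Lemma test_function : exists c0 C0, 0 < c0 /\ 0 <= C0 /\
  forall (n : nat) theta t2 t1, 0 <= t2 <= t1 -> t1 < 1 -> exists f, holo f /\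
    (forall z, inD z -> nu (Cmod z) * Cmod (f z) <= C0) /\
    (forall z, inD z -> Cmod (cderiv f z) <= Cmod z ^ n * (C0 * (Fr (Cmod z) / (1 - Cmod z ^ 2)))) /\
    c0 * t2 ^ n * RInt (fun r => Cmod (g (polar r theta)) / ((1 - r ^ 2) * nu r)) t2 t1 <=
      Cmod (Sg g f (polar t1 theta)).
Proof.
  destruct phase_comb as (lam & m & c0 & C1 & Hl & Hc0 & HC1 & HP).
  destruct primitive_bound as [K [HK0 HK]].
  (* The part C1 K bounds the function through [primitive_bound], the part C1 its derivative. *)
  exists c0, (C1 * (K + 1)). split; [exact Hc0|]. split; [apply Rmult_le_pos; lra|].
  intros n theta t2 t1 Ht2 HR.
  destruct (HP theta t1 ltac:(lra)) as (N & c & Hc & HT & HL). clear HP.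
  set (T := comb lam m N c) in *.
  set (w := polar 1 (- theta)).
  assert (Hw : Cmod w = 1) by (apply Cmod_polar; lra).
  set (k := fun z => (z ^ n * kern F z * T z)%C).
  assert (Hk : holo k).
  { apply holo_mult; [apply holo_mult|].
    - apply (holo_pow (fun z => z)), holo_id.
    - apply holo_kern, (aw_holo _ _ HA).
    - apply holo_comb, Hl. }
  set (d := fun z => k (w * z)%C).
  assert (Hwz : forall z, Cmod (w * z) = Cmod z).
  { intros z. rewrite Cmod_mult, Hw. ring. }
  assert (Hd : holo d).
  { apply holo_intro. intros z Hz. eexists. apply (cdiff_dilate k w).
    apply holo_cdiff; [exact Hk|]. unfold inD. rewrite Hwz. exact Hz. }
  assert (Bd : forall z, inD z ->
    Cmod (d z) <= Cmod z ^ n * (C1 * (Fr (Cmod z) / (1 - Cmod z ^ 2)))).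
  { intros z Hz. unfold d, k.
    assert (Dw : inD (w * z)%C) by (unfold inD; rewrite Hwz; exact Hz).
    pose proof (inD_range z Hz) as Hr.
    rewrite !Cmod_mult, Cmod_pow, Hwz, Rmult_assoc.
    apply Rmult_le_compat_l; [apply pow_le, Cmod_ge_0|]. rewrite Rmult_comm.
    apply Rmult_le_compat; try apply Cmod_ge_0; [apply HT, Dw|].
    eapply Rle_trans; [apply Cmod_kern, Dw|]. rewrite Hwz.
    apply Rmult_le_compat_r; [left; apply Rinv_0_lt_compat, one_minus_sq, Hr|].
    pose proof (aw_F_max _ Dw) as X. rewrite Hwz in X. exact X. }
  assert (Kpos : forall r, 0 <= r < 1 -> 0 <= Fr r / (1 - r ^ 2)).
  { intros r Hr. pose proof (aw_F_pos r Hr). pose proof (one_minus_sq r Hr).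
    apply Rdiv_le_0_compat; lra. }
  exists (seg d 0). split; [apply holo_primitive, Hd|].
  assert (Ed : forall z, inD z -> cderiv (seg d 0) z = d z).
  { intros z Hz. apply cderiv_unique, cdiff_primitive; assumption. }
  split; [|split].
  - intros z Hz. pose proof (inD_range z Hz) as Hr.
    apply (aw_le (seg d 0)); [exact Hz|].
    eapply Rle_trans; [apply (primitive_growth d C1 z Hd Hz)|].
    + intros v Hv. pose proof (inD_range v Hv) as Hrv.
      eapply Rle_trans; [apply Bd, Hv|].
      assert (P : Cmod v ^ n <= 1).
      { apply Rle_trans with (1 ^ n); [apply pow_incr; lra|rewrite pow1; lra]. }
      assert (0 <= C1 * (Fr (Cmod v) / (1 - Cmod v ^ 2))) by (apply Rmult_le_pos; auto).
      nra.
    + rewrite Rmult_assoc. apply Rmult_le_compat_l; [exact HC1|].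
      specialize (HK _ Hr). pose proof (aw_F_pos _ Hr). lra.
  - intros z Hz. pose proof (inD_range z Hz) as Hr.
    rewrite Ed by exact Hz. eapply Rle_trans; [apply Bd, Hz|].
    apply Rmult_le_compat_l; [apply pow_le, Cmod_ge_0|].
    apply Rmult_le_compat_r; [apply Kpos, Hr|]. nra.
  - assert (Hwp : forall r, (w * polar r theta)%C = RtoC r).
    { intros r. unfold w, polar. rewrite cos_neg, sin_neg.
      pose proof (sin2_cos2 theta) as S. unfold Rsqr in S.
      apply injective_projections; simpl; [|ring].
      transitivity (r * (sin theta * sin theta + cos theta * cos theta)); [ring|].
      rewrite S. ring. }
    assert (HR0 : 0 <= t1 < 1) by lra.
    rewrite Sg_seg.
    pose proof (seg_ray (fun z => (cderiv (seg d 0) z * g z)%C) t1 theta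
      (holo_mult _ _ (holo_cderiv _ (holo_primitive _ Hd)) Hg) HR0) as I0.
    set (S := seg (fun z => (cderiv (seg d 0) z * g z)%C) 0 (polar t1 theta)) in *.
    (* The unimodular factor [w] cancels the direction of the ray in dz, so the real part sees Re(T
       g) times a positive kernel. *)
    apply (is_CI_scal w) in I0. apply is_CI_iff in I0. destruct I0 as [I0 _].
    set (q := fun r => r ^ n * (Fr r / (1 - r ^ 2)) * Re (T (RtoC r) * g (polar r theta))%C).
    assert (I1 : is_RInt q 0 t1 (Re (w * S)%C)).
    { eapply is_RInt_ext; [|exact I0]. rewrite Rmin_left, Rmax_right by lra. intros r Hr. cbv beta.
      rewrite Ed by (apply inD_polar; lra). unfold d. rewrite Hwp. unfold k.
      rewrite (kern_real r) by lra. rewrite <- RtoC_pow.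
      replace (w * (RtoC (r ^ n) * RtoC (Fr r / (1 - r ^ 2)) * T (RtoC r) * g (polar r theta) * polar 1 theta))%C
        with (RtoC (r ^ n) * RtoC (Fr r / (1 - r ^ 2)) * (T (RtoC r) * g (polar r theta)) * (w * polar 1 theta))%C by ring.
      rewrite Hwp, Cmult_1_r, <- RtoC_mult, re_scal_l. reflexivity. }
    assert (q0 : forall r, 0 <= r <= t1 ->
      r ^ n * (c0 * (Cmod (g (polar r theta)) * (Fr r / (1 - r ^ 2)))) <= q r).
    { intros r Hr. unfold q. specialize (HL r Hr). specialize (Kpos r ltac:(lra)).
      assert (P : 0 <= r ^ n) by (apply pow_le; lra).
      replace (r ^ n * (c0 * (Cmod (g (polar r theta)) * (Fr r / (1 - r ^ 2)))))
        with (r ^ n * (Fr r / (1 - r ^ 2)) * (c0 * Cmod (g (polar r theta)))) by ring.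
      apply Rmult_le_compat_l; [apply Rmult_le_pos; assumption|exact HL]. }
    assert (Wpos : forall r, 0 <= r <= t1 ->
      0 <= c0 * (Cmod (g (polar r theta)) * (Fr r / (1 - r ^ 2)))).
    { intros r Hr. specialize (Kpos r ltac:(lra)).
      apply Rmult_le_pos; [lra|]. apply Rmult_le_pos; [apply Cmod_ge_0|exact Kpos]. }
    assert (Ex : ex_RInt q 0 t1) by (eexists; exact I1).
    assert (Ex1 : ex_RInt q 0 t2) by (apply (ex_RInt_Chasles_1 (V := R_CompleteNormedModule)) with t1; [lra|exact Ex]).
    assert (Ex2 : ex_RInt q t2 t1) by (apply (ex_RInt_Chasles_2 (V := R_CompleteNormedModule)) with 0; [lra|exact Ex]).
    pose proof (RInt_Chasles (V := R_CompleteNormedModule) q 0 t2 t1 Ex1 Ex2) as Ch.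
    rewrite (is_RInt_unique _ _ _ _ I1) in Ch.
    change (RInt q 0 t2 + RInt q t2 t1 = Re (w * S)%C) in Ch.
    (* The integrand is non-negative on the whole of [0, t1], so the piece before t2 may be dropped;
       after t2 one has r^n >= t2^n. *)
    assert (J1 : 0 <= RInt q 0 t2).
    { apply RInt_ge_0; [lra|exact Ex1|]. intros r Hr. eapply Rle_trans; [|apply q0; lra].
      apply Rmult_le_pos; [apply pow_le; lra|apply Wpos; lra]. }
    set (J := RInt (fun r => Cmod (g (polar r theta)) / ((1 - r ^ 2) * nu r)) t2 t1).
    pose proof (is_RInt_weight_ray theta t2 t1 Ht2 HR) as IJ. fold J in IJ.
    assert (J2 : c0 * t2 ^ n * J <= RInt q t2 t1).
    { apply (is_RInt_scal (V := R_NormedModule) _ _ _ (c0 * t2 ^ n)) in IJ.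
      rewrite <- (is_RInt_unique _ _ _ _ IJ : _ = c0 * t2 ^ n * J).
      apply RInt_le; [lra|eexists; exact IJ|exact Ex2|]. intros r Hr.
      eapply Rle_trans; [|apply q0; lra].
      change (c0 * t2 ^ n * (Cmod (g (polar r theta)) * (Fr r / (1 - r ^ 2))) <=
        r ^ n * (c0 * (Cmod (g (polar r theta)) * (Fr r / (1 - r ^ 2))))).
      assert (P : t2 ^ n <= r ^ n) by (apply pow_incr; lra).
      specialize (Wpos r ltac:(lra)). nra. }
    assert (E : Re (w * S)%C <= Cmod S).
    { eapply Rle_trans; [apply Rle_abs|]. eapply Rle_trans; [apply re_le_Cmod|].
      rewrite Hwz. lra. }
    lra.
Qed.

(** Pointwise decay is enough: it serves to identify the limit that compactness supplies. *)
Lemma Sg_pointwise_0 (fs : nat -> C -> C) (C0 : R) (z : C) :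
  (forall n, holo (fs n)) -> 0 <= C0 -> inD z ->
  (forall n w, inD w -> Cmod (cderiv (fs n) w) <=
     Cmod w ^ n * (C0 * (Fr (Cmod w) / (1 - Cmod w ^ 2)))) ->
  forall eps, 0 < eps -> exists N, forall n, (N <= n)%nat -> Cmod (Sg g (fs n) z) < eps.
Proof.
  intros Hf HC Hz Hb eps He.
  pose proof (inD_range z Hz) as Hr.
  set (r := Cmod z) in *.
  destruct (holo_bounded g r Hg) as [G [HG0 HG]]; [lra|].
  set (K := C0 * (Fr r / (1 - r ^ 2)) * G).
  pose proof (aw_F_pos r Hr) as PF. pose proof (one_minus_sq r Hr) as P1.
  assert (HK : 0 <= K).
  { apply Rmult_le_pos; [apply Rmult_le_pos; [lra|apply Rdiv_le_0_compat; lra]|exact HG0]. }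
  assert (Be : forall n, Cmod (Sg g (fs n) z) <= r ^ n * K).
  { intros n. rewrite Sg_seg.
    assert (Pn : 0 <= r ^ n) by (apply pow_le; lra).
    apply Rle_trans with (r ^ n * K * r); [|assert (0 <= r ^ n * K) by (apply Rmult_le_pos; assumption); nra].
    apply seg_bound; [apply holo_mult; [apply holo_cderiv, Hf|exact Hg]|exact Hz|].
    fold r. intros w Hw. rewrite Cmod_mult. unfold K. rewrite <- Rmult_assoc.
    apply Rmult_le_compat; try apply Cmod_ge_0; [|apply HG, Hw].
    pose proof (Cmod_ge_0 w) as Pw.
    eapply Rle_trans; [apply Hb; unfold inD; lra|].
    assert (Q : 0 < 1 - r ^ 2 <= 1 - Cmod w ^ 2) by (simpl in *; nra).
    pose proof (aw_F_pos (Cmod w) ltac:(lra)) as Pfw.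
    pose proof (aw_F_mono (Cmod w) r Pw Hw ltac:(lra)) as Mo.
    apply Rmult_le_compat; [apply pow_le, Pw| |apply pow_incr; lra|].
    - apply Rmult_le_pos; [exact HC|]. apply Rdiv_le_0_compat; lra.
    - apply Rmult_le_compat_l; [exact HC|]. apply Rmult_le_compat; [lra| |exact Mo|].
      + left. apply Rinv_0_lt_compat. lra.
      + apply Rinv_le_contravar; lra. }
  assert (He' : 0 < eps / (K + 1)) by (apply Rdiv_lt_0_compat; lra).
  destruct (pow_small r _ Hr He') as [N HN]. exists N. intros n Hn. specialize (HN n Hn).
  eapply Rle_lt_trans; [apply Be|].
  assert (Pn : 0 <= r ^ n) by (apply pow_le; lra).
  apply Rle_lt_trans with (r ^ n * (K + 1)); [nra|].
  apply Rmult_lt_compat_r with (r := K + 1) in HN; [|lra].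
  replace (eps / (K + 1) * (K + 1)) with eps in HN by (field; lra). exact HN.
Qed.

Lemma necessity : Sg_compact g nu mu -> limit_condition g nu mu.
Proof.
  intros [_ HC]. apply NNPP. intros HN.
  destruct test_function as (c0 & C0 & Hc0 & HC0 & HT).
  apply not_all_ex_not in HN. destruct HN as [eps HN].
  apply imply_to_and in HN. destruct HN as [He HN].
  assert (HN' : forall a, 0 <= a < 1 -> exists t2, a < t2 < 1 /\ exists t1, t2 < t1 < 1 /\
    exists theta, eps < mu t1 *
      RInt (fun r => Cmod (g (polar r theta)) / ((1 - r ^ 2) * nu r)) t2 t1).
  { intros a Ha. apply NNPP. intros H. apply HN. exists a. split; [exact Ha|].
    (* Choosing b = t2 in the limit condition, its failure yields t1 > t2 beyond every a. *)
    intros t2 Ht2. exists t2. split; [lra|]. intros t1 Ht1 theta Hth.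
    apply Rnot_lt_le. intros X. apply H. exists t2. split; [exact Ht2|].
    exists t1. split; [lra|]. exists theta. exact X. }
  assert (HS : forall n : nat, exists p : (C -> C) * C, holo (fst p) /\ inD (snd p) /\
    (forall z, inD z -> nu (Cmod z) * Cmod (fst p z) <= C0) /\
    (forall z, inD z -> Cmod (cderiv (fst p) z) <=
       Cmod z ^ n * (C0 * (Fr (Cmod z) / (1 - Cmod z ^ 2)))) /\
    c0 * eps / 2 < mu (Cmod (snd p)) * Cmod (Sg g (fst p) (snd p))).
  (* The interval is chosen after n, so close to 1 that t2^n >= 1/2: the factor z^n then costs only
     a constant. *)
  { intros n. destruct (near_one (fun s => s ^ n)) as [a [Ha1 Ha2]].
    - apply (ex_derive_continuous (K := R_AbsRing) (V := R_NormedModule)). auto_derive. exact I.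
    - rewrite pow1. lra.
    - rewrite pow1 in Ha2.
      destruct (HN' a ltac:(lra)) as (t2 & Ht2 & t1 & Ht1 & theta & HJ).
      destruct (HT n theta t2 t1 ltac:(lra) ltac:(lra)) as (f & Hf & F1 & F2 & F3).
      exists (f, polar t1 theta). simpl. split; [exact Hf|]. split; [apply inD_polar; lra|].
      split; [exact F1|]. split; [exact F2|]. rewrite Cmod_polar by lra.
      set (J := RInt _ t2 t1) in *.
      pose proof (proj1 Hmu t1 ltac:(lra)) as Hm.
      assert (HJ0 : 0 < J) by nra.
      assert (P : 1 / 2 <= t2 ^ n).
      { eapply Rle_trans; [exact Ha2|]. apply pow_incr. lra. }
      apply Rlt_le_trans with (mu t1 * (c0 * (1 / 2) * J)); [nra|].
      apply Rmult_le_compat_l; [exact Hm|]. eapply Rle_trans; [|exact F3].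
      apply Rmult_le_compat_r; [lra|]. apply Rmult_le_compat_l; lra. }
  destruct (choice _ HS) as [p Hp]. set (fs := fun n => fst (p n)).
  clear HS HN HN' HT.
  destruct (HC fs) as (phi & Hphi & hl & Hhl & Hlim).
  { intros n. split; [apply Hp|]. exists C0. apply Hp. }
  { exists C0. intros n. apply Hp. }
  assert (Hge : forall n, (n <= phi n)%nat).
  { induction n; [lia|]. specialize (Hphi n). lia. }
  (* At its own point each image has weighted size above 4e. Uniform convergence up to e and
     pointwise decay keep the limit below 2e, so the image would be at most 3e. *)
  set (e := c0 * eps / 8). assert (Hee : 0 < e) by (apply Rdiv_lt_0_compat; nra).
  destruct (Hlim e Hee) as [N HN].
  assert (Hz : forall z, inD z -> mu (Cmod z) * Cmod (hl z) <= 2 * e).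
  { intros z Dz. pose proof (proj1 Hmu (Cmod z) (conj (Cmod_ge_0 z) Dz)) as Hm.
    (* The 1 allows for a weight that vanishes at z. *)
    assert (Hd : 0 < e / (mu (Cmod z) + 1)) by (apply Rdiv_lt_0_compat; lra).
    destruct (Sg_pointwise_0 fs C0 z ltac:(apply Hp) HC0 Dz ltac:(apply Hp) _ Hd) as [N2 HN2].
    set (n := max N N2).
    specialize (HN2 (phi n)). specialize (Hge n). specialize (HN2 ltac:(lia)).
    specialize (HN n ltac:(lia) z Dz).
    pose proof (Cmod_triangle_minus (Sg g (fs (phi n)) z) (Sg g (fs (phi n)) z - hl z)) as T.
    replace (Sg g (fs (phi n)) z - (Sg g (fs (phi n)) z - hl z))%C with (hl z) in T by ring.
    assert (X : mu (Cmod z) * Cmod (Sg g (fs (phi n)) z) <= e).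
    { apply Rle_trans with ((mu (Cmod z) + 1) * (e / (mu (Cmod z) + 1))).
      - apply Rmult_le_compat; try lra. apply Cmod_ge_0.
      - right. field. lra. }
    nra. }
  destruct (Hp (phi N)) as (_ & Dz & _ & _ & X). set (z := snd (p (phi N))) in *.
  change (fst (p (phi N))) with (fs (phi N)) in X.
  specialize (HN N (le_n N) _ Dz). specialize (Hz _ Dz).
  pose proof (Cmod_triangle (Sg g (fs (phi N)) z - hl z) (hl z)) as T.
  replace (Sg g (fs (phi N)) z - hl z + hl z)%C
    with (Sg g (fs (phi N)) z) in T by ring.
  pose proof (proj1 Hmu _ (conj (Cmod_ge_0 z) Dz)) as Hm.
  unfold e in *. nra.
Qed.

End Weight.

Theorem theorem8 (g : C -> C) (nu mu : R -> R) :
  holo g -> log_in_Bloch g ->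
  analytic_weight nu -> quasi_normal nu ->
  weight mu ->
  (Sg_compact g nu mu <-> limit_condition g nu mu).
Proof.
  intros Hg [_ (h & Hh & Hgh & _ & B & HB)] (Hnu & F & HF & Hinv & Hmax) HQ Hmu.
  assert (HA : aweight nu F) by (split; assumption).
  assert (HB0 : 0 <= B).
  { eapply Rle_trans; [|apply (HB 0%C inD_0)]. rewrite Cmod_0. simpl.
    pose proof (Cmod_ge_0 (cderiv h 0%C)). lra. }
  split.
  - apply (necessity nu F) with (h := h) (B := B); assumption.
  - apply (sufficiency nu F); assumption.
Qed.
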